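(* Assume that for both $b_1=1$ and $b_1=-1$ one has $$\dim\mathfrak{B}\big(M\langle(xy,x)\rangle\oplus W^{b_1,-1}\big)=\infty=\dim\mathfrak{B}\big(M\langle(y,xy)\rangle\oplus W^{b_1,-1}\big).$$ If $M$ is a nonzero object of ${}^{H_8}_{H_8}\mathcal{YD}$ with $\dim\mathfrak{B}(M)<\infty$, then $M$ is isomorphic to one of the following Yetter–Drinfeld modules, whose braidings are of diagonal type of the indicated Cartan types: (1) $\Omega_1(n_1,n_2,n_3,n_4)$ with $n_1+n_2+n_3+n_4\ge 1$, of type $A_1\times\cdots\times A_1$ ($n_1+n_2+n_3+n_4$ factors); (2) $\Omega_2(n_1,n_2)$, $n_1,n_2\ge0$, of type $A_1\times\cdots\times A_1\times A_2$ ($n_1+n_2$ factors $A_1$); (3) $\Omega_3(n_1,n_2)$, $n_1,n_2\ge 0$, of type $A_1\times\cdots\times A_1\times A_2$ ($n_1+n_2$ factors $A_1$); (4) $\Omega_4(n_1,n_2)$, $n_1,n_2\ge 0$, of type $A_1\times\cdots\times A_1\times A_2$ ($n_1+n_2$ factors $A_1$); (5) $\Omega_5(n_1,n_2)$, $n_1,n_2\ge 0$, of type $A_1\times\cdots\times A_1\times A_2$ ($n_1+n_2$ factors $A_1$); (6) $\Omega_6$, of type $A_2\times A_2$; (7) $\Omega_7$, of type $A_2\times A_2$.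
   Context: $\mathbb{K}$ is an algebraically closed field of characteristic $0$ and $\mathrm{i}\in\mathbb{K}$ is a fixed square root of $-1$. $H_8$ (the Kac–Paljutkin algebra) is the $8$-dimensional Hopf algebra over $\mathbb{K}$ generated as an algebra by $x,y,z$ subject to $x^2=y^2=1$, $z^2=\frac12(1+x+y-xy)$, $xy=yx$, $zx=yz$, $zy=xz$, with $\Delta(x)=x\otimes x$, $\Delta(y)=y\otimes y$, $\Delta(z)=\frac12(1\otimes1+1\otimes x+y\otimes1-y\otimes x)(z\otimes z)$, $\varepsilon(x)=\varepsilon(y)=\varepsilon(z)=1$, $S(x)=x$, $S(y)=y$, $S(z)=z$. For $j,k\in\{0,1\}$ put $f_{jk}=\frac14(1+(-1)^jx)(1+(-1)^ky)$. ${}^{H_8}_{H_8}\mathcal{YD}$ is the category of left Yetter–Drinfeld modules over $H_8$: left $H_8$-modules and left $H_8$-comodules $\rho(m)=m_{(-1)}\otimes m_{(0)}$ with $\rho(h\cdot m)=h_{(1)}m_{(-1)}S(h_{(3)})\otimes h_{(2)}\cdot m_{(0)}$; it is braided with $c(v\otimes w)=v_{(-1)}\cdot w\otimes v_{(0)}$. For $M$ in this category, $\mathfrak{B}(M)=\bigoplus_{n\ge0}\mathfrak{B}^n(M)$ is its Nichols algebra: the $\mathbb N$-graded braided Hopf algebra in ${}^{H_8}_{H_8}\mathcal{YD}$ with $\mathfrak{B}^0=\mathbb{K}$, $\mathfrak{B}^1\cong M$, generated by $\mathfrak{B}^1$, whose primitive elements are exactly $\mathfrak{B}^1$ (equivalently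 $T(M)$ modulo the kernels of the quantum symmetrizers built from $c$). A braided vector space $(V,c)$ is of diagonal type if it has a basis $v_1,\dots,v_\theta$ with $c(v_i\otimes v_j)=q_{ij}v_j\otimes v_i$; it is of Cartan type with generalized Cartan matrix $(a_{ij})$ if moreover $q_{ii}\ne1$ and $q_{ij}q_{ji}=q_{ii}^{a_{ij}}$ for $i\ne j$; $A_1\times\cdots\times A_1$, $A_2$, etc. name the corresponding Cartan matrices (disjoint unions of Dynkin diagrams). Yetter–Drinfeld modules (action and coaction given on a basis): - For $(b,g)\in\{(\pm1,1),(\pm1,xy),(\pm\mathrm{i},x),(\pm\mathrm{i},y)\}$: $M\langle b,g\rangle=\mathbb{K}p$ with $x\cdot p=b^2p$, $y\cdot p=b^2p$, $z\cdot p=bp$, $\rho(p)=g\otimes p$. - For $(g_1,g_2)\in\{(xy,x),(y,xy)\}$: $M\langle(g_1,g_2)\rangle$ has basis $p_1,p_2$ with $x\cdot p_1=p_1$, $x\cdot p_2=-p_2$, $y\cdot p_1=-p_1$, $y\cdot p_2=p_2$, $z\cdot p_1=p_2$, $z\cdot p_2=p_1$, $\rho(p_1)=g_1\otimes p_1$, $\rho(p_2)=g_2\otimes p_2$. - For $b_1,b_2\in\{\pm1\}$: $W^{b_1,b_2}$ has basis $p_1,p_2$ with $x\cdot p_1=y\cdot p_1=p_1$, $x\cdot p_2=y\cdot p_2=-p_2$, $z\cdot p_1=b_2p_1$, $z\cdot p_2=-\mathrm{i}b_1b_2p_2$, $\rho(p_1)=(f_{00}-\mathrm{i}b_1f_{11})z\otimes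 p_1+(f_{10}+\mathrm{i}b_1f_{01})z\otimes p_2$, $\rho(p_2)=(f_{00}+\mathrm{i}b_1f_{11})z\otimes p_2+(f_{10}-\mathrm{i}b_1f_{01})z\otimes p_1$. Direct sums: $\Omega_1(n_1,n_2,n_3,n_4)=M\langle\mathrm{i},x\rangle^{\oplus n_1}\oplus M\langle-\mathrm{i},x\rangle^{\oplus n_2}\oplus M\langle\mathrm{i},y\rangle^{\oplus n_3}\oplus M\langle-\mathrm{i},y\rangle^{\oplus n_4}$; $\Omega_2(n_1,n_2)=M\langle\mathrm{i},x\rangle^{\oplus n_1}\oplus M\langle-\mathrm{i},x\rangle^{\oplus n_2}\oplus M\langle(xy,x)\rangle$; $\Omega_3(n_1,n_2)=M\langle\mathrm{i},y\rangle^{\oplus n_1}\oplus M\langle-\mathrm{i},y\rangle^{\oplus n_2}\oplus M\langle(y,xy)\rangle$; $\Omega_4(n_1,n_2)=M\langle\mathrm{i},x\rangle^{\oplus n_1}\oplus M\langle\mathrm{i},y\rangle^{\oplus n_2}\oplus W^{1,-1}$; $\Omega_5(n_1,n_2)=M\langle-\mathrm{i},x\rangle^{\oplus n_1}\oplus M\langle-\mathrm{i},y\rangle^{\oplus n_2}\oplus W^{-1,-1}$; $\Omega_6=M\langle(xy,x)\rangle\oplus M\langle(y,xy)\rangle$; $\Omega_7=W^{1,-1}\oplus W^{-1,-1}$. *)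

(* Defs.v *)
From HB Require Import structures.
From mathcomp Require Import all_boot all_order all_algebra.

Set Implicit Arguments.
Unset Strict Implicit.
Unset Printing Implicit Defensive.

Import Order.TTheory GRing.Theory Num.Theory.
Local Open Scope ring_scope.

(* Basis index (a,b,c) of H_8 stands for the basis element x^a y^b z^c. *)
Definition hb := (bool * bool * bool)%type.

Section H8.
Variable K : fieldType.

Definition sgn (s : bool) : K := if s then -1 else 1.

(* elements of H_8, as coordinate functions on the basis x^a y^b z^c *)
Definition hel := hb -> K.
Definition hel2 := hb -> hb -> K.

Definition hbas (b : hb) : hel := fun p => (p == b)%:R.
Definition hone : hel := hbas (false, false, false).
Definition hx : hel := hbas (true, false, false).
Definition hy : hel := hbas (false, true, false).
Definition hz : hel := hbas (false, false, true).

(* coefficient of x^s y^t in z^2 = 1/2 (1 + x + y - xy) *)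
Definition z2coef (s t : bool) : K := sgn (s && t) / 2%:R.

(* product of two basis elements, using zx = yz, zy = xz, x^2 = y^2 = 1,
   xy = yx, z^2 = 1/2 (1 + x + y - xy) *)
Definition hmul_b (u v : hb) : hel :=
  let: (a, b, c) := u in let: (a', b', c') := v in
  let A := a (+) (if c then b' else a') in
  let B := b (+) (if c then a' else b') in
  fun p => let: (p1, p2, p3) := p in
    if c && c' then (if p3 then 0 else z2coef (p1 (+) A) (p2 (+) B))
    else ((p1 == A) && (p2 == B) && (p3 == c (+) c'))%:R.

Definition hmul (u v : hel) : hel :=
  fun p => \sum_(b : hb) \sum_(b' : hb) u b * v b' * hmul_b b b' p.

Definition tens (u v : hel) : hel2 := fun p q => u p * v q.

Definition tmul (U V : hel2) : hel2 := fun p q =>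
  \sum_(b1 : hb) \sum_(b2 : hb) \sum_(b3 : hb) \sum_(b4 : hb)
    U b1 b2 * V b3 b4 * hmul_b b1 b3 p * hmul_b b2 b4 q.

Definition Dz : hel2 :=
  tmul (fun p q => (tens hone hone p q + tens hone hx p q + tens hy hone p q
                    - tens hy hx p q) / 2%:R) (tens hz hz).

Definition hpow (g : hel) (e : bool) : hel := if e then g else hone.

Definition hcomul (u : hb) : hel2 :=
  let: (a, b, c) := u in
  tmul (tmul (if a then tens hx hx else tens hone hone)
             (if b then tens hy hy else tens hone hone))
       (if c then Dz else tens hone hone).

Definition hcomul3 (u b1 b2 b3 : hb) : K :=
  \sum_(c : hb) hcomul u c b3 * hcomul c b1 b2.

(* antipode: S(x^a y^b z^c) = S(z)^c S(y)^b S(x)^a with S(x)=x, S(y)=y, S(z)=z *)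
Definition hanti (u : hb) : hel :=
  let: (a, b, c) := u in hmul (hmul (hpow hz c) (hpow hy b)) (hpow hx a).

Definition heps (u : hb) : K := 1.

Definition fjk (j k : bool) : hel :=
  hmul (fun p => (hone p + sgn j * hx p) / 4%:R) (fun p => hone p + sgn k * hy p).

(* Finite-dimensional H_8-modules and comodules on K^n (column vectors).
   yact b   = matrix of the action of the basis element b;
   ycoact b = matrix such that rho(m) = \sum_b b (x) (ycoact b *m m). *)
Record ydmod := YDMod {
  ydim : nat;
  yact : hb -> 'M[K]_ydim;
  ycoact : hb -> 'M[K]_ydim }.

Definition is_YD (M : ydmod) : Prop :=
  [/\ yact M (false, false, false) = 1%:M,
      (forall b b', yact M b *m yact M b' = \sum_(p : hb) hmul_b b b' p *: yact M p),
      \sum_(b : hb) heps b *: ycoact M b = 1%:M,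
      (forall b1 b2, ycoact M b2 *m ycoact M b1 = \sum_(b : hb) hcomul b b1 b2 *: ycoact M b)
    & (forall b q, ycoact M q *m yact M b =
        \sum_(b1 : hb) \sum_(b2 : hb) \sum_(b3 : hb) \sum_(d : hb)
          (hcomul3 b b1 b2 b3 * hmul (hmul (hbas b1) (hbas d)) (hanti b3) q)
            *: (yact M b2 *m ycoact M d))].

Definition yd_iso (M N : ydmod) : Prop :=
  exists (f : 'M[K]_(ydim N, ydim M)) (g : 'M[K]_(ydim M, ydim N)),
    [/\ g *m f = 1%:M, f *m g = 1%:M,
        (forall b, f *m yact M b = yact N b *m f)
      & (forall b, f *m ycoact M b = ycoact N b *m f)].

Definition ydsum (M N : ydmod) : ydmod :=
  @YDMod (ydim M + ydim N)
    (fun b => block_mx (yact M b) 0 0 (yact N b))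
    (fun b => block_mx (ycoact M b) 0 0 (ycoact N b)).

Definition yd0 : ydmod := @YDMod 0 (fun _ => 0) (fun _ => 0).

Fixpoint ydpow (M : ydmod) (k : nat) : ydmod :=
  match k with 0 => yd0 | k'.+1 => ydsum M (ydpow M k') end.

Definition act_gen n (X Y Z : 'M[K]_n) : hb -> 'M[K]_n := fun u =>
  let: (a, b, c) := u in
  (if a then X else 1%:M) *m (if b then Y else 1%:M) *m (if c then Z else 1%:M).

Definition mx2 (a b c d : K) : 'M[K]_2 :=
  \matrix_(r < 2, s < 2)
    if r == 0 :> nat then (if s == 0 :> nat then a else b)
    else (if s == 0 :> nat then c else d).

(* Braiding and Nichols algebra.  Basis of M^{(x) k}: words of length k
   over 'I_n; linear maps are kernels  out-word -> in-word -> K.        *)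
Section Nichols.
Variable M : ydmod.
Local Notation n := (ydim M).
Local Notation word := (seq 'I_n).
Definition wmap := word -> word -> K.

(* c(e_p (x) e_q) = \sum_{r,s} cmat r s p q  e_r (x) e_s,
   where c(v (x) w) = v_(-1) . w (x) v_(0) *)
Definition cmat (r s p q : 'I_n) : K :=
  \sum_(b : hb) yact M b r q * ycoact M b s p.

(* c acting on tensor positions j, j+1 (0-indexed) *)
Definition braid_at (j : nat) : wmap := fun u w =>
  match drop j u, drop j w with
  | r :: s :: u', p :: q :: w' =>
      ((take j u == take j w) && (u' == w'))%:R * cmat r s p q
  | _, _ => 0
  end.

Definition idw : wmap := fun u w => (u == w)%:R.

Definition compw (k : nat) (A B : wmap) : wmap := fun u w =>
  \sum_(v : k.-tuple 'I_n) A u v * B v w.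

(* chain m l = c_{m-1} c_{m-2} ... c_{m-l}  (c_j acts on positions j, j+1,
   1-indexed) *)
Fixpoint chain (m l : nat) : wmap :=
  match l with
  | 0 => idw
  | l'.+1 => compw m (chain m l') (braid_at (m - 2 - l'))
  end.

Definition tsym (m : nat) : wmap := fun u w => \sum_(l < m) chain m l u w.

(* quantum symmetrizer: Omega_1 = id, Omega_k = (Omega_{k-1} (x) id) T_k,
   which equals \sum_{sigma in S_k} of the Matsumoto lifts of sigma *)
Fixpoint qsym (k : nat) : wmap :=
  match k with
  | 0 => idw
  | k'.+1 => fun u w =>
      \sum_(v : k'.+1.-tuple 'I_n)
        (qsym k' (take k' u) (take k' v) * (drop k' u == drop k' v)%:R)
        * tsym k'.+1 v w
  end.

(* B^k(M) = M^{(x) k} / ker Omega_k; dim B(M) < oo  iff  B^k(M) = 0 for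
   all large k, i.e. Omega_k = 0 for all large k. *)
Definition fin_nichols : Prop :=
  exists N : nat, forall k : nat, (N <= k)%N ->
    forall u w : k.-tuple 'I_n, qsym k u w = 0.

(* braiding of diagonal type, of Cartan type with generalized Cartan
   matrix A, w.r.t. some basis v_1..v_theta (the columns of P) *)
Definition cartan_type (theta : nat) (A : 'M[int]_theta) : Prop :=
  exists (P : 'M[K]_(n, theta)) (Q : 'M[K]_(theta, n)) (qm : 'M[K]_theta),
    [/\ Q *m P = 1%:M, P *m Q = 1%:M,
        (forall (i j : 'I_theta) (r s : 'I_n),
           \sum_(p : 'I_n) \sum_(q : 'I_n) cmat r s p q * P p i * P q j
           = qm i j * (P r j * P s i)),
        (forall i : 'I_theta, qm i i != 1)
      & (forall i j : 'I_theta, i != j -> qm i j * qm j i = qm i i ^ (A i j))].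

End Nichols.

Definition g1 : hb := (false, false, false).
Definition gxy : hb := (true, true, false).
Definition gx : hb := (true, false, false).
Definition gy : hb := (false, true, false).

Definition Mbg (bb : K) (g : hb) : ydmod :=
  @YDMod 1 (act_gen (bb ^+ 2)%:M (bb ^+ 2)%:M bb%:M) (fun q => (q == g)%:R%:M).

Definition Mpair (h1 h2 : hb) : ydmod :=
  @YDMod 2 (act_gen (mx2 1 0 0 (-1)) (mx2 (-1) 0 0 1) (mx2 0 1 1 0))
    (fun q => mx2 (q == h1)%:R 0 0 (q == h2)%:R).

(* W^{b1,b2}, where i is the fixed square root of -1 *)
Definition W (i b1 b2 : K) : ydmod :=
  let u f g (s : K) := hmul (fun p => f p + s * i * b1 * g p) hz in
  let u11 := u (fjk false false) (fjk true true) (-1) in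
  let u21 := u (fjk true false) (fjk false true) 1 in
  let u22 := u (fjk false false) (fjk true true) 1 in
  let u12 := u (fjk true false) (fjk false true) (-1) in
  @YDMod 2 (act_gen (mx2 1 0 0 (-1)) (mx2 1 0 0 (-1)) (mx2 b2 0 0 (- i * b1 * b2)))
    (fun q => mx2 (u11 q) (u12 q) (u21 q) (u22 q)).

Definition Omega1 (i : K) (n1 n2 n3 n4 : nat) : ydmod :=
  ydsum (ydpow (Mbg i gx) n1) (ydsum (ydpow (Mbg (- i) gx) n2)
    (ydsum (ydpow (Mbg i gy) n3) (ydpow (Mbg (- i) gy) n4))).
Definition Omega2 (i : K) (n1 n2 : nat) : ydmod :=
  ydsum (ydpow (Mbg i gx) n1) (ydsum (ydpow (Mbg (- i) gx) n2) (Mpair gxy gx)).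
Definition Omega3 (i : K) (n1 n2 : nat) : ydmod :=
  ydsum (ydpow (Mbg i gy) n1) (ydsum (ydpow (Mbg (- i) gy) n2) (Mpair gy gxy)).
Definition Omega4 (i : K) (n1 n2 : nat) : ydmod :=
  ydsum (ydpow (Mbg i gx) n1) (ydsum (ydpow (Mbg i gy) n2) (W i 1 (-1))).
Definition Omega5 (i : K) (n1 n2 : nat) : ydmod :=
  ydsum (ydpow (Mbg (- i) gx) n1) (ydsum (ydpow (Mbg (- i) gy) n2) (W i (-1) (-1))).
Definition Omega6 : ydmod := ydsum (Mpair gxy gx) (Mpair gy gxy).
Definition Omega7 (i : K) : ydmod := ydsum (W i 1 (-1)) (W i (-1) (-1)).

End H8.

(* Cartan matrices (up to relabelling of the basis, which is absorbed by
   the existential basis in cartan_type). *)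
Definition cartanA1s (m : nat) : 'M[int]_m :=
  \matrix_(i < m, j < m) if i == j then (2 : int) else (0 : int).
(* A_2 x A_1 x ... x A_1 (m factors A_1); the A_2 block on indices 0,1 *)
Definition cartanA2A1s (m : nat) : 'M[int]_(m.+2) :=
  \matrix_(i < m.+2, j < m.+2)
    if i == j then (2 : int) else if (i + j == 1)%N then (-1 : int) else (0 : int).
Definition cartanA2A2 : 'M[int]_4 :=
  \matrix_(i < 4, j < 4)
    if i == j then (2 : int) else if (i./2 == j./2)%N then (-1 : int) else (0 : int).

(* Main.v *)
(* If M is a Yetter-Drinfeld module with finite-dimensional Nichols algebra, then
   every braided subspace of M, and every braided space obtained from one by
   twisting with a symmetry, has a finite-dimensional Nichols algebra. The relations
   of the Drinfeld double cut M into blocks on which x, y and the coaction are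
   explicit. A vector v with c (v (x) v) = v (x) v cannot exist in characteristic 0,
   nor can, on the block carried by the 4-dimensional subcoalgebra with xy = -1, a
   twisted braiding of affine type A_1; this leaves the lines M<+-i, x>, M<+-i, y>,
   the two planes M<(g_1, g_2)> and the two planes W^{b, -1}, and M is the direct sum
   of copies of these. Their braidings are diagonal with all q_ii = -1, and an
   incompatible pair of summands produces a triangle or a square of affine Cartan
   type A_2 or A_3, or a sum that is infinite-dimensional by assumption.

   Affine braidings are excluded by a direct computation with skew derivations: an
   element u of imaginary degree delta is found which is killed by all derivations but
   one; since q_delta = 1, the composite f of derivations of degree delta acts on the
   powers of u as an ordinary derivation, so f^k (u^k) = k! f(u)^k is nonzero. *)
Require Import Defs.
From HB Require Import structures.
From mathcomp Require Import all_boot all_order all_algebra.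
From mathcomp Require Import ring.
Import Order.TTheory GRing.Theory Num.Theory.
Local Open Scope ring_scope.
Set Implicit Arguments.
Unset Strict Implicit.
Unset Printing Implicit Defensive.

(** Nichols algebras enter only through their symmetrizers, as operators on coordinate functions of
    words; no braided Hopf algebra is built. For a diagonal braiding the component of [T_k] with
    last letter i is a skew derivation, so a coefficient of a symmetrized tensor is an iterated
    derivative, and infinite dimension amounts to nonzero derivatives in arbitrarily high degree.
    This replaces an appeal to the classification of arithmetic root systems: a point with q = 1 and
    the affine diagrams A_1, A_2, A_3 suffice, each with an explicit u. The braiding fails to be
    diagonal in two places. Where xy = -1 on the four-dimensional subcoalgebra, c also swaps two
    basis vectors, which a change of basis depending on the tensor position undoes. Between W and
    M<(g_1, g_2)>, z permutes the basis of the latter, and there the hypothesis takes over.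
    Semisimplicity is not quoted: the identity of M is a sum of twenty explicit joint
    eigenprojectors, twelve of which vanish by finiteness; the others are refined by eigenvalues i
    and -i where needed. *)

Section TupleSums.
Variables (R : nmodType) (L : finType).

Lemma big_tuple_cons k (F : seq L -> R) :
  \sum_(v : k.+1.-tuple L) F v = \sum_(a : L) \sum_(v : k.-tuple L) F (a :: v).
Proof.
rewrite pair_bigA /= (reindex (fun p : L * k.-tuple L => [tuple of p.1 :: p.2])) //=.
exists (fun v => (thead v, [tuple of behead v])) => [[a v] _ | v _] /=.
  by rewrite theadE; congr pair; apply: val_inj.
by apply: val_inj; rewrite /= [in RHS](tuple_eta v).
Qed.
Arguments big_tuple_cons {k} F.

Lemma big_tuple_rcons k (F : seq L -> R) :
  \sum_(v : k.+1.-tuple L) F v = \sum_(v : k.-tuple L) \sum_(a : L) F (rcons v a).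
Proof.
elim: k F => [|k IH] F.
  rewrite big_tuple_cons exchange_big /=; apply: eq_bigr => v _.
  by apply: eq_bigr => a _; rewrite (tuple0 v).
rewrite big_tuple_cons.
under eq_bigr do rewrite (IH (fun v => F (_ :: v))).
by rewrite (big_tuple_cons (fun v => \sum_a F (rcons v a))).
Qed.

End TupleSums.
Arguments big_tuple_cons {R L k} F.
Arguments big_tuple_rcons {R L k} F.

(** * Quantum symmetrizers as operators on tensors *)

Section Operators.
Variables (K : fieldType) (L : finType) (c : L -> L -> L -> L -> K).
Implicit Types (phi : seq L -> K) (u v w : seq L).

(* The operators below act on tensors, seen as functions on words. *)
Definition braid_op j phi : seq L -> K := fun u =>
  if drop j u is r :: s :: u' then
    \sum_p \sum_q c r s p q * phi (take j u ++ p :: q :: u')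
  else 0.

Fixpoint chain_op m l phi : seq L -> K :=
  if l is l'.+1 then chain_op m l' (braid_op (m - 2 - l') phi) else phi.

Definition tsym_op m phi : seq L -> K := fun u => \sum_(l < m) chain_op m l phi u.

Fixpoint qsym_op k phi : seq L -> K := fun u =>
  if k is k'.+1 then
    qsym_op k' (fun v => tsym_op k'.+1 phi (v ++ drop k' u)) (take k' u)
  else phi u.

Lemma eq_braid_op j m phi psi : (forall u, size u = m -> phi u = psi u) ->
  forall u, size u = m -> braid_op j phi u = braid_op j psi u.
Proof.
move=> H u su; rewrite /braid_op; have := cat_take_drop j u.
case: (drop j u) => [|r [|s u']] // e.
apply: eq_bigr => p _; apply: eq_bigr => q _; congr (_ * _); apply: H.
by rewrite -su -[in RHS]e !size_cat.
Qed.

Lemma eq_chain_op m l n phi psi : (forall u, size u = n -> phi u = psi u) ->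
  forall u, size u = n -> chain_op m l phi u = chain_op m l psi u.
Proof.
elim: l phi psi => [|l IH] phi psi H //=.
by apply: IH; apply: eq_braid_op.
Qed.

Lemma eq_tsym_op m n phi psi : (forall u, size u = n -> phi u = psi u) ->
  forall u, size u = n -> tsym_op m phi u = tsym_op m psi u.
Proof. by move=> H u su; apply: eq_bigr => l _; apply: (eq_chain_op _ _ H). Qed.

Lemma eq_qsym_op k phi psi : (forall u, size u = k -> phi u = psi u) ->
  forall u, size u = k -> qsym_op k phi u = qsym_op k psi u.
Proof.
elim: k phi psi => [|k IH] phi psi H u su /=; first exact: H.
apply: IH => [v sv|]; last by rewrite size_take su ltnS leqnn.
by apply: (eq_tsym_op _ H); rewrite size_cat size_drop su subSnn sv addn1.
Qed.

End Operators.

Section Kernels.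
Variables (K : fieldType) (M : ydmod K).
Local Notation n := (ydim M).
Local Notation c := (@cmat K M).

Lemma braid_atE j k (u : seq 'I_n) (phi : seq 'I_n -> K) :
  size u = k -> (j + 2 <= k)%N ->
  \sum_(v : k.-tuple 'I_n) braid_at j u v * phi v = braid_op c j phi u.
Proof.
elim: j k u phi => [|j IH] [|k] [|r u] //= phi [su] jk.
  case: k su jk => [|k]; case: u => [|s u] //= [su] _.
  rewrite (big_tuple_cons (fun v => braid_at 0 (r :: s :: u) v * phi v)).
  rewrite /braid_op /=; apply: eq_bigr => p _.
  rewrite (big_tuple_cons (fun v => braid_at 0 (r :: s :: u) (p :: v) * phi (p :: v))).
  apply: eq_bigr => q _.
  have st : size u == k by apply/eqP.
  rewrite (bigD1 (Tuple st)) //= big1 ?addr0.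
    by rewrite /braid_at /= !eqxx mul1r.
  move=> v /negPf; rewrite -val_eqE /= /braid_at /= [u == v]eq_sym => ->.
  by rewrite ?andbF !mul0r.
rewrite (big_tuple_cons (fun v => braid_at j.+1 (r :: u) v * phi v)).
have bE a v : braid_at j.+1 (r :: u) (a :: v) = (r == a)%:R * @braid_at K M j u v.
  rewrite /braid_at /=; case: (drop j u) => [|? [|? ?]] //=; rewrite ?mulr0 //.
  case: (drop j v) => [|? [|? ?]] //=; rewrite ?mulr0 // eqseq_cons.
  by case: (r == a); rewrite ?mul1r ?mul0r //= mul0r.
rewrite (bigD1 r) //= [X in _ + X]big1 ?addr0; last first.
  move=> a /negPf ar; apply: big1 => v _; rewrite bE.
  by rewrite [r == a]eq_sym ar !mul0r.
under eq_bigr do rewrite bE eqxx mul1r.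
rewrite (IH k u (fun v => phi (r :: v))) //.
Qed.

Lemma chainE m l (u : seq 'I_n) (phi : seq 'I_n -> K) :
  size u = m -> (l < m)%N ->
  \sum_(v : m.-tuple 'I_n) @chain K M m l u v * phi v = chain_op c m l phi u.
Proof.
elim: l u phi => [|l IH] u phi su lm /=.
  have st : size u == m by apply/eqP.
  rewrite (bigD1 (Tuple st)) //= big1 ?addr0; first by rewrite /idw eqxx mul1r.
  by move=> v /negPf; rewrite -val_eqE /= /idw eq_sym => ->; rewrite mul0r.
rewrite -IH //; last exact: ltnW.
under eq_bigr do rewrite /compw big_distrl /=.
rewrite exchange_big /=; apply: eq_bigr => v _.
under eq_bigr do rewrite -mulrA.
rewrite -big_distrr /= (@braid_atE _ m) ?size_tuple //.
(* Since [l.+1 < m], the truncated subtraction in the position [m - 2 - l] is exact. *)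
by case: m {IH su v} lm => [|[|m]] //= _; rewrite subSS subSS subn0 addn2 !ltnS leq_subr.
Qed.

Lemma qsymE k (u : seq 'I_n) (phi : seq 'I_n -> K) :
  size u = k ->
  \sum_(v : k.-tuple 'I_n) @qsym K M k u v * phi v = qsym_op c k phi u.
Proof.
elim: k u phi => [|k IH] u phi su /=.
  have st : size u == 0%N by apply/eqP.
  rewrite (bigD1 (Tuple st)) //= big1 ?addr0; first by rewrite /idw eqxx mul1r.
  by move=> v /negPf; rewrite -val_eqE /= /idw eq_sym => ->; rewrite mul0r.
under eq_bigr do rewrite big_distrl /=.
rewrite exchange_big /=.
have tE (v : k.+1.-tuple 'I_n) :
    \sum_(w : k.+1.-tuple 'I_n) @tsym K M k.+1 v w * phi w = tsym_op c k.+1 phi v.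
  rewrite /tsym /tsym_op; under eq_bigr do rewrite big_distrl /=.
  by rewrite exchange_big /=; apply: eq_bigr => l _; rewrite chainE ?size_tuple.
under eq_bigr do (under eq_bigr do rewrite -mulrA; rewrite -big_distrr /= tE).
rewrite (big_tuple_rcons (fun v => @qsym K M k (take k u) (take k v)
   * (drop k u == drop k v)%:R * tsym_op c k.+1 phi v)).
case/lastP: u su => [//|u a]; rewrite size_rcons => [[su]].
rewrite -cats1 take_cat drop_cat su ltnn subnn /= cats0.
rewrite -(IH u (fun v => tsym_op c k.+1 phi (v ++ [:: a]))) //.
apply: eq_bigr => v _; rewrite (bigD1 a) //= big1 ?addr0 => [|b ba].
  by rewrite -cats1 take_cat drop_cat size_tuple ltnn subnn /= cats0 eqxx mulr1.
rewrite -cats1 take_cat drop_cat size_tuple ltnn subnn /= cats0.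
by rewrite eqseq_cons eq_sym (negPf ba) mulr0 mul0r.
Qed.

(** Indicator functions of words recover the kernel from the operator, so [fin_nichols] can be
    tested on tensors. *)
Lemma qsym_eq0 k : (forall u w : k.-tuple 'I_n, @qsym K M k u w = 0) <->
  (forall phi u, size u = k -> qsym_op c k phi u = 0).
Proof.
split=> H => [phi u su | u w].
  rewrite -qsymE // big1 // => v _.
  have st : size u == k by apply/eqP.
  by rewrite (H (Tuple st) v) mul0r.
have := H (fun v => (v == w)%:R) u (size_tuple u).
rewrite -qsymE ?size_tuple // (bigD1 w) //= eqxx mulr1 big1 ?addr0 // => v.
by rewrite -val_eqE /= => /negPf->; rewrite mulr0.
Qed.

End Kernels.

(** * Linearity of the symmetrizer operators *)

Section BraidSum.
Variables (K : fieldType) (L I : finType) (c : L -> L -> L -> L -> K).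
Variables (al : I -> K) (psi : I -> seq L -> K).
Implicit Types (phi : seq L -> K) (u v w : seq L).
Local Notation comb F := (fun u => \sum_i al i * F i u).

Lemma braid_op_sum j phi m : (forall u, size u = m -> phi u = comb psi u) ->
  forall u, size u = m -> braid_op c j phi u = comb (fun i => braid_op c j (psi i)) u.
Proof.
move=> H u su; rewrite (eq_braid_op c j H su) /braid_op /=.
case: (drop j u) => [|r [|s u']]; try by rewrite big1 // => i _; rewrite mulr0.
under [RHS]eq_bigr do rewrite big_distrr /=.
rewrite [RHS]exchange_big /=; apply: eq_bigr => p _.
under [RHS]eq_bigr do rewrite big_distrr /=.
rewrite [RHS]exchange_big /=; apply: eq_bigr => q _.
by rewrite big_distrr /=; apply: eq_bigr => i _; rewrite mulrCA.
Qed.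

End BraidSum.

Section OperatorSums.
Variables (K : fieldType) (L I : finType) (c : L -> L -> L -> L -> K) (al : I -> K).
Implicit Types (phi : seq L -> K) (u v w : seq L).
Local Notation comb F := (fun u => \sum_i al i * F i u).

Lemma chain_op_sum m l n phi psi : (forall u, size u = n -> phi u = comb psi u) ->
  forall u, size u = n ->
  chain_op c m l phi u = comb (fun i => chain_op c m l (psi i)) u.
Proof.
elim: l phi psi => [|l IH] phi psi H //=.
by apply: IH; apply: braid_op_sum.
Qed.

Lemma tsym_op_sum m n phi psi : (forall u, size u = n -> phi u = comb psi u) ->
  forall u, size u = n -> tsym_op c m phi u = comb (fun i => tsym_op c m (psi i)) u.
Proof.
move=> H u su; rewrite /tsym_op.
under eq_bigr do rewrite (chain_op_sum _ _ H su) /=.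
by rewrite exchange_big /=; apply: eq_bigr => i _; rewrite big_distrr.
Qed.

Lemma qsym_op_sum k phi psi : (forall u, size u = k -> phi u = comb psi u) ->
  forall u, size u = k -> qsym_op c k phi u = comb (fun i => qsym_op c k (psi i)) u.
Proof.
elim: k phi psi => [|k IH] phi psi H u su /=; first exact: H.
apply: (IH _ (fun i v => tsym_op c k.+1 (psi i) (v ++ drop k u))).
  move=> v sv; apply: (tsym_op_sum _ H).
  by rewrite size_cat size_drop su subSnn sv addn1.
by rewrite size_take su ltnS leqnn.
Qed.

End OperatorSums.

(** * Changes of basis that depend on the tensor position *)

Section Push.
Variables (K : fieldType) (L L' : finType) (P : nat -> L -> L' -> K).

(* [push o] is P_o (x) P_(o+1) (x) ... on tensors. *)
Fixpoint push o (phi : seq L' -> K) (u : seq L) : K :=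
  if u is a :: u1 then \sum_a' P o a a' * push o.+1 (fun v => phi (a' :: v)) u1
  else phi [::].

Lemma eq_push o phi psi u : (forall v, size v = size u -> phi v = psi v) ->
  push o phi u = push o psi u.
Proof.
elim: u o phi psi => [|a u IH] o phi psi H /=; first exact: H.
apply: eq_bigr => a' _; congr (_ * _); apply: IH => v sv; apply: H.
by rewrite /= sv.
Qed.

Lemma push_cat o phi u1 u2 : push o phi (u1 ++ u2) =
  push o (fun v1 => push (o + size u1) (fun v2 => phi (v1 ++ v2)) u2) u1.
Proof.
elim: u1 o phi => [|a u1 IH] o phi /=; first by rewrite addn0.
by apply: eq_bigr => a' _; rewrite IH addnS.
Qed.

Lemma push_sum (I : finType) o (al : I -> K) psi u :
  push o (fun v => \sum_i al i * psi i v) u = \sum_i al i * push o (psi i) u.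
Proof.
elim: u o psi => [|a u IH] o psi //=.
under [RHS]eq_bigr do rewrite big_distrr /=.
rewrite exchange_big /=; apply: eq_bigr => a' _; rewrite IH big_distrr /=.
by apply: eq_bigr => i _; rewrite mulrCA.
Qed.

Lemma push0 o u : push o (fun _ => 0) u = 0.
Proof. by elim: u o => [|a u IH] o //=; apply: big1 => a' _; rewrite IH mulr0. Qed.

End Push.

Lemma pushK (K : fieldType) (L L' : finType) (P : nat -> L -> L' -> K)
    (G : nat -> L' -> L -> K) o phi u :
  (forall j b a', \sum_a G j b a * P j a a' = (b == a')%:R) ->
  push G o (push P o phi) u = phi u.
Proof.
move=> H; elim: u o phi => [|b u IH] o phi //=.
under eq_bigr do rewrite (push_sum _ _ _ (fun a' v => push P o.+1 (fun v' => phi (a' :: v')) v)) big_distrr /=.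
rewrite exchange_big /= (bigD1 b) //= [X in _ + X]big1 ?addr0 => [|a' /negPf ba].
  under eq_bigr do rewrite mulrA.
  by rewrite -big_distrl /= H eqxx mul1r IH.
under eq_bigr do rewrite mulrA.
by rewrite -big_distrl /= H eq_sym ba mul0r.
Qed.

(* The maps P_j may depend on the tensor position j: a constant family embeds a
   braided subspace, while an alternating one untwists a braiding. *)
Section Intertwine.
Variables (K : fieldType) (L L' : finType) (P : nat -> L -> L' -> K).
Variables (c : L -> L -> L -> L -> K) (c' : L' -> L' -> L' -> L' -> K).
Hypothesis cP : forall j r s p' q',
  \sum_p \sum_q c r s p q * (P j p p' * P j.+1 q q') =
  \sum_r' \sum_s' P j r r' * P j.+1 s s' * c' r' s' p' q'.

Lemma braid_push j o phi u : (j + 2 <= size u)%N ->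
  braid_op c j (push P o phi) u = push P o (braid_op c' j phi) u.
Proof.
move=> ju; have sj : size (take j u) = j.
  by rewrite size_take; case: ltnP => // /(leq_trans ju); rewrite addn2 ltnNge leqnSn.
have := cat_take_drop j u; rewrite /braid_op; case E: (drop j u) => [|r [|s u']].
- by move/(congr1 size); rewrite size_cat sj addn0 => e; move: ju; rewrite -e addn2 ltnNge leqnSn.
- by move/(congr1 size); rewrite size_cat sj => e; move: ju; rewrite -e addn1 addn2 ltnn.
move=> e; rewrite -[in RHS]e [RHS]push_cat sj {e}.
transitivity (push P o (fun v1 => \sum_(x : L * L) c r s x.1 x.2 *
  push P (o + j) (fun v2 => phi (v1 ++ v2)) (x.1 :: x.2 :: u')) (take j u)).
  rewrite pair_bigA /= (push_sum _ _ _ (fun (x : L * L) v1 => _)).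
  by apply: eq_bigr => x _; congr (_ * _); rewrite [LHS]push_cat sj.
apply: eq_push => v1 sv1; rewrite /= {ju E}.
(* With the rest of the tensor frozen in [A], both sides are sums over two letters, to which [cP]
   applies. *)
pose A p' q' := push P (o + j).+2 (fun v => phi (v1 ++ [:: p', q' & v])) u'.
transitivity (\sum_p' \sum_q' (\sum_p \sum_q c r s p q * (P (o + j) p p' * P (o + j).+1 q q')) * A p' q').
  rewrite -(pair_bigA _ (fun p q => c r s p q * (\sum_a' P (o + j) p a' *
    \sum_a'0 P (o + j).+1 q a'0 * A a' a'0))) /=.
  under eq_bigr do under eq_bigr do rewrite big_distrr /=.
  under eq_bigr do rewrite exchange_big /=.
  rewrite exchange_big /=; apply: eq_bigr => p' _.
  under eq_bigr do under eq_bigr do rewrite !big_distrr /=.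
  under eq_bigr do rewrite exchange_big /=.
  rewrite exchange_big /=; apply: eq_bigr => q' _.
  rewrite big_distrl /=; apply: eq_bigr => p _.
  by rewrite big_distrl /=; apply: eq_bigr => q _; rewrite !mulrA.
transitivity (\sum_r' P (o + j) r r' * \sum_s' P (o + j).+1 s s' * \sum_p' \sum_q' c' r' s' p' q' * A p' q').
  under eq_bigr do under eq_bigr do rewrite cP.
  under [RHS]eq_bigr do rewrite big_distrr /=.
  rewrite (pair_bigA _ (fun p' q' => (\sum_r' \sum_s' P (o + j) r r' * P (o + j).+1 s s' * c' r' s' p' q') * A p' q')) /=.
  under eq_bigr do rewrite big_distrl /=.
  rewrite exchange_big /=; apply: eq_bigr => r' _.
  under eq_bigr do rewrite big_distrl /=.
  rewrite exchange_big /=; apply: eq_bigr => s' _.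
  rewrite (pair_bigA _ (fun p' q' => c' r' s' p' q' * A p' q')) /= mulrA big_distrr /=.
  by apply: eq_bigr => x _; rewrite !mulrA.
apply: eq_bigr => r' _; congr (_ * _); apply: eq_bigr => s' _; congr (_ * _).
rewrite (pair_bigA _ (fun p' q' => c' r' s' p' q' * A p' q')) /= -(push_sum _ _ _ (fun (x : L' * L') v => _)).
apply: eq_push => v _.
have sv : size (take j u) = size v1 by rewrite sv1.
by rewrite -sj sv drop_size_cat // take_size_cat // pair_bigA.
Qed.

Lemma chain_push m l o phi u : size u = m -> (l < m)%N ->
  chain_op c m l (push P o phi) u = push P o (chain_op c' m l phi) u.
Proof.
elim: l phi u => [|l IH] phi u su lm //=.
rewrite -IH //; last exact: ltnW.
apply: (eq_chain_op c m l _ su) => v sv; apply: braid_push.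
by case: m {IH su} sv lm => [|[|m]] //= -> _; rewrite subSS subSS subn0 addn2 !ltnS leq_subr.
Qed.

Lemma tsym_push m o phi u : size u = m ->
  tsym_op c m (push P o phi) u = push P o (tsym_op c' m phi) u.
Proof.
move=> su; rewrite /tsym_op.
under eq_bigr do rewrite chain_push //.
have := push_sum P o (fun=> 1) (fun l : 'I_m => chain_op c' m l phi) u.
under [in X in _ = X -> _]eq_bigr do rewrite mul1r.
by move<-; apply: eq_push => v _; apply: eq_bigr => l _; rewrite mul1r.
Qed.

Lemma qsym_push k o phi u : size u = k ->
  qsym_op c k (push P o phi) u = push P o (qsym_op c' k phi) u.
Proof.
elim: k phi u => [|k IH] phi u su.
  by move/size0nil: su => ->.
case/lastP: u su => [//|u a]; rewrite size_rcons => [[su]].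
rewrite /= -cats1 take_size_cat // drop_size_cat // push_cat su.
(* Once the last letter a is fixed, its transport by [P (o + k)] leaves a combination, over a', of
   tensors in the first k factors; linearity of [qsym_op] then gives the induction. *)
pose psi v := \sum_a' P (o + k) a a' * tsym_op c' k.+1 phi (v ++ [:: a']).
transitivity (qsym_op c k (push P o psi) u).
  apply: eq_qsym_op => // v sv; rewrite tsym_push ?size_cat ?sv ?addn1 //.
  by rewrite push_cat sv.
rewrite IH //; apply: eq_push => v sv /=.
rewrite (@qsym_op_sum _ _ _ c' (fun a' => P (o + k) a a') k psi
  (fun a' v => tsym_op c' k.+1 phi (v ++ [:: a']))) ?sv //.
by apply: eq_bigr => a' _; rewrite -su -sv take_size_cat // drop_size_cat.
Qed.

Lemma qsym_op_transfer G k :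
  (forall j b a', \sum_a G j b a * P j a a' = (b == a')%:R) ->
  (forall phi u, size u = k -> qsym_op c k phi u = 0) ->
  forall phi u, size u = k -> qsym_op c' k phi u = 0.
Proof.
move=> GP H phi u su; rewrite -[LHS](pushK 0 _ _ GP).
rewrite -[RHS](push0 G 0 u); apply: eq_push => v sv.
by rewrite -qsym_push ?H // sv.
Qed.

End Intertwine.

(** * Diagonal braidings and skew derivations *)

Section Diagonal.
Variables (K : fieldType) (L : finType) (Q : L -> L -> K).
Implicit Types (phi : seq L -> K) (u v w : seq L).

Definition diag_br (r s p q : L) : K := ((r == q) && (s == p))%:R * Q p q.

Fixpoint chi i w : K := if w is r :: w' then Q i r * chi i w' else 1.

Lemma chi_cat i v w : chi i (v ++ w) = chi i v * chi i w.
Proof. by elim: v => [|a v IH] /=; rewrite ?mul1r // IH mulrA. Qed.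

(* The skew derivation [D_i (ab) = a D_i(b) + chi_i(b) D_i(a) b] dual to the
   letter i. *)
Definition skewder i phi v : K :=
  \sum_(p < (size v).+1) chi i (drop p v) * phi (take p v ++ i :: drop p v).

Fixpoint skewders D phi : seq L -> K :=
  if D is i :: D' then skewders D' (skewder i phi) else phi.

Lemma eq_skewder i m phi psi : (forall v, size v = m.+1 -> phi v = psi v) ->
  forall v, size v = m -> skewder i phi v = skewder i psi v.
Proof.
move=> H v sv; apply: eq_bigr => p _; congr (_ * _); apply: H.
by rewrite size_cat /= addnS -size_cat cat_take_drop sv.
Qed.

Lemma eq_skewders D m phi psi :
  (forall v, size v = (size D + m)%N -> phi v = psi v) ->
  forall v, size v = m -> skewders D phi v = skewders D psi v.
Proof.
elim: D phi psi => [|i D IH] phi psi H v sv /=; first exact: H.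
by apply: IH sv => w sw; apply: (eq_skewder _ _ sw) => w' sw'; apply: H.
Qed.

Lemma braid_diag t phi r s u :
  braid_op diag_br (size t) phi (t ++ [:: r, s & u]) = Q s r * phi (t ++ [:: s, r & u]).
Proof.
rewrite /braid_op drop_size_cat // take_size_cat // (bigD1 s) //=.
rewrite [X in _ + X]big1 ?addr0 => [|p /negPf ps].
  rewrite (bigD1 r) //= [X in _ + X]big1 ?addr0 => [|q /negPf qr].
    by rewrite /diag_br !eqxx mul1r.
  by rewrite /diag_br eq_sym qr !mul0r.
by apply: big1 => q _; rewrite /diag_br [s == p]eq_sym ps andbF !mul0r.
Qed.

(** The chain carries the letter in position [size v - l] to the end; it passes every letter behind
    it and collects [chi i] of them. *)
Lemma chain_diag l phi v i : (l <= size v)%N ->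
  chain_op diag_br (size v).+1 l phi (rcons v i) =
  chi i (drop (size v - l) v) * phi (take (size v - l) v ++ i :: drop (size v - l) v).
Proof.
elim: l phi => [|l IH] phi lv /=.
  by rewrite subn0 drop_size take_size mul1r cats1.
rewrite IH; last exact: ltnW.
have [r [t [w [ev st]]]] : exists r t w, v = t ++ r :: w /\ size t = (size v - l.+1)%N.
  have [r0 _] : exists r0 : L, true by case: (v) lv => [//|r0 ? _]; exists r0.
  exists (nth r0 v (size v - l.+1)), (take (size v - l.+1) v), (drop (size v - l.+1).+1 v).
  rewrite -drop_nth ?cat_take_drop ?ltn_subrL //; last by case: (v) lv.
  by rewrite size_take_min (minn_idPl _) // leq_subr.
have e1 : (size v - l)%N = (size t).+1 by rewrite st subnSK.
have e2 : ((size v).+1 - 2 - l)%N = size t by rewrite subSS -subnDA add1n.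
rewrite -st e1 e2 ev -cat_rcons.
rewrite take_size_cat ?size_rcons // drop_size_cat ?size_rcons // cat_rcons.
rewrite cat_rcons take_size_cat // drop_size_cat // braid_diag /=.
by rewrite mulrCA mulrA.
Qed.

Lemma tsym_diag phi v i :
  tsym_op diag_br (size v).+1 phi (rcons v i) = skewder i phi v.
Proof.
rewrite /tsym_op /skewder (reindex_inj rev_ord_inj) /=.
by apply: eq_bigr => p _; rewrite chain_diag ?subSS ?leq_subr // subKn // -ltnS.
Qed.

(** Each [T_k] strips the last letter of the word, so the derivations act in the order opposite to
    the word. *)
Lemma qsym_diag D phi : qsym_op diag_br (size D) phi (rev D) = skewders D phi [::].
Proof.
elim: D phi => [|i D IH] phi //=.
rewrite -IH rev_cons -cats1 take_size_cat ?size_rev // drop_size_cat ?size_rev //.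
apply: eq_qsym_op; rewrite ?size_rev // => v <-.
by rewrite cats1 tsym_diag.
Qed.

(** Product in the tensor algebra. The degree d of the left factor is a parameter because [a] is a
    function on words of all lengths. *)
Definition mulw d (a phi : seq L -> K) w := a (take d w) * phi (drop d w).

(** The letter i is inserted either behind the cut, which differentiates [phi], or before it, which
    differentiates [a] and costs the character of what follows. The strict bound makes the second
    factor of positive degree: otherwise w is too short for the cut [s.+1]. *)
Lemma skewder_mulw i s a phi w : (s < size w)%N ->
  skewder i (mulw s.+1 a phi) w =
  mulw s.+1 a (skewder i phi) w + chi i (drop s w) * mulw s (skewder i a) phi w.
Proof.
move=> sw; rewrite /skewder -(big_mkord predT (fun p => chi i (drop p w) *
  mulw s.+1 a phi (take p w ++ i :: drop p w))).
have sz : size (take s w) = s by rewrite size_take sw.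
rewrite (@big_cat_nat _ _ _ s.+1) //=; last by rewrite ltnS ltnW.
rewrite addrC; congr (_ + _).
  rewrite -{1}[s.+1]add0n big_addn /mulw big_mkord size_drop big_distrr /= subSn //.
  apply: eq_bigr => p _; rewrite drop_drop.
  rewrite [(p + s.+1)%N]addnC takeD -catA.
  by rewrite take_size_cat ?size_takel // drop_size_cat ?size_takel // mulrCA.
rewrite /mulw big_mkord sz mulrC big_distrl big_distrl /=.
apply: eq_bigr => p _; have ps : (p <= s)%N by rewrite -ltnS.
have e : drop p w = drop p (take s w) ++ drop s w.
  by rewrite -[in LHS](cat_take_drop s w) drop_cat sz ltn_neqAle ps andbT; case: eqP => //= ->; rewrite subnn drop0 [drop s (take s w)]drop_oversize ?sz.
have st : size (take p w ++ i :: drop p (take s w)) = s.+1.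
  rewrite size_cat /= size_drop sz size_take_min (minn_idPl _) ?(leq_trans ps (ltnW sw)) //.
  by rewrite addnS subnKC.
rewrite e -cat_cons catA take_size_cat // drop_size_cat // take_takel // chi_cat.
by rewrite mulrAC mulrA.
Qed.

(* Let u be killed by the derivations in D and let f be the composite of the
   derivations j0 :: D. Since the bicharacter pairs the degree of f trivially with
   that of u, f satisfies f (u v) = u f (v) + f (u) v on powers v of u, whence
   f (u^k) = k f (u) u^(k-1), and u^k is nonzero in the Nichols algebra. *)
Section Criterion.
Variables (d : nat) (j0 : L) (D : seq L) (u : seq L -> K) (kap : L -> K).
Hypothesis sD : size D = d.
Hypothesis u_deg : forall w i, size w = d.+1 -> u w != 0 -> chi i w = kap i.
Hypothesis u_prim : forall i, i \in D -> forall w, size w = d -> skewder i u w = 0.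
Hypothesis kap1 : \prod_(i <- j0 :: D) kap i = 1.

Fixpoint powu k w : K := if k is k'.+1 then mulw d.+1 u (powu k') w else 1.

Lemma powu_deg k w i : size w = (k * d.+1)%N -> powu k w != 0 -> chi i w = kap i ^+ k.
Proof.
elim: k w => [|k IH] w /=; first by move/size0nil->.
move=> sw; rewrite /mulw mulf_eq0 negb_or => /andP[u1 u2].
rewrite -(cat_take_drop d.+1 w) chi_cat exprS (u_deg _ _ u1); last first.
  by rewrite size_take_min sw mulSn (minn_idPl _) // leq_addr.
by rewrite IH // size_drop sw mulSn addKn.
Qed.

Lemma powu_prim k i : i \in D -> forall w, (size w).+1 = (k * d.+1)%N ->
  skewder i (powu k) w = 0.
Proof.
move=> iD; elim: k => [|k IH] w //= sw.
move: (sw); rewrite mulSn addSn => -[sw'].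
have tw : size (take d w) = d by rewrite size_take_min sw' (minn_idPl _) // leq_addr.
(* The Leibniz rule needs a right factor of positive degree, so the first power is treated apart. *)
case: k IH sw sw' => [|k] IH sw sw'.
  rewrite addn0 in sw'; rewrite -[RHS](u_prim iD sw').
  apply: (eq_skewder _ _ sw') => v sv.
  by rewrite /mulw /= mulr1 take_oversize // sv.
rewrite skewder_mulw; last by rewrite sw' mulSn addSn addnS ltnS leq_addr.
rewrite /mulw (u_prim iD) // mul0r mulr0 addr0 IH ?mulr0 //.
by rewrite size_drop sw' subnS addKn mulSn addSn.
Qed.

(** The two Leibniz terms never interact. Derivations in E kill u, so on the first term they reach
    [be] only; they kill [powu k], so on the second they only lower [ga], each paying the character
    [kap i ^+ k] of [powu k]. When E is exhausted [ga] has become a scalar. *)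
Lemma skewders_mix k E be ga ka : (0 < k)%N -> {subset E <= D} -> (size E <= d)%N ->
  forall w, size w = (k * d.+1)%N ->
  skewders E (fun v => mulw d.+1 u be v + ka * mulw (size E) ga (powu k) v) w =
  mulw d.+1 u (skewders E be) w
   + ka * (\prod_(i <- E) kap i ^+ k) * skewders E ga [::] * powu k w.
Proof.
move=> k0; elim: E be ga ka => [|i E IH] be ga ka ED sE w sw /=.
  by rewrite big_nil mulr1 /mulw take0 drop0 mulrA.
have iD : i \in D by apply: ED; rewrite mem_head.
rewrite big_cons mulrA -IH //; last 2 first.
- by move=> x xE; apply: ED; rewrite inE xE orbT.
- exact: ltnW.
apply: (eq_skewders (m := (k * d.+1)%N)) => // v sv.
have dk : (d.+1 <= k * d.+1)%N by rewrite leq_pmull.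
rewrite [LHS](_ : _ = skewder i (mulw d.+1 u be) v + ka * skewder i (mulw (size E).+1 ga (powu k)) v); last first.
  rewrite /skewder [in RHS]big_distrr -[RHS]big_split /=. apply: eq_bigr => p _.
  by rewrite mulrDr; congr (_ + _); rewrite [RHS]mulrCA.
rewrite !skewder_mulw ?sv; last 2 first.
- by rewrite -[X in (X < _)%N]addn0 ltn_add2l muln_gt0 k0.
- exact: (leq_trans dk (leq_addl _ _)).
congr (_ + _).
  rewrite /mulw [skewder i u _](u_prim iD) ?mul0r ?mulr0 ?addr0 //.
  by rewrite size_take_min sv (minn_idPl _) // (leq_trans (leqnSn _)) // (leq_trans dk) // leq_addl.
rewrite /mulw powu_prim ?mulr0 ?add0r //; last first.
  by rewrite size_drop sv subnS addKn prednK // muln_gt0 k0.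
have sdv : size (drop (size E) v) = (k * d.+1)%N by rewrite size_drop sv addKn.
have [->|p0] := eqVneq (powu k (drop (size E) v)) 0; first by rewrite !mulr0.
by rewrite (powu_deg _ sdv) // mulrA.
Qed.

Lemma skewders_powu k w : size w = (k * d.+1)%N ->
  skewders (j0 :: D) (powu k.+1) w = k.+1%:R * skewders (j0 :: D) u [::] * powu k w.
Proof.
elim: k w => [|k IH] w sw.
  move/size0nil: sw => -> /=; rewrite mulr1 mul1r.
  apply: (eq_skewders (m := 0%N)) => // v; rewrite addn0 sD => sv.
  apply: (eq_skewder _ _ sv) => v' sv'.
  by rewrite /mulw /= mulr1 take_oversize // sv'.
set m := (k.+1 * d.+1)%N in sw.
have dm : (d < m)%N by rewrite /m mulSn addSn ltnS leq_addr.
rewrite [LHS](_ : _ = skewders D (fun v => mulw d.+1 u (skewder j0 (powu k.+1)) v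
    + kap j0 ^+ k.+1 * mulw (size D) (skewder j0 u) (powu k.+1) v) w); last first.
  rewrite -[LHS]/(skewders D (skewder j0 (mulw d.+1 u (powu k.+1))) w);  apply: (eq_skewders (m := m)) => // v; rewrite sD => sv.
  rewrite skewder_mulw; last by rewrite sv (leq_trans dm) // leq_addl.
  congr (_ + _); rewrite /mulw.
  have sdv : size (drop d v) = m by rewrite size_drop sv addKn.
  have [->|p0] := eqVneq (powu k.+1 (drop d v)) 0; first by rewrite !mulr0.
  by rewrite (powu_deg _ sdv).
rewrite skewders_mix ?sD //.
(* The characters paid by all the derivations of f in front of [powu k.+1] multiply to a power of
   the pairing of the two degrees, which is 1 by [kap1]. *)
have -> : kap j0 ^+ k.+1 * \prod_(i <- D) kap i ^+ k.+1 = 1.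
  by rewrite prodrXl -exprMn; move: kap1; rewrite big_cons => ->; rewrite expr1n.
rewrite mul1r /mulw.
have -> : skewders D (skewder j0 (powu k.+1)) (drop d.+1 w) = skewders (j0 :: D) (powu k.+1) (drop d.+1 w) by [].
rewrite IH; last by rewrite size_drop sw /m mulSn addKn.
rewrite -[powu k.+1 w]/(mulw d.+1 u (powu k) w) /mulw.
by rewrite [skewders (j0 :: D) u _]/= -[k.+2]addn1 natrD; ring.
Qed.

Lemma skewders_cat E1 E2 phi : skewders (E1 ++ E2) phi = skewders E2 (skewders E1 phi).
Proof. by elim: E1 phi => [|i E1 IH] phi //=. Qed.

Lemma skewdersZ E a phi w : skewders E (fun v => a * phi v) w = a * skewders E phi w.
Proof.
elim: E phi w => [|i E IH] phi w //=; rewrite -IH.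
apply: (eq_skewders (m := size w)) => // v _; rewrite /skewder big_distrr /=.
by apply: eq_bigr => p _; rewrite mulrCA.
Qed.

Lemma skewders_powu_full k :
  skewders (flatten (nseq k (j0 :: D))) (powu k) [::] =
  k`!%:R * skewders (j0 :: D) u [::] ^+ k.
Proof.
elim: k => [|k IH]; first by rewrite /= mul1r.
rewrite [flatten _]/= -cat_cons skewders_cat.
transitivity (skewders (flatten (nseq k (j0 :: D)))
   (fun v => k.+1%:R * skewders (j0 :: D) u [::] * powu k v) [::]).
  apply: (eq_skewders (m := 0%N)) => // v sv; apply: skewders_powu.
  by rewrite sv addn0 size_flatten /shape map_nseq sumn_nseq /= sD mulnC.
by rewrite skewdersZ IH factS natrM exprS mulrACA.
Qed.

Lemma qsym_diag_neq0 k : [pchar K] =i pred0 -> skewders (j0 :: D) u [::] != 0 ->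
  ~ (forall phi v, size v = (k * d.+1)%N -> qsym_op diag_br (k * d.+1) phi v = 0).
Proof.
move=> ch0 s0 H; set E := flatten (nseq k (j0 :: D)).
have sE : size E = (k * d.+1)%N.
  by rewrite size_flatten /shape map_nseq sumn_nseq /= sD mulnC.
have := skewders_powu_full k; rewrite -qsym_diag sE H ?size_rev //.
move/esym/eqP; rewrite mulf_eq0 expf_eq0 (negPf s0) andbF orbF.
by move/pcharf0P: ch0 => ->; rewrite eqn0Ngt fact_gt0.
Qed.

End Criterion.

(** * Evaluating derivations on explicit combinations of words *)

Section Evaluate.

Definition ev (l : seq (K * seq L)) w : K := \sum_(x <- l) x.1 * (w == x.2)%:R.

(** The transpose of insertion: each occurrence of i is deleted in turn, weighted by [chi i] of the
    suffix behind it. On lists this reduces by computation, which leaves polynomial identities in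
    the q_ij. *)
Fixpoint dword i v : seq (K * seq L) :=
  if v is a :: v' then
    (if a == i then [:: (chi i v', v')] else [::]) ++ [seq (x.1, a :: x.2) | x <- dword i v']
  else [::].

Definition dlist i (l : seq (K * seq L)) : seq (K * seq L) :=
  flatten [seq [seq (x.1 * y.1, y.2) | y <- dword i x.2] | x <- l].

Lemma ev_cat l1 l2 w : ev (l1 ++ l2) w = ev l1 w + ev l2 w.
Proof. by rewrite /ev big_cat. Qed.

Lemma skewder_word i v w : skewder i (fun w => (w == v)%:R) w = ev (dword i v) w.
Proof.
elim: v w => [|a v IH] w /=.
  rewrite /ev big_nil /skewder big1 // => p _.
  by case: (take p w) => [|? ?]; rewrite mulr0.
rewrite ev_cat /skewder big_ord_recl /= drop0 take0 /=; congr (_ + _).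
  rewrite eqseq_cons eq_sym; case: eqP => [_|_]; rewrite /ev ?big_nil ?mulr0 //.
  by rewrite big_seq1 /=; case: eqP => [->|]; rewrite ?mulr0.
case: w => [|b w].
  by rewrite big_ord0 /ev big_map big1 // => x _; rewrite mulr0.
rewrite /ev big_map /=.
under eq_bigr do rewrite add0n eqseq_cons.
under [RHS]eq_bigr do rewrite eqseq_cons.
case: (b == a) => /=; last by rewrite !big1 // => *; rewrite mulr0.
exact: IH.
Qed.

Lemma skewder_ev i l w : skewder i (ev l) w = ev (dlist i l) w.
Proof.
elim: l => [|x l IH].
  by rewrite /ev big_nil /skewder big1 // => p _; rewrite big_nil mulr0.
rewrite /dlist /= ev_cat -/(dlist i l) -IH /skewder.
under eq_bigr do rewrite {1}/ev big_cons mulrDr.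
rewrite big_split /=; congr (_ + _).
under eq_bigr do rewrite mulrCA.
rewrite -big_distrr /= [X in _ * X]skewder_word /ev big_map big_distrr /=.
by apply: eq_bigr => y _; rewrite mulrA.
Qed.

Lemma skewders_ev D l w : skewders D (ev l) w = ev (foldl (fun l i => dlist i l) l D) w.
Proof.
elim: D l w => [|i D IH] l w //=; rewrite -IH.
by apply: (eq_skewders (m := size w)) => // v _; apply: skewder_ev.
Qed.

Lemma ev_neq0 l w : ev l w != 0 -> w \in map snd l.
Proof.
apply: contraNT => nw; rewrite /ev big_seq big1 // => x xl.
by case: eqP => [wx|_]; rewrite ?mulr0 //; move: nw; rewrite wx map_f.
Qed.

End Evaluate.
End Diagonal.

(** * Infinite-dimensional Nichols algebras *)

Section Infinite.
Variables (K : fieldType) (ch0 : [pchar K] =i pred0).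

Lemma charf0_natr_neq0 n : n.+1%:R != 0 :> K.
Proof. by move/pcharf0P: ch0 => ->. Qed.

Lemma subrN1_neq0 : 1 - -1 != 0 :> K.
Proof. by rewrite opprK; exact: (charf0_natr_neq0 1). Qed.

Lemma fin_nichols_sub (M N : ydmod K) (P : 'M[K]_(ydim M, ydim N)) G :
  G *m P = 1%:M ->
  (forall r s p' q', \sum_p \sum_q cmat (M := M) r s p q * (P p p' * P q q') =
     \sum_r' \sum_s' P r r' * P s s' * cmat (M := N) r' s' p' q') ->
  fin_nichols M -> fin_nichols N.
Proof.
move=> GP H [k0 fM]; exists k0 => k /fM Mk.
apply/qsym_eq0; move/qsym_eq0: Mk.
apply: (@qsym_op_transfer K _ _ (fun _ r a => P r a) _ _ _ (fun _ a r => G a r)).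
  by move=> _; apply: H.
by move=> _ b a'; move/matrixP/(_ b a'): GP; rewrite !mxE.
Qed.

Lemma diag_infinite (M : ydmod K) (L : finType) (Q : L -> L -> K)
    (P : nat -> 'I_(ydim M) -> L -> K) G j0 D (l : seq (K * seq L)) (kap : L -> K) :
  (forall j r s a b, \sum_p \sum_q cmat r s p q * (P j p a * P j.+1 q b) =
     Q a b * (P j r b * P j.+1 s a)) ->
  (forall j b a', \sum_a G j b a * P j a a' = (b == a')%:R) ->
  (forall x i, x \in map snd l -> chi Q i x = kap i) ->
  (forall i, i \in D -> forall w, size w = size D -> ev (dlist Q i l) w = 0) ->
  \prod_(i <- j0 :: D) kap i = 1 ->
  ev (foldl (fun l i => dlist Q i l) l (j0 :: D)) [::] != 0 ->
  ~ fin_nichols M.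
Proof.
move=> cP GP Hk HD k1 s0 [N fM].
apply: (@qsym_diag_neq0 K L Q (size D) j0 D (ev l) kap _ _ _ _ N ch0) => //.
- by move=> w i _ /ev_neq0; apply: Hk.
- by move=> i iD w sw; rewrite skewder_ev HD.
- by rewrite skewders_ev.
(* The degrees [k * (size D).+1] are unbounded, so [k = N] already exceeds the bound of
   finiteness. *)
have Mk := fM (N * (size D).+1)%N (leq_pmulr _ (ltn0Sn _)).
move/qsym_eq0: Mk; apply: (qsym_op_transfer _ GP) => j r s p' q'.
rewrite cP (bigD1 q') //= [X in _ + X]big1 ?addr0 => [|r' /negPf rq].
  rewrite (bigD1 p') //= [X in _ + X]big1 ?addr0 => [|s' /negPf sp].
    by rewrite /diag_br !eqxx mul1r mulrC.
  by rewrite /diag_br sp andbF mul0r mulr0.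
by apply: big1 => s' _; rewrite /diag_br rq mul0r mulr0.
Qed.

Lemma fixed_infinite (M : ydmod K) (v : 'cV[K]_(ydim M)) : v != 0 ->
  (forall r s, \sum_p \sum_q cmat r s p q * (v p 0 * v q 0) = v r 0 * v s 0) ->
  ~ fin_nichols M.
Proof.
move=> /cV0Pn [r0 vr0] H.
(* One letter with q = 1 and u = x: the derivation is ordinary differentiation of polynomials. *)
apply: (@diag_infinite M unit (fun _ _ => 1) (fun _ p _ => v p 0)
  (fun _ _ p => (p == r0)%:R / v r0 0) tt [::] [:: (1, [:: tt])] (fun=> 1)).
- by move=> j r s a b; rewrite mul1r H.
- move=> _ [] []; rewrite (bigD1 r0) //= big1 ?addr0 ?eqxx ?mul1r ?mulVf //.
  by move=> p /negPf->; rewrite !mul0r.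
- by move=> x []; rewrite inE => /eqP->; rewrite /= mulr1.
- by [].
- by rewrite big_seq1.
- by rewrite /ev /= big_seq1 /= !mulr1 oner_neq0.
Qed.

(* Here [c (v_a (x) v_b) = q_(a,~~b) v_(~~b) (x) v_(~~a)]: twisting by powers of
   the swap of v_false and v_true turns c into a diagonal braiding of affine
   Cartan type with a_12 = a_21 = -2. *)
Lemma twisted_infinite (M : ydmod K) (v : bool -> 'cV[K]_(ydim M))
    (G : bool -> 'rV[K]_(ydim M)) (z : K) :
  z ^+ 4 = -1 ->
  (forall a b, (G a *m v b) 0 0 = (a == b)%:R) ->
  (forall a b r s, \sum_p \sum_q cmat r s p q * (v a p 0 * v b q 0) =
     (if a (+) b then z else z^-1) * (v (~~ b) r 0 * v (~~ a) s 0)) ->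
  ~ fin_nichols M.
Proof.
move=> z4 GP H.
have z0 : z != 0.
  by apply/eqP => z0; move/eqP: z4; rewrite z0 expr0n /= eq_sym oppr_eq0 oner_eq0.
pose Q (a b : bool) := if a == b then z else z^-1.
(* Here u is the braided commutator of the letters [false] and [true], and q_delta is the product of
   z, z, z^-1, z^-1. The surviving derivative is 1 - z^-2, nonzero because z^4 = -1. *)
apply: (@diag_infinite M bool Q (fun j p a => v (a (+) odd j) p 0)
  (fun j a p => G (a (+) odd j) 0 p) true [:: false]
  [:: (1, [:: false; true]); (- z^-1, [:: true; false])] (fun=> 1)).
- move=> j r s a b; rewrite H /= /Q.
  by case: a; case: b; case: (odd j).
- move=> j b a; have := GP (b (+) odd j) (a (+) odd j); rewrite mxE => ->.
  by case: b; case: a; case: (odd j).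
- move=> x i; rewrite !inE => /orP[] /eqP->; rewrite /= /Q;
  by case: i; rewrite /= mulr1 ?mulfV ?mulVf.
- move=> i; rewrite inE => /eqP-> w _; rewrite /ev /dlist /= /Q /= !big_cons big_nil /=.
  by rewrite !mulr1 mul1r; ring.
- by rewrite !big_cons big_nil !mulr1.
- rewrite /ev /dlist /= /Q /= !big_cons big_nil /=.
  rewrite !mulr1 addr0 mulNr -expr2 subr_eq0; apply/eqP => e.
  have : z ^+ 4 = 1 by rewrite -[4%N]/(2 * 2)%N exprM -[z ^+ 2]invrK -exprVn -e invr1 expr1n.
  rewrite z4 => /eqP; rewrite -subr_eq0 -opprD oppr_eq0 => /eqP e2.
  by have := charf0_natr_neq0 1; rewrite mulr2n e2 eqxx.
Qed.

Section DiagonalVectors.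
Variables (M : ydmod K) (L : finType) (v : L -> 'cV[K]_(ydim M)) (g : L -> 'rV[K]_(ydim M)).
Variable q : L -> L -> K.
Hypothesis gv : forall a b, (g a *m v b) 0 0 = (a == b)%:R.
Hypothesis vq : forall a b r s,
  \sum_p \sum_t cmat r s p t * (v a p 0 * v b t 0) = q a b * (v b r 0 * v a s 0).

Lemma diag_vectors_infinite j0 D (l : seq (K * seq L)) (kap : L -> K) :
  (forall x i, x \in map snd l -> chi q i x = kap i) ->
  (forall i, i \in D -> forall w, size w = size D -> ev (dlist q i l) w = 0) ->
  \prod_(i <- j0 :: D) kap i = 1 ->
  ev (foldl (fun l i => dlist q i l) l (j0 :: D)) [::] != 0 ->
  ~ fin_nichols M.
Proof.
apply: (@diag_infinite M L q (fun _ p a => v a p 0) (fun _ a p => g a 0 p)) => [_ r s a b|_ a b].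
  exact: vq.
by rewrite -gv mxE.
Qed.

End DiagonalVectors.

Section Shapes.
Variable M : ydmod K.
Local Notation n := (ydim M).
Local Notation diag_vectors v g q :=
  ((forall a b, ((g a : 'rV_n) *m v b) 0 0 = (a == b)%:R :> K) /\
   (forall a b r s, \sum_p \sum_t cmat r s p t * ((v a : 'cV_n) p 0 * (v b : 'cV_n) t 0)
       = q a b * (v b r 0 * v a s 0))).

(* Affine type A_2: u is the iterated braided commutator [x0, [x1, x2]]. *)
Lemma triangle_infinite (v : option bool -> 'cV_n) g (q : option bool -> option bool -> K) :
  diag_vectors v g q -> (forall a, q a a = -1) -> (forall a b, a != b -> q a b * q b a = -1) ->
  ~ fin_nichols M.
Proof.
move=> [gv vq] qd qo; pose x0 := Some false; pose x1 := Some true; pose x2 := @None bool.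
have q0 : q x0 x0 = -1 by []. have q1 : q x1 x1 = -1 by []. have q2 : q x2 x2 = -1 by [].
have q01 : q x0 x1 * q x1 x0 = -1 by exact: qo.
have q12 : q x1 x2 * q x2 x1 = -1 by exact: qo.
have q02 : q x0 x2 * q x2 x0 = -1 by exact: qo.
apply: (diag_vectors_infinite gv vq (j0 := x2) (D := [:: x0; x1])
  (l := [:: (1, [:: x0; x1; x2]); (- q x1 x2, [:: x0; x2; x1]);
      (- (q x0 x1 * q x0 x2), [:: x1; x2; x0]);
      (q x0 x1 * q x0 x2 * q x1 x2, [:: x2; x1; x0])])
  (kap := fun i => q i x0 * q i x1 * q i x2)) => /=.
- by move=> x i; rewrite !inE => /or4P[] /eqP-> /=; rewrite /=; ring.
- move=> i; rewrite !inE => /orP[] /eqP-> w _; rewrite /ev /dlist /= !big_cons big_nil /=; ring.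
- rewrite !big_cons big_nil /= q0 q1 q2.
  transitivity (- ((q x0 x1 * q x1 x0) * (q x1 x2 * q x2 x1) * (q x0 x2 * q x2 x0))); first ring.
  by rewrite q01 q12 q02; ring.
- rewrite /ev /dlist /= !big_cons big_nil /= !mulr1 addr0.
  (* A bracket with x_i is killed by the derivation of x_i when its other entry is; only the
     innermost letter x2 survives, and the two factors obtained are each 1 - (-1). *)
  rewrite [X in X != _](_ : _ = (1 - q x1 x2 * q x2 x1) * (1 - q x0 x2 * q x2 x0) * q x0 x1); last ring.
  rewrite q12 q02 !mulf_neq0 ?subrN1_neq0 //.
  by apply/eqP => q00; move/eqP: q01; rewrite q00 mul0r eq_sym oppr_eq0 oner_eq0.
Qed.

(* Affine type A_3, a 4-cycle: u is the iterated braided commutator [x2, [x1, [x0, x3]]]. *)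
Lemma square_infinite (v : bool * bool -> 'cV_n) g (q : bool * bool -> bool * bool -> K) :
  diag_vectors v g q -> (forall a, q a a = -1) ->
  (forall a b, a != b -> q a b * q b a = if a.1 (+) b.1 (+) a.2 (+) b.2 then -1 else 1) ->
  ~ fin_nichols M.
Proof.
move=> [gv vq] qd qo; pose x0 := (false, false); pose x1 := (false, true).
pose x2 := (true, true); pose x3 := (true, false).
have q0 : q x0 x0 = -1 by []. have q1 : q x1 x1 = -1 by [].
have q2 : q x2 x2 = -1 by []. have q3 : q x3 x3 = -1 by [].
have q01 : q x0 x1 * q x1 x0 = -1 by exact: qo.
have q12 : q x1 x2 * q x2 x1 = -1 by exact: qo.
have q23 : q x2 x3 * q x3 x2 = -1 by exact: qo.
have q03 : q x0 x3 * q x3 x0 = -1 by exact: qo.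
have q02 : q x0 x2 * q x2 x0 = 1 by exact: qo.
have q13 : q x1 x3 * q x3 x1 = 1 by exact: qo.
(* [ad i k] is the braided commutator with the letter i, where k is the character of i on the degree
   of the other entry. *)
pose ad i (k : K) (l : seq (K * seq (bool * bool))) :=
  [seq (x.1, i :: x.2) | x <- l] ++ [seq (- (k * x.1), rcons x.2 i) | x <- l].
pose l := ad x2 (q x2 x1 * q x2 x0 * q x2 x3) (ad x1 (q x1 x0 * q x1 x3)
           (ad x0 (q x0 x3) [:: (1, [:: x3])])).
apply: (diag_vectors_infinite gv vq (j0 := x3) (D := [:: x0; x2; x1]) (l := l)
  (kap := fun i => q i x0 * q i x1 * q i x2 * q i x3)) => /=.
- move=> x i; rewrite !inE; do 7!(case/predU1P => [->|]; first by rewrite /= ; ring).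
  by move=> /eqP->; rewrite /= ; ring.
- move=> i; rewrite !inE => /or3P[] /eqP-> w _; rewrite /ev /dlist /= !big_cons big_nil /=; ring.
- rewrite !big_cons big_nil /= q0 q1 q2 q3.
  transitivity ((q x0 x1 * q x1 x0) * (q x1 x2 * q x2 x1) * (q x0 x2 * q x2 x0)
    * (q x2 x3 * q x3 x2) * (q x0 x3 * q x3 x0) * (q x1 x3 * q x3 x1)); first ring.
  by rewrite q01 q12 q02 q23 q03 q13; ring.
- rewrite /ev /dlist /= !big_cons big_nil /= !mulr1 addr0.
  rewrite [X in X != _](_ : _ = (1 - q x0 x3 * q x3 x0) * (1 - q x0 x1 * q x1 x0 * (q x1 x3 * q x3 x1)) *
     (1 - q x2 x3 * q x3 x2 * (q x0 x2 * q x2 x0)) * q x2 x1); last ring.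
  rewrite q03 q01 q13 q23 q02 !mulr1 !mulf_neq0 ?subrN1_neq0 //.
  by apply/eqP => q00; move/eqP: q12; rewrite q00 mulr0 eq_sym oppr_eq0 oner_eq0.
Qed.

End Shapes.
End Infinite.

(** * Structure constants of the Kac-Paljutkin algebra *)

Section HopfStructure.
Variable K : fieldType.
Implicit Types (l : seq (K * hb * hb)) (u v p q : hb).

Lemma big_hb (R : nmodType) (F : hb -> R) :
  \sum_p F p = \sum_a \sum_b \sum_c F (a, b, c).
Proof.
rewrite [RHS](pair_bigA _ (fun a b => \sum_c F (a, b, c))) /=.
by rewrite (pair_bigA _ (fun ab c => F (ab.1, ab.2, c))) /=; apply: eq_bigr => -[[]].
Qed.

Lemma sum_bool (R : nmodType) (F : bool -> R) : \sum_a F a = F true + F false.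
Proof. exact: big_bool. Qed.

Definition hprod u v : hb :=
  let: (a, b, c) := u in let: (a', b', c') := v in
  (a (+) (if c then b' else a'), b (+) (if c then a' else b'), c (+) c').

Lemma hmul_bE u v p : ~~ (u.2 && v.2) -> hmul_b K u v p = (p == hprod u v)%:R.
Proof. by case: u v p => [[a b] c] [[a' b'] c'] [[p1 p2] p3] /= /negPf->; rewrite !xpair_eqE. Qed.

Lemma hmul_bas u v p : hmul (hbas K u) (hbas K v) p = hmul_b K u v p.
Proof.
rewrite /hmul (bigD1 u) //= [X in _ + X]big1 ?addr0 => [|b /negPf bu]; last first.
  by apply: big1 => b' _; rewrite /hbas bu !mul0r.
rewrite (bigD1 v) //= [X in _ + X]big1 ?addr0 => [|b /negPf bu]; last first.
  by rewrite /hbas bu mulr0 mul0r.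
by rewrite /hbas !eqxx !mul1r.
Qed.

(** Sparse elements of the tensor square. Since [tmul] sums over four basis indices, 4096 terms,
    products are computed on lists; this is legitimate as long as no two factors z meet, when the
    product of basis elements is again one. *)
Definition ev2 l : hel2 K := fun p q =>
  \sum_(x <- l) x.1.1 * ((p == x.1.2)%:R * (q == x.2)%:R).

Definition prod2 l l' :=
  [seq (x.1.1 * y.1.1, hprod x.1.2 y.1.2, hprod x.2 y.2) | x <- l, y <- l'].

Lemma eq_tmul (U U' V V' : hel2 K) : U =2 U' -> V =2 V' -> tmul U V =2 tmul U' V'.
Proof.
by move=> HU HV p q; do 4!(apply: eq_bigr => ? _); rewrite HU HV.
Qed.

Lemma tmul_suml (I : Type) (r : seq I) (F : I -> hel2 K) V p q :
  tmul (fun p q => \sum_(x <- r) F x p q) V p q = \sum_(x <- r) tmul (F x) V p q.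
Proof.
rewrite /tmul; do 4!(rewrite [RHS]exchange_big /=; apply: eq_bigr => ? _).
by rewrite -mulrA -mulrA big_distrl /=; apply: eq_bigr => x _; rewrite !mulrA.
Qed.

Lemma tmul_sumr (I : Type) (r : seq I) (F : I -> hel2 K) U p q :
  tmul U (fun p q => \sum_(x <- r) F x p q) p q = \sum_(x <- r) tmul U (F x) p q.
Proof.
rewrite /tmul; do 4!(rewrite [RHS]exchange_big /=; apply: eq_bigr => ? _).
rewrite -mulrA mulrAC big_distrr /=; apply: eq_bigr => x _; ring.
Qed.

Lemma tmul_tens (k k' : K) (u v u' v' : hel K) p q :
  tmul (fun p q => k * (u p * v q)) (fun p q => k' * (u' p * v' q)) p q =
  k * k' * (hmul u u' p * hmul v v' q).
Proof.
rewrite /tmul /hmul !big_distrl !big_distrr /=; apply: eq_bigr => b1 _.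
rewrite exchange_big /= big_distrl big_distrr /=; apply: eq_bigr => b3 _.
rewrite mulrA big_distrr /=; apply: eq_bigr => b2 _.
rewrite big_distrr /=; apply: eq_bigr => b4 _; ring.
Qed.

Lemma tmul_ev2 l l' : all (fun x => all (fun y => ~~ (x.1.2.2 && y.1.2.2)
    && ~~ (x.2.2 && y.2.2)) l') l ->
  tmul (ev2 l) (ev2 l') =2 ev2 (prod2 l l').
Proof.
move=> ll p q; rewrite tmul_suml /prod2 /ev2 big_allpairs_dep /= big_seq [RHS]big_seq.
apply: eq_bigr => x /(allP ll) /allP xl; rewrite tmul_sumr big_seq [RHS]big_seq.
apply: eq_bigr => y /xl /andP[z1 z2]; rewrite (tmul_tens _ _ (hbas K _) (hbas K _) (hbas K _) (hbas K _)).
by rewrite !hmul_bas !hmul_bE.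
Qed.

Definition Dz_list : seq (K * hb * hb) :=
  [:: (2%:R^-1, (false, false, true), (false, false, true));
      (2%:R^-1, (false, false, true), (true, false, true));
      (2%:R^-1, (false, true, true), (false, false, true));
      (- 2%:R^-1, (false, true, true), (true, false, true))].

Lemma DzE : Dz K =2 ev2 Dz_list.
Proof.
move=> p q; rewrite /Dz.
pose l := [:: (2%:R^-1, (false, false, false), (false, false, false));
      (2%:R^-1, (false, false, false), (true, false, false));
      (2%:R^-1, (false, true, false), (false, false, false));
      (- 2%:R^-1, (false, true, false), (true, false, false))] : seq (K * hb * hb).
rewrite (@eq_tmul _ (ev2 l) _ (ev2 [:: (1, (false, false, true), (false, false, true))])).
- by rewrite tmul_ev2 // /prod2 /= !mulr1.
- by move=> p' q'; rewrite /ev2 /l !big_cons big_nil /tens /hone /hx /hy /hbas /=; ring.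
- by move=> p' q'; rewrite /ev2 big_seq1 /tens /hz /hbas /= mul1r.
Qed.

Definition comul_list u : seq (K * hb * hb) :=
  let: (a, b, c) := u in
  prod2 [:: (1, (a, b, false), (a, b, false))]
    (if c then Dz_list else [:: (1, (false, false, false), (false, false, false))]).

Lemma hcomulE u : hcomul K u =2 ev2 (comul_list u).
Proof.
case: u => [[a b] c] p q; rewrite /hcomul.
have e1 : tmul (if a then tens (hx K) (hx K) else tens (hone K) (hone K))
    (if b then tens (hy K) (hy K) else tens (hone K) (hone K)) =2
    ev2 [:: (1, (a, b, false), (a, b, false))].
  pose l1 := [:: (1, (a, false, false), (a, false, false))] : seq (K * hb * hb).
  pose l2 := [:: (1, (false, b, false), (false, b, false))] : seq (K * hb * hb).
  move=> p' q'; rewrite (@eq_tmul _ (ev2 l1) _ (ev2 l2)).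
  - by rewrite tmul_ev2 //= /prod2 /= addbF mulr1.
  - by move=> ? ?; rewrite /ev2 big_seq1 /= mul1r; case: (a).
  - by move=> ? ?; rewrite /ev2 big_seq1 /= mul1r; case: (b).
rewrite (eq_tmul e1 (V' := ev2 (if c then Dz_list else [:: (1, (false, false, false), (false, false, false))]))).
  by rewrite tmul_ev2 //; case: (c).
case: (c) => ? ?; first exact: DzE.
by rewrite /ev2 big_seq1 /= mul1r.
Qed.

Lemma sgnD a b : sgn K (a (+) b) = sgn K a * sgn K b.
Proof. by case: a; case: b; rewrite /sgn /= ?mulrNN ?mulr1 ?mul1r. Qed.

Lemma hcomul_group a b p q :
  hcomul K (a, b, false) p q = ((p == (a, b, false)) && (q == (a, b, false)))%:R.
Proof.
by rewrite hcomulE /ev2 /= big_seq1 /= !addbF !mul1r -natrM mulnb.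
Qed.

Lemma hcomul_z a b p q : hcomul K (a, b, true) p q =
  if [&& p.2, q.2, p.1.1 == a & q.1.2 == b]
  then sgn K ((p.1.2 (+) b) && (q.1.1 (+) a)) / 2%:R else 0.
Proof.
rewrite hcomulE /ev2 /= !big_cons big_nil /=.
case: p => [[p1 p2] []]; case: q => [[q1 q2] []]; rewrite !xpair_eqE ?andbF /=; try ring.
by case: a b p1 p2 q1 q2 => [] [] [] [] [] [] /=; rewrite /sgn /=; ring.
Qed.

Lemma hcomul3_group a b b1 b2 b3 : hcomul3 K (a, b, false) b1 b2 b3 =
  [&& b1 == (a, b, false), b2 == (a, b, false) & b3 == (a, b, false)]%:R.
Proof.
rewrite /hcomul3 (bigD1 (a, b, false)) // big1 ?addr0 => [|c /negPf nc].
  by rewrite !hcomul_group eqxx /= -natrM mulnb addr0 andbC -andbA; do 3!case: (_ == _).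
by rewrite hcomul_group nc mul0r.
Qed.

Lemma hcomul3_z b1 b2 b3 : hcomul3 K (false, false, true) b1 b2 b3 =
  if [&& b1.2, b2.2, b3.2, ~~ b1.1.1 & ~~ b3.1.2]
  then sgn K ((b3.1.1 && b2.1.2) (+) (b2.1.1 && (b1.1.2 (+) b2.1.2))) / 4%:R else 0.
Proof.
rewrite /hcomul3 (bigD1 (false, b2.1.2, true)) // big1 ?addr0 => [|c nc].
  rewrite !hcomul_z /= eqxx andbT addbF /= !addbF.
  case: b1 b2 b3 => [[[] p2] []] [[q1 q2] []] [[r1 []] []] /=; rewrite ?mul0r ?mulr0 ?addr0 //.
  by rewrite sgnD mulrACA -invfM -natrM [q2 && r1]andbC [q1 && _]andbC.
case: c nc => [[c1 cb] c2] nc; rewrite hcomul_z; case: ifP => [|_]; last by rewrite mul0r.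
move=> /and4P[c2t _ /eqP c1f _].
have {}c1f : c1 = false := c1f; have {}c2t : c2 = true := c2t; subst c1 c2.
rewrite !xpair_eqE eqxx andbT /= in nc; rewrite hcomul_z [b2.1.2 == _]eq_sym (negPf nc).
by rewrite !andbF mulr0.
Qed.

Lemma hantiE a b c : hanti K (a, b, c) =1 hbas K (if c then (b, a, c) else (a, b, c)).
Proof.
have hpE (b' : bool) : hpow (hy K) b' =1 hbas K (false, b', false) by case: b'.
have hpEx (b' : bool) : hpow (hx K) b' =1 hbas K (b', false, false) by case: b'.
have hpEz (b' : bool) : hpow (hz K) b' =1 hbas K (false, false, b') by case: b'.
have eqm (u u' v v' : hel K) : u =1 u' -> v =1 v' -> hmul u v =1 hmul u' v'.
  by move=> Hu Hv p; do 2!(apply: eq_bigr => ? _); rewrite Hu Hv.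
move=> p; rewrite /hanti (eqm _ (hbas K (if c then (b, false, c) else (false, b, c))) _ _ _ (hpEx a)).
  by rewrite hmul_bas hmul_bE ?andbF // /hbas; case: c; rewrite //= ?addbF.
by move=> p'; rewrite (eqm _ _ _ _ (hpEz c) (hpE b)) hmul_bas hmul_bE ?andbF // /hbas; case: c.
Qed.

End HopfStructure.

(** * Adjoint action of the basis on the algebra *)

Section Adjoint.
Variable K : fieldType.
Implicit Types (u v p q d : hb).

Definition adj u d v q : K := hmul (hmul (hbas K u) (hbas K d)) (hanti K v) q.

Lemma eq_hmul (u u' v v' : hel K) : u =1 u' -> v =1 v' -> hmul u v =1 hmul u' v'.
Proof. by move=> Hu Hv p; do 2!(apply: eq_bigr => ? _); rewrite Hu Hv. Qed.

(** Conjugating z by x or by y multiplies it by xy, because zx = yz and zy = xz; only the parity of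
    a + b matters. *)
Lemma adj_group a b d q :
  adj (a, b, false) d (a, b, false) q =
  (q == (if d.2 then (d.1.1 (+) (a (+) b), d.1.2 (+) (a (+) b), true) else d))%:R.
Proof.
rewrite /adj (eq_hmul (@hmul_bas K _ _) (@hantiE K a b false)).
rewrite (eq_hmul (u' := hbas K (hprod (a, b, false) d)) _ (fun _ => erefl)); last first.
  by move=> p; rewrite hmul_bE.
rewrite hmul_bas hmul_bE ?andbF //; congr (_ == _)%:R.
by case: d => [[[] []] []]; case: a; case: b.
Qed.

Lemma adj_z a b a' b' d q :
  adj (a, b, true) d (a', b', true) q =
  if d.2 == q.2 then
    z2coef K (q.1.1 (+) a (+) d.1.2 (+) (if d.2 then b' else a'))
             (q.1.2 (+) b (+) d.1.1 (+) (if d.2 then a' else b'))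
  else 0.
Proof.
rewrite /adj (eq_hmul (@hmul_bas K _ _) (@hantiE K a' b' true)).
case: d => [[m n] [|]]; last first.
  rewrite (eq_hmul (u' := hbas K (hprod (a, b, true) (m, n, false))) _ (fun _ => erefl)); last first.
    by move=> p; rewrite hmul_bE.
  rewrite hmul_bas /=; case: q => [[p r] []] //=.
  by rewrite !addbA.
(* The antipode has exchanged the exponents a' and b'. The only z-free p whose product with the last
   factor is q is the one singled out here. *)
rewrite /hmul (bigD1 (q.1.1 (+) b', q.1.2 (+) a', false)) //= [X in _ + X]big1 => [|p np].
  rewrite (bigD1 (b', a', true)) //= big1 ?addr0 => [|p /negPf np].
    case: q => [[p r] [|]]; rewrite /hbas /= !eqxx mulr1 ?andbF ?mulr0 //=.
    by rewrite !addbK !eqxx mulr1 !addbA [p (+) b' (+) _]addbAC [r (+) a' (+) _]addbAC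
      [p (+) a (+) b' (+) _]addbAC [r (+) b (+) a' (+) _]addbAC.
  by rewrite /hbas np mulr0 mul0r.
rewrite (bigD1 (b', a', true)) //= big1 ?addr0 => [|p' /negPf np']; last first.
  by rewrite /hbas np' mulr0 mul0r.
case: p np => [[s t] [|]]; first by rewrite !mul0r.
case: q => [[p r] c]; rewrite !xpair_eqE /= andbT => np.

case: (p =P s (+) b') => [pe|_]; last by rewrite mulr0.
case: (r =P t (+) a') => [re|_]; last by rewrite mulr0.
by move: np; rewrite pe re !addbK !eqxx.
Qed.

Hypothesis ch0 : [pchar K] =i pred0.

(** Summing out the outer legs of the iterated coproduct of z gives the coefficient with which an
    action composed with a coaction enters the compatibility condition for z. It vanishes unless
    both coaction indices lie in the group part or both in the span of the x^a y^b z. *)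
Lemma adj_coef_z (a b c2 m n c p r c' : bool) :
  \sum_b1 \sum_b3 hcomul3 K (false, false, true) b1 (a, b, c2) b3 * adj b1 (m, n, c) b3 (p, r, c') =
  if c2 && (c == c') then
    if c then (if (a == b) && (a == p (+) n) then sgn K (a && ~~ (r (+) m)) / 2%:R else 0)
    else sgn K (((n (+) p) && b) (+) ((m (+) r) && a)) / 4%:R
  else 0.
Proof.
have n2 : 2%:R != 0 :> K := charf0_natr_neq0 ch0 1.
have n4 : 4%:R != 0 :> K := charf0_natr_neq0 ch0 3.
rewrite big_hb; under eq_bigr do under eq_bigr do under eq_bigr do rewrite big_hb.
rewrite !sum_bool !hcomul3_z /=.
rewrite ?andbF ?andbT /= !mul0r ?add0r ?addr0.
case: c2; last by rewrite /= !mul0r !addr0.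
rewrite /= !adj_z /= /z2coef.
case: c; case: c'; rewrite /= ?mulr0 ?add0r ?addr0 //; try (by rewrite !mulr0 !addr0).
  by case: a b m n p r => [] [] [] [] [] []; rewrite /sgn /=; field; rewrite ?n2 ?n4.
by case: a b m n p r => [] [] [] [] [] []; rewrite /sgn /=; field; rewrite ?n2 ?n4.
Qed.

End Adjoint.

(** * Yetter-Drinfeld modules *)

Section Relations.
Variables (K : fieldType) (ch0 : [pchar K] =i pred0) (M : ydmod K) (HM : is_YD M).
Local Notation n := (ydim M).
Local Notation A := (yact M).
Local Notation R := (ycoact M).
Local Notation A3 a b c := (yact M (a, b, c)).
Local Notation R3 a b c := (ycoact M (a, b, c)).

Lemma act_one : A3 false false false = 1%:M.
Proof. by case: HM. Qed.

Lemma act_mul u v : ~~ (u.2 && v.2) -> A u *m A v = A (hprod u v).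
Proof.
move=> uv; case: HM => _ -> _ _ _; rewrite (bigD1 (hprod u v)) //= hmul_bE // eqxx scale1r.
by rewrite big1 ?addr0 // => p /negPf np; rewrite hmul_bE // np scale0r.
Qed.

Lemma act_genE b : A b = act_gen (A3 true false false) (A3 false true false) (A3 false false true) b.
Proof.
case: b => [[[] []] []]; rewrite /act_gen ?mulmx1 ?mul1mx ?act_one //.
all: by rewrite ?act_mul //= ?act_mul.
Qed.

Lemma act_zz : A3 false false true *m A3 false false true =
  2%:R^-1 *: (1%:M + A3 true false false + A3 false true false - A3 true true false).
Proof.
case: HM => A1 -> _ _ _; rewrite big_hb !sum_bool /= /z2coef /sgn /= A1 !scale0r !add0r.
by apply/matrixP => r s; rewrite !mxE; ring.
Qed.

Lemma coact_sum : \sum_b R b = 1%:M.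
Proof. by case: HM => _ _ <- _ _; apply: eq_bigr => b _; rewrite scale1r. Qed.

Lemma coact_mul q2 q1 : R q2 *m R q1 =
  if q1.2 && q2.2 then
    (sgn K ((q1.1.2 (+) q2.1.2) && (q1.1.1 (+) q2.1.1)) / 2%:R) *: R3 q1.1.1 q2.1.2 true
  else if q1 == q2 then R q1 else 0.
Proof.
case: HM => _ _ _ -> _; rewrite big_hb; under eq_bigr do under eq_bigr do
  rewrite sum_bool hcomul_group hcomul_z.
case: q1 => [[a1 b1] c1]; case: q2 => [[a2 b2] c2]; rewrite !sum_bool.
case: c1; case: c2; rewrite !xpair_eqE ?andbF /=;
  rewrite ?scale0r ?add0r ?addr0 ?andbT //.
- by case: a1 b1 a2 b2 => [] [] [] []; rewrite /= ?mul0r ?scale0r ?add0r ?addr0.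
- by case: a1 b1 a2 b2 => [] [] [] []; rewrite /= ?scale0r ?scale1r ?add0r ?addr0.
Qed.

Lemma coact_act_group q a b : R q *m A3 a b false = A3 a b false *m
  R (if q.2 then (q.1.1 (+) (a (+) b), q.1.2 (+) (a (+) b), true) else q).
Proof.
set q' := if q.2 then (q.1.1 (+) (a (+) b), q.1.2 (+) (a (+) b), true) else q.
case: HM => _ _ _ _ ->.
rewrite (bigD1 (a, b, false)) //= addrC big1 ?add0r => [|b1 /negPf n1]; last first.
  by do 3!(apply: big1 => ? _); rewrite hcomul3_group n1 mul0r scale0r.
rewrite (bigD1 (a, b, false)) //= addrC big1 ?add0r => [|b1 /negPf n1]; last first.
  by do 2!(apply: big1 => ? _); rewrite hcomul3_group n1 andbF mul0r scale0r.
rewrite (bigD1 (a, b, false)) //= addrC big1 ?add0r => [|b1 /negPf n1]; last first.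
  by apply: big1 => ? _; rewrite hcomul3_group n1 !andbF mul0r scale0r.
have adjE d : hmul (hmul (hbas K (a, b, false)) (hbas K d)) (hanti K (a, b, false)) q = (d == q')%:R.
  rewrite -/(adj K (a, b, false) d (a, b, false) q) adj_group; congr (nat_of_bool _)%:R.
  rewrite /q'; case: d => [[[] []] []]; case: (q) => [[[] []] []]; by case: (a); case: (b).
rewrite (bigD1 q') //= addrC big1 ?add0r => [|d /negPf nd]; last first.
  by rewrite adjE nd mulr0 scale0r.
by rewrite adjE hcomul3_group !eqxx mulr1 scale1r.
Qed.

Lemma coact_act_z q : R q *m A3 false false true =
  \sum_b2 \sum_d (\sum_b1 \sum_b3
     hcomul3 K (false, false, true) b1 b2 b3 * adj K b1 d b3 q) *: (A b2 *m R d).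
Proof.
case: HM => _ _ _ _ ->; rewrite exchange_big /=; apply: eq_bigr => b2 _.
under eq_bigr do rewrite exchange_big /=.
rewrite exchange_big /=; apply: eq_bigr => d _; rewrite scaler_suml.
by apply: eq_bigr => b1 _; rewrite scaler_suml.
Qed.

Lemma coact_act_z_group p r : R3 p r false *m A3 false false true =
  4%:R^-1 *: \sum_a \sum_b \sum_m \sum_k
    sgn K (((k (+) p) && b) (+) ((m (+) r) && a)) *: (A3 a b true *m R3 m k false).
Proof.
rewrite coact_act_z big_hb scaler_sumr; apply: eq_bigr => a _.
rewrite scaler_sumr; apply: eq_bigr => b _; rewrite sum_bool addrC big1 ?add0r; last first.
  by move=> [[m k] c] _; rewrite (adj_coef_z ch0) scale0r.
rewrite big_hb scaler_sumr; apply: eq_bigr => m _; rewrite scaler_sumr.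
apply: eq_bigr => k _; rewrite sum_bool !(adj_coef_z ch0) /= scale0r add0r.
by rewrite scalerA mulrC.
Qed.

Lemma coact_act_z_coalg p r : R3 p r true *m A3 false false true =
  2%:R^-1 *: \sum_m \sum_k
    sgn K ((p (+) k) && ~~ (r (+) m)) *: (A3 (p (+) k) (p (+) k) true *m R3 m k true).
Proof.
rewrite coact_act_z; under eq_bigr do rewrite big_hb.
rewrite exchange_big scaler_sumr /=; apply: eq_bigr => m _.
rewrite exchange_big scaler_sumr /=; apply: eq_bigr => k _.
rewrite exchange_big sum_bool /= addrC big1 ?add0r; last first.
  by move=> [[a b] c] _; rewrite (adj_coef_z ch0) andbF scale0r.
rewrite (bigD1 (p (+) k, p (+) k, true)) //= addrC big1 ?add0r => [|[[a b] c] nab].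
  by rewrite (adj_coef_z ch0) /= !eqxx /= scalerA mulrC.
rewrite (adj_coef_z ch0) /=; case: c nab => /=; last by rewrite scale0r.
rewrite !xpair_eqE andbT; case: (a =P p (+) k) => [->|_]; rewrite ?andbF ?scale0r //=.
by rewrite [_ == b]eq_sym; case: (b == _); rewrite // scale0r.
Qed.

(* Fourier transform of the four coefficients of the coaction along the simple
   subcoalgebra spanned by the x^a y^b z. *)
Definition T j k := \sum_a \sum_b sgn K ((j && a) (+) (k && b)) *: R3 a b true.

(** The dual of the four-dimensional subcoalgebra is the algebra of 2 x 2 matrices, in its form as a
    twisted group algebra of (Z/2)^2: [T false false] is the unit, [T true false] and [T false true]
    are anticommuting involutions, and [T true true] squares to minus the unit. *)
Lemma T_mul j k j' k' : T j k *m T j' k' = sgn K (j && k') *: T (j (+) j') (k (+) k').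
Proof.
have n2 : 2%:R != 0 :> K := charf0_natr_neq0 ch0 1.
rewrite /T !sum_bool !mulmxDl !mulmxDr -!scalemxAl -!scalemxAr !coact_mul /=.
apply/matrixP => r s; rewrite !mxE.
by case: j; case: k; case: j'; case: k'; rewrite /sgn /=; field.
Qed.

Lemma T_act_group j k a b : T j k *m A3 a b false =
  sgn K ((a (+) b) && (j (+) k)) *: (A3 a b false *m T j k).
Proof.
rewrite /T !sum_bool !mulmxDl !mulmxDr -!scalemxAl -!scalemxAr !coact_act_group /=.
apply/matrixP => r s; rewrite !mxE.
by case: j; case: k; case: a; case: b; rewrite /sgn /=; ring.
Qed.

Lemma T_act_z j k : T j k *m A3 false false true =
  sgn K (k && ~~ j) *: (A3 k k true *m T k j).
Proof.
have n2 : 2%:R != 0 :> K := charf0_natr_neq0 ch0 1.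
rewrite /T !sum_bool !mulmxDl !mulmxDr -!scalemxAl -!scalemxAr !coact_act_z_coalg.
rewrite !sum_bool /=.
apply/matrixP => r s; rewrite !mxE.
by case: j; case: k; rewrite /sgn /=; field.
Qed.

Lemma coact_T a b : R3 a b true =
  4%:R^-1 *: \sum_j \sum_k sgn K ((j && a) (+) (k && b)) *: T j k.
Proof.
have n4 : 4%:R != 0 :> K := charf0_natr_neq0 ch0 3.
rewrite /T !sum_bool /=; apply/matrixP => r s; rewrite !mxE.
by case: a; case: b; rewrite /sgn /=; field.
Qed.

Lemma coact_group_T a b j k : R3 a b false *m T j k = 0.
Proof. by rewrite /T !sum_bool !mulmxDr -!scalemxAr !coact_mul /= !xpair_eqE ?andbF /= !scaler0 !addr0. Qed.

Lemma T_coact_group a b j k : T j k *m R3 a b false = 0.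
Proof. by rewrite /T !sum_bool !mulmxDl -!scalemxAl !coact_mul /= !xpair_eqE ?andbF /= !scaler0 !addr0. Qed.

Lemma coact_sum_T : \sum_a \sum_b R3 a b false + T false false = 1%:M.
Proof.
rewrite -coact_sum big_hb /T !sum_bool /= /sgn /= !scale1r.
by apply/matrixP => r s; rewrite !mxE; ring.
Qed.

End Relations.

Lemma cmat_vec (K : fieldType) (M : ydmod K) (v w : 'cV[K]_(ydim M)) r s :
  \sum_p \sum_q cmat (M := M) r s p q * (v p 0 * w q 0) =
  \sum_b (yact M b *m w) r 0 * (ycoact M b *m v) s 0.
Proof.
transitivity (\sum_b \sum_p \sum_q yact M b r q * ycoact M b s p * (v p 0 * w q 0)).
  rewrite [RHS]exchange_big; apply: eq_bigr => p _.
  rewrite [RHS]exchange_big; apply: eq_bigr => q _.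
  by rewrite /cmat big_distrl.
apply: eq_bigr => b _; rewrite !mxE mulrC big_distrl; apply: eq_bigr => p _.
by rewrite big_distrr; apply: eq_bigr => q _ /=; ring.
Qed.

(** * Blocks and their braidings *)

Section Blocks.
Variables (K : fieldType) (ch0 : [pchar K] =i pred0) (M : ydmod K) (HM : is_YD M).
Hypothesis fM : fin_nichols M.
Local Notation n := (ydim M).
Local Notation A := (yact M).
Local Notation R := (ycoact M).
Local Notation A3 a b c := (yact M (a, b, c)).
Local Notation R3 a b c := (ycoact M (a, b, c)).
Local Notation X := (A3 true false false).
Local Notation Y := (A3 false true false).
Local Notation Z := (A3 false false true).
Local Notation T := (T M).
Local Notation sg := (sgn K).

Lemma sgK s : sg s * sg s = 1. Proof. by case: s; rewrite /sgn ?mulrNN mulr1. Qed.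

(* [block o s t V]: on the columns of V, x and y act by the signs s and t; the
   coaction is by the group-like x^a y^b if o = Some (a, b), and by the simple
   subcoalgebra spanned by the x^a y^b z if o = None. *)
Definition block (o : option (bool * bool)) (s t : bool) m (V : 'M[K]_(n, m)) :=
  [/\ X *m V = sg s *: V, Y *m V = sg t *: V,
      forall a b, R3 a b false *m V = (o == Some (a, b))%:R *: V
    & T false false *m V = (o == None)%:R *: V].

Lemma blockM o s t m k (V : 'M[K]_(n, m)) (W : 'M_(m, k)) :
  block o s t V -> block o s t (V *m W).
Proof. by case=> H1 H2 H3 H4; split=> *; rewrite mulmxA ?H1 ?H2 ?H3 ?H4 scalemxAl. Qed.

Lemma blockZ o s t m a (V : 'M[K]_(n, m)) : block o s t V -> block o s t (a *: V).
Proof. by case=> H1 H2 H3 H4; split=> *; rewrite -scalemxAr ?H1 ?H2 ?H3 ?H4 !scalerA mulrC. Qed.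

Lemma blockD o s t m (V W : 'M[K]_(n, m)) :
  block o s t V -> block o s t W -> block o s t (V + W).
Proof.
by case=> H1 H2 H3 H4 [H1' H2' H3' H4']; split=> *;
  rewrite mulmxDr ?H1 ?H2 ?H3 ?H4 ?H1' ?H2' ?H3' ?H4' scalerDr.
Qed.

Lemma block0 o s t m : block o s t (0 : 'M[K]_(n, m)).
Proof. by split=> *; rewrite mulmx0 scaler0. Qed.

Lemma ZX : Z *m X = Y *m Z. Proof. by rewrite !act_mul. Qed.
Lemma ZY : Z *m Y = X *m Z. Proof. by rewrite !act_mul. Qed.

Lemma act_block o s t m (V : 'M[K]_(n, m)) a b c : block o s t V ->
  A3 a b c *m V = sg (if c then (a && t) (+) (b && s) else (a && s) (+) (b && t)) *:
    ((if c then Z else 1%:M) *m V).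
Proof.
case=> H1 H2 _ _; rewrite (act_genE HM) /act_gen -!mulmxA.
case: c.
  have HX : X *m (Z *m V) = sg t *: (Z *m V) by rewrite mulmxA -ZY -mulmxA H2 scalemxAr.
  have HY : Y *m (Z *m V) = sg s *: (Z *m V) by rewrite mulmxA -ZX -mulmxA H1 scalemxAr.
  case: b; case: a; rewrite ?mul1mx ?HX ?HY -?scalemxAr ?HX ?HY ?scalerA -?sgnD //=.
  - by rewrite addbC.
  - by rewrite addbF.
  - by rewrite scale1r.
case: b; case: a; rewrite ?mul1mx ?H1 ?H2 -?scalemxAr ?H1 ?H2 ?scalerA -?sgnD //=.
- by rewrite addbC.
- by rewrite addbF.
- by rewrite scale1r.
Qed.

Lemma T_Z j k m (V : 'M[K]_(n, m)) o s t : block o s t V ->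
  T j k *m (Z *m V) = sg (k && ~~ j) *: (sg (k && (s (+) t)) *: (Z *m (T k j *m V))).
Proof.
move=> bV; rewrite mulmxA (T_act_z ch0 HM) -scalemxAl; congr (_ *: _).
have -> : A3 k k true = Z *m A3 k k false by rewrite act_mul.
rewrite -!mulmxA; have := T_act_group HM k j k k; rewrite addbb /= scale1r => e.
rewrite [A3 k k false *m _]mulmxA -e -mulmxA (act_block _ _ _ bV) mul1mx -!scalemxAr.
by case: k {e}.
Qed.

Lemma block_Z o s t m (V : 'M[K]_(n, m)) : block o s t V ->
  block (omap (fun g => (g.2 (+) s, g.1 (+) t)) o) t s (Z *m V).
Proof.
move=> bV; case: (bV) => H1 H2 H3 H4; split.
- by rewrite mulmxA -ZY -mulmxA H2 scalemxAr.
- by rewrite mulmxA -ZX -mulmxA H1 scalemxAr.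
- move=> p r; rewrite mulmxA (coact_act_z_group ch0 HM) -scalemxAl.
  case: o bV H3 {H4} => [[g1 g2]|] bV H3 /=; last first.
    rewrite scale0r mulmx_suml big1 ?scaler0 // => a _; rewrite mulmx_suml big1 // => b _.
    rewrite mulmx_suml big1 // => a' _; rewrite mulmx_suml big1 // => b' _.
    by rewrite -scalemxAl -mulmxA H3 scale0r mulmx0 scaler0.
  (* As a function of (a, b) this is a character of (Z/2)^2, so its sum is 4 or 0: the sum picks out
     the new degree. *)
  pose c a b := sg (((g2 (+) p) && b) (+) ((g1 (+) r) && a)) * sg ((a && t) (+) (b && s)).
  have e a b : (\sum_m \sum_k sg (((k (+) p) && b) (+) ((m (+) r) && a)) *:
      (A3 a b true *m R3 m k false)) *m V = c a b *: (Z *m V).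
    rewrite mulmx_suml (bigD1 g1) //= addrC big1 ?add0r => [|a' /negPf na]; last first.
      rewrite mulmx_suml big1 // => b' _; rewrite -scalemxAl -mulmxA H3.
      have -> : Some (g1, g2) == Some (a', b') = (g1 == a') && (g2 == b') by [].
      by rewrite eq_sym na scale0r mulmx0 scaler0.
    rewrite mulmx_suml (bigD1 g2) //= addrC big1 ?add0r => [|b' /negPf nb]; last first.
      rewrite -scalemxAl -mulmxA H3.
      have -> : Some (g1, g2) == Some (g1, b') = (g1 == g1) && (g2 == b') by [].
      by rewrite [g2 == _]eq_sym nb andbF scale0r mulmx0 scaler0.
    by rewrite -scalemxAl -mulmxA H3 eqxx scale1r (act_block _ _ _ bV) scalerA.
  transitivity ((4%:R^-1 * (\sum_a \sum_b c a b)) *: (Z *m V)).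
    rewrite -scalerA; congr (_ *: _); rewrite mulmx_suml scaler_suml.
    apply: eq_bigr => a _; rewrite mulmx_suml scaler_suml; apply: eq_bigr => b _.
    exact: e.
  congr (_ *: _); rewrite !sum_bool /c {c e bV H1 H2 H3}.
  have -> : Some (g2 (+) s, g1 (+) t) == Some (p, r) = (g2 (+) s == p) && (g1 (+) t == r) by [].
  have n4 : 4%:R != 0 :> K := charf0_natr_neq0 ch0 3.
  case: g1 g2 p r s t => [] [] [] [] [] [] /=; rewrite /sgn /=; by field.
rewrite (T_Z _ _ bV) /= /sgn !scale1r H4 -scalemxAr.
by case: o {bV H3 H4}.
Qed.

Lemma zz_block o s t m (V : 'M[K]_(n, m)) : block o s t V ->
  Z *m (Z *m V) = sg (s && t) *: V.
Proof.
move=> bV; rewrite mulmxA (act_zz HM) -scalemxAl mulmxBl !mulmxDl.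
rewrite !(act_block _ _ _ bV) !mul1mx /=.
have n2 : 2%:R != 0 :> K := charf0_natr_neq0 ch0 1.
apply/matrixP => i j; rewrite !mxE; case: s t {bV} => [] []; rewrite /sgn /=; by field.
Qed.

Lemma T_block o s t m (V : 'M[K]_(n, m)) : block o s t V -> o != None ->
  forall j k, T j k *m V = 0.
Proof.
case=> _ _ _ H oN j k; have := T_mul ch0 HM j k false false.
rewrite andbF !addbF /sgn scale1r => <-.
by rewrite -mulmxA H (negPf oN) scale0r mulmx0.
Qed.

Lemma T_blockC j k s t m (V : 'M[K]_(n, m)) : block None s t V ->
  block None (s (+) (j (+) k)) (t (+) (j (+) k)) (T j k *m V).
Proof.
case=> H1 H2 H3 H4; split=> [|||].
- have := T_act_group HM j k true false; rewrite /= => e.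
  have {e} : sg (j (+) k) *: (T j k *m X) = X *m T j k by rewrite e scalerA sgK scale1r.
  by rewrite mulmxA => <-; rewrite -scalemxAl -mulmxA H1 -scalemxAr scalerA -sgnD addbC.
- have := T_act_group HM j k false true; rewrite /= => e.
  have {e} : sg (j (+) k) *: (T j k *m Y) = Y *m T j k by rewrite e scalerA sgK scale1r.
  by rewrite mulmxA => <-; rewrite -scalemxAl -mulmxA H2 -scalemxAr scalerA -sgnD addbC.
- by move=> a b; rewrite mulmxA (coact_group_T HM) mul0mx scale0r.
- by rewrite mulmxA (T_mul ch0 HM) /= /sgn !scale1r.
Qed.

Lemma coact_blockC s t (v : 'cV[K]_n) (w : 'cV_n) o s' t' r r' :
  block None s t v -> block o s' t' w ->
  \sum_b (A b *m w) r 0 * (R b *m v) r' 0 =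
  (Z *m w) r 0 * (T t' s' *m v) r' 0.
Proof.
case=> _ _ H3 _ bw; rewrite big_hb; under eq_bigr do under eq_bigr do
  rewrite sum_bool H3 scale0r [X in _ + _ * X]mxE mulr0 addr0 (act_block _ _ _ bw).
rewrite /T !mulmx_suml summxE big_distrr; apply: eq_bigr => a _.
rewrite mulmx_suml summxE big_distrr; apply: eq_bigr => b _ /=.
by rewrite -scalemxAl !mxE [t' && a]andbC [s' && b]andbC; ring.
Qed.

Lemma coact_block_group g s t (v : 'cV[K]_n) (w : 'cV_n) o s' t' r r' :
  block (Some g) s t v -> block o s' t' w ->
  \sum_b (A b *m w) r 0 * (R b *m v) r' 0 =
  sg ((g.1 && s') (+) (g.2 && t')) * (w r 0 * v r' 0).
Proof.
move=> bv bw; case: (bv) => _ _ H3 _.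
have Hz a b : R3 a b true *m v = 0.
  by rewrite (coact_T ch0) !sum_bool -scalemxAl !mulmxDl -!scalemxAl
    !(T_block bv) // !scaler0 !addr0 scaler0.
rewrite big_hb; under eq_bigr do under eq_bigr do
  rewrite sum_bool Hz [X in _ * X]mxE mulr0 add0r H3 (act_block _ _ _ bw) mul1mx.
rewrite !sum_bool; case: g {bv H3 Hz} => [[] []] /=;
  rewrite !scale0r !scale1r !mxE; ring.
Qed.

Lemma vanish m (V : 'M[K]_(n, m)) :
  (forall w : 'cV_m, let v := V *m w in forall r r',
     \sum_b (A b *m v) r 0 * (R b *m v) r' 0 = v r 0 * v r' 0) ->
  V = 0.
Proof.
move=> H; apply/matrixP => i j; rewrite mxE; apply/eqP/negPn/negP => Vij.
apply: (@fixed_infinite K ch0 M (col j V)) fM => [|r r'].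
  by apply/cV0Pn; exists i; rewrite mxE.
rewrite cmat_vec colE; exact: H.
Qed.

(** A vector of group-like degree g braids with itself by the sign through which g acts on it; the
    sign +1 would give a fixed vector. *)
Lemma block_group_eq0 g s t m (V : 'M[K]_(n, m)) :
  block (Some g) s t V -> (g.1 && s) (+) (g.2 && t) = false -> V = 0.
Proof.
move=> bV e; apply: vanish => w v r r'.
have bv := blockM w bV.
by rewrite (coact_block_group _ _ bv bv) e mul1r.
Qed.

Lemma blockC_eq0 m (V : 'M[K]_(n, m)) :
  block None false false V -> Z *m V = V -> V = 0.
Proof.
move=> bV zV; apply: vanish => w v r r'; have bv := blockM w bV.
rewrite (coact_blockC _ _ bv bv) /v mulmxA zV; congr (_ * _).
by case: bv => _ _ _ ->; rewrite scale1r.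
Qed.

End Blocks.

Lemma closed_sqrt (K : closedFieldType) (a : K) : exists z, z * z = a.
Proof.
have [z Hz] := @solve_monicpoly K 2 (fun k => if k == 0%N then a else 0) isT.
exists z; move: Hz; rewrite expr2 => ->.
by rewrite !big_ord_recl big_ord0 /= mul0r !addr0 mulr1.
Qed.

(** * The part of the subcoalgebra block with xy = -1 *)

Section Twisted.
Variables (K : closedFieldType) (ch0 : [pchar K] =i pred0) (i : K) (ii : i * i = -1).
Variables (M : ydmod K) (HM : is_YD M) (fM : fin_nichols M).
Local Notation n := (ydim M).
Local Notation A3 a b c := (yact M (a, b, c)).
Local Notation X := (A3 true false false).
Local Notation Y := (A3 false true false).
Local Notation Z := (A3 false false true).
Local Notation T := (T M).
Local Notation sg := (sgn K).

(** If f^2 = a = z^2, then f v + z v is an eigenvector for z, unless it is zero, and then v is one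
    for -z. The predicate P confines the search to a subspace stable under f. *)
Lemma sqrt_eigenvector (f : 'cV[K]_n -> 'cV[K]_n) (P : 'cV[K]_n -> Prop) (a z : K) :
  z * z = a -> {morph f : u v / u + v} -> (forall b, {morph f : u / b *: u}) ->
  (forall u v, P u -> P v -> P (u + v)) -> (forall b u, P u -> P (b *: u)) ->
  (forall u, P u -> P (f u)) -> (forall u, P u -> f (f u) = a *: u) ->
  forall v, v != 0 -> P v ->
  exists z' w, [/\ z' * z' = a, w != 0, P w & f w = z' *: w].
Proof.
move=> za fD fZ PD PZ Pf ff v v0 Pv.
have [e|ne] := eqVneq (f v + z *: v) 0.
  exists (- z), v; split; rewrite ?mulrNN // scaleNr; apply/eqP.
  by rewrite -addr_eq0 e.
exists z, (f v + z *: v); split=> //; first by apply: PD; [apply: Pf|apply: PZ].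
by rewrite fD fZ ff // scalerDr scalerA za addrC.
Qed.

(* On the block x = 1, y = -1 the operator (Z T_10)^2 is T_11, whose square is -1.
   An eigenvector w of T_11 and of Z T_10 spans with Z w a braided subspace of the
   kind treated in [twisted_infinite]. *)
Lemma blockC_01_eq0 m (V : 'M[K]_(n, m)) : block None false true V -> V = 0.
Proof.
move=> bV; apply/matrixP => r j; rewrite mxE; apply/eqP/negPn/negP => Vrj.
have : col j V != 0 by apply/cV0Pn; exists r; rewrite mxE.
have : block None false true (col j V) by rewrite colE; apply: blockM.
move: (col j V) => v {r j Vrj bV m V} bv v0.
have NN (u : 'cV_n) : block None false true u -> T true true *m (T true true *m u) = -1 *: u.
  by case=> _ _ _ H; rewrite mulmxA (T_mul ch0 HM) -scalemxAl H scale1r.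
have [nu [{}v [nu2 {}v0 {}bv Nv]]] : exists (z' : K) (w : 'cV[K]_n), [/\ z' * z' = -1, w != 0,
    block None false true w & T true true *m w = z' *: w].
  apply: (@sqrt_eigenvector (fun u => T true true *m u) (fun u => block None false true u)
    _ _ ii _ _ _ _ _ NN v) => // [u w|b u|u w|b u|u].
  - by rewrite mulmxDr.
  - by rewrite -scalemxAr.
  - exact: blockD.
  - exact: blockZ.
  - by move/(T_blockC ch0 HM true true).
pose Q (u : 'cV_n) := Z *m (T true false *m u).
have bS (u : 'cV_n) : block None false true u -> block None true false (T true false *m u).
  by move/(T_blockC ch0 HM true false).
have bQ (u : 'cV_n) : block None false true u -> block None false true (Q u).
  by move/bS/(block_Z ch0 HM).
have NQ u : block None false true u -> T true true *m Q u = Q (T true true *m u).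
  move=> bu; rewrite /Q (T_Z ch0 HM _ _ (bS _ bu)) /= /sgn scale1r !mulmxA -!mulmxA.
  by rewrite !(mulmxA (T _ _)) !(T_mul ch0 HM) /= /sgn scale1r -scalemxAl -scalemxAr.
have QQ u : block None false true u -> Q (Q u) = T true true *m u.
  move=> bu; rewrite /Q (T_Z ch0 HM _ _ (bS _ bu)) /= /sgn !scale1r.
  rewrite (mulmxA (T _ _)) (T_mul ch0 HM) /= /sgn scale1r.
  by rewrite (zz_block ch0 HM (T_blockC ch0 HM true true bu)) scale1r.
(* As nu^2 = -1, a square root of nu is a primitive eighth root of unity, which algebraic closedness
   provides. *)
have [z0 z02] := closed_sqrt nu.
have [z [w [zz w0 [bw Nw] Qw]]] : exists (z' : K) (w : 'cV[K]_n), [/\ z' * z' = nu, w != 0,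
    block None false true w /\ T true true *m w = nu *: w & Q w = z' *: w].
  apply: (@sqrt_eigenvector Q (fun u => block None false true u /\ T true true *m u = nu *: u)
    _ _ z02 _ _ _ _ _ _ v) => // [u w|b u|u w|b u|u|u].
  - by rewrite /Q !mulmxDr.
  - by rewrite /Q -!scalemxAr.
  - by move=> [bu Nu] [bw Nw]; rewrite mulmxDr Nu Nw scalerDr; split=> //; apply: blockD.
  - by move=> [bu Nu]; rewrite -scalemxAr Nu !scalerA mulrC; split=> //; apply: blockZ.
  - by move=> [bu Nu]; rewrite NQ // Nu /Q -!scalemxAr; split=> //; apply: bQ.
  - by move=> [bu Nu]; rewrite QQ.
have zu : z != 0 by apply/eqP => z0'; move/eqP: nu2; rewrite -zz z0' !mul0r eq_sym oppr_eq0 oner_eq0.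
have zV : z^-1 = - (z * nu).
  by apply: (mulfI zu); rewrite mulfV // mulrN mulrA zz nu2 opprK.
have Sw : T true false *m w = z *: (Z *m w).
  by have := zz_block ch0 HM (bS _ bw); rewrite -/(Q w) Qw /= /sgn scale1r -scalemxAr.
have Dw : T false true *m w = z^-1 *: (Z *m w).
  have := T_mul ch0 HM true true true false; rewrite /= /sgn scale1r => <-.
  rewrite -mulmxA Sw -scalemxAr (T_Z ch0 HM _ _ bw) /= /sgn scale1r Nw -scalemxAr !scalerA zV.
  by congr (_ *: _); ring.
have zzw : Z *m (Z *m w) = w by rewrite (zz_block ch0 HM bw) /sgn scale1r.
have Szw : T true false *m (Z *m w) = z^-1 *: w.
  by rewrite (T_Z ch0 HM _ _ bw) /= /sgn !scale1r Dw -scalemxAr zzw.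
have Dzw : T false true *m (Z *m w) = z *: w.
  by rewrite (T_Z ch0 HM _ _ bw) /= /sgn Sw -scalemxAr zzw scalerA mulrNN mulr1 scale1r.
have [r0 wr0] := cV0Pn _ w0.
have n2 : 2%:R != 0 :> K := charf0_natr_neq0 ch0 1.
pose ph : 'rV[K]_n := (w r0 0)^-1 *: delta_mx 0 r0.
have phw : (ph *m w) 0 0 = 1.
  rewrite /ph -scalemxAl mxE mxE (bigD1 r0) //= big1 ?addr0 => [|k /negPf nk].
    by rewrite mxE !eqxx mul1r mulVf.
  by rewrite mxE nk andbF mul0r.
pose vb (b : bool) := if b then Z *m w else w.
have bv' b : block None b (~~ b) (vb b).
  by case: b => //; have := block_Z ch0 HM bw.
(* Dual covectors: half of 1 + [sg b] X selects the eigenvalue of x that tells w from Z w, and Z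
   brings Z w back to w before [ph] evaluates. *)
pose G (b : bool) := 2%:R^-1 *: (ph *m ((if b then Z else 1%:M) *m (1%:M + sg b *: X))).
apply: (@twisted_infinite K ch0 M vb G z^-1) fM.
- have -> : z^-1 ^+ 4 = ((z * z) * (z * z))^-1 by rewrite exprVn; congr (_^-1); ring.
  by rewrite zz nu2 invrN1.
- move=> a b; rewrite /G -scalemxAl -!mulmxA mulmxDl mul1mx -scalemxAl.
  case: (bv' b) => -> _ _ _; rewrite scalerA -sgnD.
  case: a; case: b; rewrite /= /sgn ?scale1r ?scaleN1r ?subrr ?mulmx0 ?scaler0; [| by rewrite mxE | by rewrite mxE |].
    by rewrite -mulr2n -scaler_nat -!scalemxAr zzw scalerA mulVf // scale1r phw.
  by rewrite mul1mx -mulr2n -scaler_nat -!scalemxAr scalerA mulVf // scale1r phw.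
- move=> a b r s; rewrite cmat_vec (coact_blockC HM _ _ (bv' a) (bv' b)) invrK.
  have -> : Z *m vb b = vb (~~ b) by case: b.
  have -> : T (~~ b) b *m vb a = (if a (+) b then z^-1 else z) *: vb (~~ a).
    by case: a; case: b; rewrite /= ?Sw ?Dw ?Szw ?Dzw.
  by rewrite [in LHS]mxE mulrCA.
Qed.

Lemma blockC_mixed_eq0 s t m (V : 'M[K]_(n, m)) : block None s t V -> s (+) t -> V = 0.
Proof.
case: s; case: t => // bV _; last exact: blockC_01_eq0 bV.
have := blockC_01_eq0 (block_Z ch0 HM bV) => e.
by have := zz_block ch0 HM bV; rewrite e mulmx0 /sgn scale1r.
Qed.

End Twisted.

(** With E = c r a full-rank factorization, c r c r = c r, and both factors cancel. So [col_base] is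
    a basis of the image of E and [row_base] its dual basis. *)
Lemma idem_base (K : fieldType) n (E : 'M[K]_n) : E *m E = E ->
  row_base E *m col_base E = 1%:M.
Proof.
move=> EE; have := row_base_free E; have := col_base_full E; have := mulmx_base E.
move: (col_base E) (row_base E) => c r cr c_full r_free.
apply: (row_full_inj c_full); apply: (row_free_inj r_free).
by rewrite /= mulmx1 !mulmxA cr -mulmxA cr.
Qed.

Lemma idem_col_base (K : fieldType) n (E : 'M[K]_n) : E *m E = E ->
  E *m col_base E = col_base E.
Proof.
move=> EE; have := idem_base EE; have := mulmx_base E.
move: (col_base E) (row_base E) => c r cr rc.
by have := mulmxA c r c; rewrite cr rc mulmx1.
Qed.

(** * Decomposition into simple constituents *)

(* Basis vectors of the simple modules that survive: inl (c, e) is the basis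
   vector of M<(-1)^e i, x> (c = false) or M<(-1)^e i, y> (c = true),
   inr (inl (c, k)) is p_(k+1) in M<(xy, x)> (c = false) or M<(y, xy)> (c = true),
   inr (inr (b, k)) is p_(k+1) in W^{(-1)^b, -1}. *)
Definition lab := ((bool * bool) + ((bool * bool) + (bool * bool)))%type.

Definition lab_x (t : lab) : bool :=
  match t with inl _ => true | inr (inl (_, k)) => k | inr (inr (_, k)) => k end.
Definition lab_y (t : lab) : bool :=
  match t with inl _ => true | inr (inl (_, k)) => ~~ k | inr (inr (_, k)) => k end.
Definition lab_o (t : lab) : option (bool * bool) :=
  match t with
  | inl (c, _) => Some (~~ c, c)
  | inr (inl (c, k)) => Some (if c then (k, true) else (true, ~~ k))
  | inr (inr _) => None
  end.
Definition lab_z (t : lab) : lab :=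
  if t is inr (inl (c, k)) then inr (inl (c, ~~ k)) else t.
Definition lab_s (t : lab) : lab :=
  if t is inr (inr (b, k)) then inr (inr (b, ~~ k)) else t.
Definition lab0 (t : lab) : lab :=
  match t with
  | inl _ => t | inr (inl (c, _)) => inr (inl (c, false))
  | inr (inr (b, _)) => inr (inr (b, false))
  end.

Lemma big_lab (R : nmodType) (F : lab -> R) : \sum_t F t =
  \sum_c \sum_e F (inl (c, e)) + (\sum_c \sum_k F (inr (inl (c, k))) + \sum_b \sum_k F (inr (inr (b, k)))).
Proof.
rewrite big_sumType /= big_sumType /=; congr (_ + (_ + _)); rewrite pair_bigA /=;
by apply: eq_bigr => -[].
Qed.

Lemma big_option (R : nmodType) (F : option (bool * bool) -> R) :
  \sum_o F o = F None + \sum_a \sum_b F (Some (a, b)).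
Proof.
rewrite (bigD1 None) //=; congr (_ + _).
rewrite pair_bigA /= (reindex (@Some (bool * bool))) /=.
  by apply: eq_bigr => -[].
by exists (fun o => odflt (true, true) o) => [g|[g|]].
Qed.

Section Projectors.
Variables (K : closedFieldType) (ch0 : [pchar K] =i pred0) (i : K) (ii : i * i = -1).
Variables (M : ydmod K) (HM : is_YD M) (fM : fin_nichols M).
Local Notation n := (ydim M).
Local Notation A3 a b c := (yact M (a, b, c)).
Local Notation R3 a b c := (ycoact M (a, b, c)).
Local Notation X := (A3 true false false).
Local Notation Y := (A3 false true false).
Local Notation Z := (A3 false false true).
Local Notation T := (T M).
Local Notation sg := (sgn K).

Let n2 : 2%:R != 0 :> K := charf0_natr_neq0 ch0 1.

Lemma half_half m k (V : 'M[K]_(m, k)) : 2%:R^-1 *: (V + V) = V.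
Proof. by rewrite -mulr2n -scaler_nat scalerA mulVf ?scale1r. Qed.

Lemma coactC_Z m (V : 'M[K]_(n, m)) : block None false false V -> Z *m V = - V.
Proof.
move=> bV; apply/eqP; rewrite -addr_eq0 addrC; apply/eqP.
apply: (blockC_eq0 ch0 HM fM); first by apply: blockD => //; exact: (block_Z ch0 HM bV).
by rewrite mulmxDr (zz_block ch0 HM bV) /sgn scale1r addrC.
Qed.

Definition proj_x s : 'M[K]_n := 2%:R^-1 *: (1%:M + sg s *: X).
Definition proj_y s : 'M[K]_n := 2%:R^-1 *: (1%:M + sg s *: Y).
Definition proj_o (o : option (bool * bool)) : 'M[K]_n :=
  if o is Some (a, b) then R3 a b false else T false false.
Definition bproj o s t := proj_x s *m (proj_y t *m proj_o o).

Lemma bproj_block o s t o' s' t' m (V : 'M[K]_(n, m)) : block o s t V ->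
  bproj o' s' t' *m V = [&& o' == o, s' == s & t' == t]%:R *: V.
Proof.
case=> H1 H2 H3 H4; rewrite /bproj -!mulmxA.
have -> : proj_o o' *m V = (o' == o)%:R *: V.
  by rewrite [o' == o]eq_sym; case: o' => [[a b]|]; rewrite /proj_o ?H3 ?H4.
have -> : proj_y t' *m ((o' == o)%:R *: V) = ((o' == o) && (t' == t))%:R *: V.
  rewrite -scalemxAr -mulnb natrM -scalerA; congr (_ *: _).
  rewrite /proj_y -scalemxAl mulmxDl mul1mx -scalemxAl H2 scalerA -sgnD.
  by case: t' t {H2} => [] []; rewrite /sgn /= ?scale1r ?scaleN1r ?subrr ?scaler0 ?scale0r // half_half.
have -> : [&& o' == o, s' == s & t' == t]%:R = ((o' == o) && (t' == t))%:R * (s' == s)%:R :> K.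
  by rewrite -natrM mulnb andbAC andbA.
rewrite -scalemxAr -scalerA; congr (_ *: _).
rewrite /proj_x -scalemxAl mulmxDl mul1mx -scalemxAl H1 scalerA -sgnD.
by case: s' s {H1} => [] []; rewrite /sgn /= ?scale1r ?scaleN1r ?subrr ?scaler0 ?scale0r // half_half.
Qed.

Lemma proj_o_comm o a b : proj_o o *m A3 a b false = A3 a b false *m proj_o o.
Proof.
case: o => [[a' b']|]; first by rewrite /= (coact_act_group HM).
by rewrite /= (T_act_group HM) andbF /sgn scale1r.
Qed.

Lemma block_bproj o s t : block o s t (bproj o s t).
Proof.
have XX : X *m X = 1%:M by rewrite act_mul // /= act_one.
have YY : Y *m Y = 1%:M by rewrite act_mul // /= act_one.
have XY : X *m Y = Y *m X by rewrite !act_mul.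
have XP u : X *m proj_x u = sg u *: proj_x u.
  rewrite /proj_x -scalemxAr mulmxDr mulmx1 -scalemxAr XX [RHS]scalerA [sg u * _]mulrC -[RHS]scalerA; congr (_ *: _).
  by rewrite scalerDr scalerA sgK scale1r addrC.
have YP u : Y *m proj_y u = sg u *: proj_y u.
  rewrite /proj_y -scalemxAr mulmxDr mulmx1 -scalemxAr YY [RHS]scalerA [sg u * _]mulrC -[RHS]scalerA; congr (_ *: _).
  by rewrite scalerDr scalerA sgK scale1r addrC.
have YX u : Y *m proj_x u = proj_x u *m Y.
  by rewrite /proj_x -scalemxAr -scalemxAl mulmxDr mulmxDl mulmx1 mul1mx -scalemxAr -scalemxAl XY.
have CX o' u : proj_o o' *m proj_x u = proj_x u *m proj_o o'.
  by rewrite /proj_x -scalemxAr -scalemxAl mulmxDr mulmxDl mulmx1 mul1mx -scalemxAr -scalemxAl proj_o_comm.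
have CY o' u : proj_o o' *m proj_y u = proj_y u *m proj_o o'.
  by rewrite /proj_y -scalemxAr -scalemxAl mulmxDr mulmxDl mulmx1 mul1mx -scalemxAr -scalemxAl proj_o_comm.
have CC o' : proj_o o' *m bproj o s t = bproj o s t *m proj_o o'.
  rewrite /bproj mulmxA CX -mulmxA [proj_o o' *m (_ *m _)]mulmxA CY -!mulmxA; congr (_ *m (_ *m _)).
  case: o' o => [[a' b']|] [[a b]|] //=.
  - rewrite !(coact_mul HM) /=; case: eqP => [->|ne] //; case: eqP => // e.
    by case: ne.
  - by rewrite (T_coact_group HM) (coact_group_T HM).
  - by rewrite (T_coact_group HM) (coact_group_T HM).
split.
- by rewrite /bproj (mulmxA X) XP scalemxAl.
- by rewrite /bproj (mulmxA Y) YX -mulmxA (mulmxA Y) YP -scalemxAl -scalemxAr.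
- move=> a b; rewrite -[R3 a b false]/(proj_o (Some (a, b))) CC /bproj -!mulmxA !scalemxAr.
  congr (_ *m (_ *m _)); case: o {CC} => [[a' b']|] /=.
    have e : ((a, b, false) == (a', b', false)) = (Some (a', b') == Some (a, b)).
      by case: a a' b b' => [] [] [] [].
    by rewrite (coact_mul HM) e; case: eqP => [[-> ->]|_]; rewrite ?scale1r ?scale0r.
  by rewrite (T_coact_group HM) scale0r.
- rewrite -[T false false]/(proj_o None) CC /bproj -!mulmxA !scalemxAr.
  congr (_ *m (_ *m _)); case: o {CC} => [[a' b']|] /=.
    by rewrite (coact_group_T HM) scale0r.
  by rewrite (T_mul ch0 HM).
Qed.

Lemma bproj_sum : \sum_o \sum_s \sum_t bproj o s t = 1%:M.
Proof.
have sX : \sum_s proj_x s = 1%:M.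
  by rewrite sum_bool -scalerDr /sgn scaleN1r scale1r addrACA addNr addr0 half_half.
have sY : \sum_s proj_y s = 1%:M.
  by rewrite sum_bool -scalerDr /sgn scaleN1r scale1r addrACA addNr addr0 half_half.
transitivity (\sum_o proj_o o).
  apply: eq_bigr => o _; rewrite -[RHS]mul1mx -sX mulmx_suml; apply: eq_bigr => s _.
  by rewrite -mulmx_sumr; congr (_ *m _); rewrite -mulmx_suml sY mul1mx.
by rewrite -(coact_sum_T HM) big_option addrC.
Qed.

(** A block leaves one sign open on a line, where z^2 = -1, and on W, where the square of
    [T true true] is -1; the second clause records that eigenvalue. On W it changes sign with k,
    since [T true false] anticommutes with [T true true]. *)
Definition typ (t : lab) m (V : 'M[K]_(n, m)) :=
  block (lab_o t) (lab_x t) (lab_y t) V /\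
  match t with
  | inl (c, e) => Z *m V = (sg e * i) *: V
  | inr (inl _) => True
  | inr (inr (b, k)) => T true true *m V = (- sg (b (+) k) * i) *: V
  end.

Lemma typM t m k (V : 'M[K]_(n, m)) (W : 'M_(m, k)) : typ t V -> typ t (V *m W).
Proof.
case=> bV H; split; first exact: blockM.
by case: t {bV} H => [[c e]|[|[b k']]] // H; rewrite mulmxA H scalemxAl.
Qed.

Lemma typ_Z t m (V : 'M[K]_(n, m)) : typ t V -> typ (lab_z t) (Z *m V).
Proof.
case=> bV H; have := block_Z ch0 HM bV; case: t bV H => [[c e]|[[c k]|[b k]]] /= bV H bZ; split.
- by case: c bV H bZ.
- by rewrite {1}H scalemxAr.
- by case: c bV H bZ; case: k.
- by [].
- by [].
- by rewrite (T_Z ch0 HM _ _ bV) /= addbb /sgn !scale1r H scalemxAr.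
Qed.

Lemma typ_S t m (V : 'M[K]_(n, m)) : typ t V -> typ (lab_s t) (T true false *m V).
Proof.
case=> bV H; case: t bV H => [[c e]|[[c k]|[b k]]] /= bV H.
- rewrite (T_block ch0 HM bV) //; split; first exact: block0.
  by rewrite mulmx0 scaler0.
- by rewrite (T_block ch0 HM bV) //; split; first exact: block0.
split; first by have := T_blockC ch0 HM true false bV; rewrite !addbT.
have e1 : T true true *m T true false = - (T true false *m T true true).
  by rewrite !(T_mul ch0 HM) /= /sgn scale1r scaleN1r opprK.
rewrite mulmxA e1 mulNmx -mulmxA H -scalemxAr -scaleNr; congr (_ *: _).
by rewrite addbN; case: (b (+) k); rewrite /sgn /=; ring.
Qed.

(** On x = y = 1 the absence of fixed vectors forces z = -1. [T true false] carries the part x = y =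
    -1 there, and commuting it back past z shows that z coincides with [T true true] on that
    part. *)
Lemma typ_W_Z b k m (V : 'M[K]_(n, m)) : typ (inr (inr (b, k))) V ->
  Z *m V = (if k then sg b * i else -1) *: V.
Proof.
case: k => -[bV H]; last by rewrite scaleN1r coactC_Z.
have bS := T_blockC ch0 HM true false bV.
have SS : T true false *m (T true false *m V) = V.
  by rewrite mulmxA (T_mul ch0 HM) /= /sgn scale1r; case: bV => _ _ _ ->; rewrite scale1r.
have := T_Z ch0 HM false true bS; rewrite /= {1}/sgn SS /sgn scale1r scaleN1r => e.
have -> : Z *m V = T false true *m (T true false *m V).
  by rewrite -[LHS]opprK -e coactC_Z // mulmxN opprK.
have -> : T false true = T true true *m T true false.
  by rewrite (T_mul ch0 HM) /= /sgn scale1r.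
rewrite -mulmxA SS H; congr (_ *: _).
by rewrite addbT; case: b {H bV bS}; rewrite /sgn /=; ring.
Qed.

(** Spectral projectors within a block. The operator squares to -1, so the inverse of an eigenvalue
    is its negative, whence the signs. *)
Definition lab_half (t : lab) : 'M[K]_n :=
  match t with
  | inl (c, e) => 2%:R^-1 *: (1%:M - (sg e * i) *: Z)
  | inr (inl _) => 1%:M
  | inr (inr (b, k)) => 2%:R^-1 *: (1%:M + (sg (b (+) k) * i) *: T true true)
  end.

Definition proj t := lab_half t *m bproj (lab_o t) (lab_x t) (lab_y t).

Lemma typ_proj t : typ t (proj t).
Proof.
have bB := block_bproj (lab_o t) (lab_x t) (lab_y t); rewrite /typ /proj.
move: (bproj _ _ _) bB => B; case: t => [[c e]|[[c k]|[b k]]] /= bB.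
- rewrite -scalemxAl mulmxBl mul1mx -scalemxAl; split.
    apply: blockZ; apply: blockD => //; rewrite -scaleNr; apply: blockZ.
    by have := block_Z ch0 HM bB; case: (c).
  rewrite -scalemxAr mulmxBr -scalemxAr (zz_block ch0 HM bB) /= /sgn scaleN1r scalerN opprK.
  have kk : sg e * i * (sg e * i) = -1 by rewrite mulrACA sgK ii mul1r.
  rewrite [RHS]scalerA [_ * 2%:R^-1]mulrC -[RHS]scalerA; congr (_ *: _).
  by rewrite scalerBr scalerA kk scaleN1r opprK addrC.
- by rewrite mul1mx.
- rewrite -scalemxAl mulmxDl mul1mx -scalemxAl; split.
    apply: blockZ; apply: blockD => //; apply: blockZ.
    by have := T_blockC ch0 HM true true bB; rewrite addbF.
  rewrite -scalemxAr mulmxDr -scalemxAr mulmxA (T_mul ch0 HM) /= /sgn -scalemxAl.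
  case: bB => _ _ _ ->; rewrite scale1r scaleN1r scalerN.
  have kk : - sg (b (+) k) * i * (sg (b (+) k) * i) = 1.
    by rewrite mulrACA mulNr sgK ii mulrNN mulr1.
  rewrite [RHS]scalerA [_ * 2%:R^-1]mulrC -[RHS]scalerA; congr (_ *: _).
  by rewrite scalerDr scalerA kk scale1r mulNr scaleNr addrC.
Qed.

Lemma proj_typ t t' m (V : 'M[K]_(n, m)) : typ t V -> proj t' *m V = (t' == t)%:R *: V.
Proof.
case=> bV H; rewrite /proj -mulmxA (bproj_block _ _ _ bV) -scalemxAr.
have [e|ne] := eqVneq t' t.
  rewrite e !eqxx /= scale1r scale1r; case: t H {e bV} => [[c e]|[[c k]|[b k]]] /= H.
  - rewrite -scalemxAl mulmxBl mul1mx -scalemxAl H scalerA mulrACA sgK ii mul1r.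
    by rewrite scaleN1r opprK half_half.
  - by rewrite mul1mx.
  - rewrite -scalemxAl mulmxDl mul1mx -scalemxAl H scalerA.
    by rewrite mulrACA mulrN sgK ii mulrNN mulr1 scale1r half_half.
case: andP => [[/eqP eo /andP[/eqP ex /eqP ey]]|_]; last by rewrite !scale0r.
rewrite scale1r scale0r; move: ne eo ex ey H {bV}.
case: t => [[c e]|[[c k]|[b k]]]; case: t' => [[c' e']|[[c' k']|[b' k']]] //=; last 1 first.
- move=> ne _ ek _ H; subst k'.
  have eb : b' = ~~ b by case: b b' ne {H} => [] []; rewrite ?eqxx.
  rewrite -scalemxAl mulmxDl mul1mx -scalemxAl H scalerA eb.
  have -> : sg (~~ b (+) k) * i * (- sg (b (+) k) * i) = -1.
    rewrite mulrACA ii addNb; case: (b (+) k); rewrite /sgn /=; ring.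
  by rewrite scaleN1r subrr scaler0.
- move=> ne [_ ec] _ _ H; subst c'.
  have ee : e' = ~~ e by case: e e' ne {H} => [] []; rewrite ?eqxx.
  rewrite -scalemxAl mulmxBl mul1mx -scalemxAl H scalerA ee.
  have -> : sg (~~ e) * i * (sg e * i) = 1.
    by rewrite mulrACA ii -sgnD; case: (e); rewrite /sgn /= mulrNN mulr1.
  by rewrite scale1r subrr scaler0.
- by move=> _ _; case: k'.
- by move=> _ _; case: k.
- by case: c; case: c'; case: k; case: k'.
Qed.

Lemma proj_sum : \sum_t proj t = 1%:M.
Proof.
have halves (k : K) (W B : 'M[K]_n) :
    2%:R^-1 *: (1%:M - k *: W) *m B + 2%:R^-1 *: (1%:M + k *: W) *m B = B.
  rewrite -mulmxDl -scalerDr addrACA addNr addr0 half_half mul1mx //.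
have B0 g s t : (g.1 && s) (+) (g.2 && t) = false -> bproj (Some g) s t = 0.
  by apply: (block_group_eq0 ch0 HM fM); apply: block_bproj.
have C0 s t : s (+) t -> bproj None s t = 0.
  by apply: (blockC_mixed_eq0 ch0 ii HM fM); apply: block_bproj.
rewrite -bproj_sum big_lab big_option.
have -> : \sum_c \sum_e proj (inl (c, e)) = \sum_c bproj (Some (~~ c, c)) true true.
  apply: eq_bigr => c _; rewrite sum_bool /proj /= /sgn mulN1r scaleNr opprK mul1r addrC.
  exact: halves.
have -> : \sum_b \sum_k proj (inr (inr (b, k))) = bproj None true true + bproj None false false.
  rewrite exchange_big sum_bool; congr (_ + _); rewrite sum_bool /proj /= /sgn !mulN1r !mul1r ?scaleNr.
    by rewrite addrC; apply: halves.
  exact: halves.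
rewrite !sum_bool /proj /= !mul1mx.
(* Of the twenty blocks ten of group-like degree and two with xy = -1 vanish; the remaining eight
   carry the twelve labels. *)
rewrite (B0 (true, true) true true erefl) (B0 (true, true) false false erefl) (B0 (true, false) false true erefl) (B0 (true, false) false false erefl) (B0 (false, true) true false erefl) (B0 (false, true) false false erefl) (B0 (false, false) true true erefl) (B0 (false, false) true false erefl) (B0 (false, false) false true erefl) (B0 (false, false) false false erefl)
  (C0 true false isT) (C0 false true isT) !addr0 !add0r.
do 8!move: (bproj _ _ _) => ?.
by apply/matrixP => r s; rewrite !mxE; ring.
Qed.

Definition lab_u (t : lab) : 'M[K]_n :=
  match t with
  | inr (inl (_, true)) => Z | inr (inr (_, true)) => T true false | _ => 1%:M
  end.

Lemma lab_uu t t' m (V : 'M[K]_(n, m)) : lab0 t' = lab0 t -> typ t' V ->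
  lab_u t *m (lab_u t *m V) = V.
Proof.
case: t => [[c e]|[[c []]|[b []]]]; rewrite /= ?mul1mx //.
  case: t' => [[c' e']|[[c' k']|[b' k']]] //= _ [bV _].
  by rewrite (zz_block ch0 HM bV); case: (k'); rewrite /= /sgn scale1r.
case: t' => [[c' e']|[[c' k']|[b' k']]] //= _ [bV _].
by rewrite mulmxA (T_mul ch0 HM) /= /sgn scale1r; case: bV => _ _ _ ->; rewrite scale1r.
Qed.

Definition lab_inv (t : lab) : lab -> lab :=
  match t with
  | inr (inl (_, true)) => lab_z | inr (inr (_, true)) => lab_s | _ => id
  end.

Lemma lab_invK t : involutive (lab_inv t).
Proof. by case: t => [?|[[? []]|[? []]]] [[? ?]|[[? []]|[? []]]]. Qed.

Lemma lab_inv0 t : lab_inv t t = lab0 t.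
Proof. by case: t => [[? ?]|[[? []]|[? []]]]. Qed.

Lemma typ_u t t' m (V : 'M[K]_(n, m)) : typ t' V -> typ (lab_inv t t') (lab_u t *m V).
Proof.
case: t => [[c e]|[[c []]|[b []]]] tV; rewrite /= ?mul1mx //; first exact: typ_Z.
exact: typ_S.
Qed.

Lemma proj_u t t' : proj (lab_inv t t') *m lab_u t = lab_u t *m proj t'.
Proof.
rewrite -[LHS]mulmx1 -proj_sum mulmx_sumr (bigD1 t') //= addrC big1 ?add0r => [|s nst].
  by rewrite -mulmxA (proj_typ _ (typ_u t (typ_proj t'))) eqxx scale1r.
rewrite -mulmxA (proj_typ _ (typ_u t (typ_proj s))).
by rewrite (inj_eq (inv_inj (lab_invK t))) eq_sym (negPf nst) scale0r.
Qed.

Lemma proj_idem t : proj t *m proj t = proj t.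
Proof. by rewrite (proj_typ _ (typ_proj t)) eqxx scale1r. Qed.

(** Rank and basis are taken at the base label and moved by [lab_u]. Labels of one simple module
    thus share their multiplicity by conversion, and vectors with the same index in their families
    belong to the same copy. *)
Definition mult t := \rank (proj (lab0 t)).
Definition fam t : 'M[K]_(n, mult t) := lab_u t *m col_base (proj (lab0 t)).
Definition cofam t : 'M[K]_(mult t, n) := row_base (proj (lab0 t)) *m lab_u t.

Lemma typ_fam t : typ t (fam t).
Proof.
rewrite -[t in typ t](lab_invK t) lab_inv0; apply: typ_u.
by rewrite -(idem_col_base (proj_idem _)); apply: typM; apply: typ_proj.
Qed.

Lemma fam_cofam t : fam t *m cofam t = proj t.
Proof.
rewrite /fam /cofam -mulmxA (mulmxA (col_base _)) mulmx_base -lab_inv0 proj_u.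
exact: (lab_uu _ (typ_proj t)).
Qed.

Lemma cofam_fam t : cofam t *m fam t = 1%:M.
Proof.
rewrite /fam /cofam -mulmxA (lab_uu (t' := lab0 t)); first exact: (idem_base (proj_idem _)).
  by case: t => [[? ?]|[[? ?]|[? ?]]].
by rewrite -(idem_col_base (proj_idem _)); apply: typM; apply: typ_proj.
Qed.

Lemma cofam_typ t t' m (V : 'M[K]_(n, m)) : t != t' -> typ t' V -> cofam t *m V = 0.
Proof.
move=> ne tV; have -> : cofam t = cofam t *m proj t.
  by rewrite -fam_cofam mulmxA cofam_fam mul1mx.
by rewrite -mulmxA (proj_typ _ tV) (negPf ne) scale0r mulmx0.
Qed.

Lemma cofam_fam0 t t' : t != t' -> cofam t *m fam t' = 0.
Proof. by move=> ne; apply: (cofam_typ ne (typ_fam t')). Qed.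

End Projectors.

(* Vectors v, w of types t, t' satisfy c (v (x) w) = (-1)^(lab_q t t') w (x) v,
   unless t is one of the W and t' one of the M<(g_1, g_2)>. *)
Definition lab_q (t t' : lab) : bool :=
  match t with
  | inr (inr (b, k)) =>
      match t' with
      | inl (c, e) => e (+) b (+) k
      | inr (inr (b', k')) => if k' then b (+) b' (+) k else true
      | inr (inl _) => false
      end
  | _ => if lab_o t is Some g then (g.1 && lab_x t') (+) (g.2 && lab_y t') else false
  end.

Definition lab_diag (t t' : lab) : bool :=
  match t, t' with inr (inr _), inr (inl _) => false | _, _ => true end.

Lemma lab_qq t : lab_q t t = true.
Proof. by case: t => [[[] []]|[[[] []]|[[] []]]]. Qed.

(** * Excluding incompatible summands *)

Section Incompatible.
Variables (K : closedFieldType) (ch0 : [pchar K] =i pred0) (i : K) (ii : i * i = -1).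
Variables (M : ydmod K) (HM : is_YD M) (fM : fin_nichols M).
Local Notation n := (ydim M).
Local Notation sg := (sgn K).
Local Notation typ := (@typ K i M).

Lemma typ_braiding t t' (v w : 'cV[K]_n) r s : typ t v -> typ t' w -> lab_diag t t' ->
  \sum_b (yact M b *m w) r 0 * (ycoact M b *m v) s 0 = sg (lab_q t t') * (w r 0 * v s 0).
Proof.
move=> tv tw; have [bw Hw] := tw; have [bv Hv] := tv.
case: t tv bv Hv => [[c e]|[[c k]|[b k]]] tv bv Hv.
- by move=> _; rewrite (coact_block_group ch0 HM _ _ bv bw).
- by move=> _; rewrite (coact_block_group ch0 HM _ _ bv bw); case: (c).
case: t' tw bw Hw => [[c' e']|[[c' k']|[b' k']]] tw bw Hw //= _.
  rewrite (coact_blockC HM _ _ bv bw) Hw Hv !mxE mulrACA; congr (_ * _).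
  rewrite mulrACA ii mulrN1 mulrN opprK -sgnD.
  by rewrite addbA.
rewrite (coact_blockC HM _ _ bv bw) (typ_W_Z ch0 HM fM tw) /=.
case: k' {tw bw Hw}.
  rewrite Hv !mxE mulrACA; congr (_ * _).
  by rewrite mulrACA ii mulrN1 mulrN opprK -sgnD addbA [b' (+) b]addbC.
by case: bv => _ _ _ /= ->; rewrite scale1r mxE /sgn; ring.
Qed.

Local Notation vec := {t : lab & 'I_(mult i M t)}.

Definition vecv (x : vec) : 'cV[K]_n := col (tagged x) (fam i M (tag x)).
Definition covec (x : vec) : 'rV[K]_n := row (tagged x) (cofam i M (tag x)).

Lemma typ_vecv x : typ (tag x) (vecv x).
Proof. by rewrite /vecv colE; apply: typM; exact: (typ_fam ch0 ii HM). Qed.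

Lemma covecv x y : (covec x *m vecv y) 0 0 = (x == y)%:R.
Proof.
have rc m m' (B : 'M[K]_(m, n)) (C : 'M_(n, m')) j k :
    (row j B *m col k C) 0 0 = (B *m C) j k.
  by rewrite !mxE; apply: eq_bigr => l _; rewrite !mxE.
case: x y => [t j] [t' j']; rewrite /covec /vecv /= rc.
have [e|ne] := eqVneq t t'.
  by subst t'; rewrite (cofam_fam ch0 ii HM) mxE -[existT _ t j']/(Tagged (fun t => 'I_(mult i M t)) j') eq_Tagged.
rewrite (cofam_fam0 ch0 ii HM fM ne) mxE.
by case: eqP => // /(congr1 tag) /= e; rewrite e eqxx in ne.
Qed.

Lemma vecv_braiding x y r s : lab_diag (tag x) (tag y) ->
  \sum_p \sum_t cmat r s p t * (vecv x p 0 * vecv y t 0) =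
  sg (lab_q (tag x) (tag y)) * (vecv y r 0 * vecv x s 0).
Proof. by move=> xy; rewrite cmat_vec; apply: typ_braiding => //; apply: typ_vecv. Qed.

Lemma triangle_labels (x : option bool -> vec) : injective x ->
  (forall a b, lab_diag (tag (x a)) (tag (x b))) ->
  (forall a b, a != b -> lab_q (tag (x a)) (tag (x b)) (+) lab_q (tag (x b)) (tag (x a))) ->
  False.
Proof.
move=> xI xd xq.
apply: (@triangle_infinite K ch0 M (vecv \o x) (covec \o x)
  (fun a b => sg (lab_q (tag (x a)) (tag (x b))))) fM => [|a|a b ab].
- split=> [a b|a b r s]; first by rewrite /= covecv (inj_eq xI).
  exact: vecv_braiding.
- by rewrite lab_qq.
- by rewrite -sgnD xq.
Qed.

Lemma square_labels (x : bool * bool -> vec) : injective x ->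
  (forall a b, lab_diag (tag (x a)) (tag (x b))) ->
  (forall a b, a != b -> lab_q (tag (x a)) (tag (x b)) (+) lab_q (tag (x b)) (tag (x a)) =
     a.1 (+) b.1 (+) a.2 (+) b.2) ->
  False.
Proof.
move=> xI xd xq.
apply: (@square_infinite K ch0 M (vecv \o x) (covec \o x)
  (fun a b => sg (lab_q (tag (x a)) (tag (x b))))) fM => [|a|a b ab].
- split=> [a b|a b r s]; first by rewrite /= covecv (inj_eq xI).
  exact: vecv_braiding.
- by rewrite lab_qq.
- by rewrite -sgnD xq.
Qed.

(** In two copies every p_1 is joined to every p_2 and to nothing else: the diagram is a 4-cycle.
    The first coordinate of a numbers the copy and the sum of both is k, so opposite corners have
    equal k. *)
Lemma mult_pair_le1 c : (mult i M (inr (inl (c, false))) <= 1)%N.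
Proof.
rewrite leqNgt; apply/negP => m2; have m1 := ltnW m2.
pose x (a : bool * bool) : vec := Tagged (fun t => 'I_(mult i M t))
  ((if a.1 then Ordinal m2 else Ordinal m1) : 'I_(mult i M (inr (inl (c, a.1 (+) a.2))))).
apply: (@square_labels x).
- move=> [a1 a2] [b1 b2] e.
  have := congr1 (fun y : vec => lab_x (tag y)) e.
  have := congr1 (fun y : vec => nat_of_ord (tagged y)) e.
  by case: a1 a2 b1 b2 {e} => [] [] [] []; case: (c).
- by [].
- by move=> [[] []] [[] []] //= _; case: (c).
Qed.

(** Again the diagram of two copies is the complete bipartite graph on the two values of k, a
    4-cycle. *)
Lemma mult_W_le1 b : (mult i M (inr (inr (b, false))) <= 1)%N.
Proof.
rewrite leqNgt; apply/negP => m2; have m1 := ltnW m2.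
pose x (a : bool * bool) : vec := Tagged (fun t => 'I_(mult i M t))
  ((if a.1 then Ordinal m2 else Ordinal m1) : 'I_(mult i M (inr (inr (b, a.1 (+) a.2))))).
apply: (@square_labels x).
- move=> [a1 a2] [b1 b2] e.
  have := congr1 (fun y : vec => lab_x (tag y)) e.
  have := congr1 (fun y : vec => nat_of_ord (tagged y)) e.
  by case: a1 a2 b1 b2 {e} => [] [] [] []; case: (b).
- by [].
- by move=> [[] []] [[] []] //= _; case: (b).
Qed.

(** When c' differs from c the line is joined to both p_1 and p_2, which are joined to each
    other. *)
Lemma mult_line_pair c c' e : (0 < mult i M (inl (c', e)))%N ->
  (0 < mult i M (inr (inl (c, false))))%N -> c' = c.
Proof.
move=> m1 m2; apply/eqP/negPn/negP => ne.
pose x (a : option bool) : vec := match a with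
  | Some k => Tagged (fun t => 'I_(mult i M t)) (Ordinal m2 : 'I_(mult i M (inr (inl (c, k)))))
  | None => Tagged (fun t => 'I_(mult i M t)) (Ordinal m1) end.
apply: (@triangle_labels x).
- move=> a b ab; have := congr1 (fun y : vec => tag y) ab.
  by case: a b {ab} => [a|] [b|] //= [->].
- by move=> [a|] [b|].
- by move=> [[]|] [[]|] //= _; case: c c' {m1 m2 x} ne => [] [].
Qed.

(** The edge sign between the line and either basis vector of W is [e (+) b], whatever k is, so a
    mismatch closes a triangle. *)
Lemma mult_line_W c e b : (0 < mult i M (inl (c, e)))%N ->
  (0 < mult i M (inr (inr (b, false))))%N -> e = b.
Proof.
move=> m1 m2; apply/eqP/negPn/negP => ne.
pose x (a : option bool) : vec := match a with
  | Some k => Tagged (fun t => 'I_(mult i M t)) (Ordinal m2 : 'I_(mult i M (inr (inr (b, k)))))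
  | None => Tagged (fun t => 'I_(mult i M t)) (Ordinal m1) end.
apply: (@triangle_labels x).
- move=> a b' ab; have := congr1 (fun y : vec => tag y) ab.
  by case: a b' {ab} => [a|] [b'|] //= [->].
- by move=> [a|] [b'|].
- by move=> [[]|] [[]|] //= _; case: c e b {m1 m2 x} ne => [] [] [].
Qed.

End Incompatible.

(** * Direct summands *)

Section Summands.
Variables (K : fieldType) (M : ydmod K).
Local Notation n := (ydim M).

Definition intertwines (N : ydmod K) (F : 'M[K]_(n, ydim N)) :=
  (forall b, yact M b *m F = F *m yact N b) /\
  (forall b, ycoact M b *m F = F *m ycoact N b).

Definition part_iso N F G E :=
  [/\ G *m F = 1%:M, F *m G = E & @intertwines N F].

Definition summand N (E : 'M[K]_n) := exists F G, @part_iso N F G E.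

Lemma summand_sum N1 N2 E1 E2 : summand N1 E1 -> summand N2 E2 ->
  E1 *m E2 = 0 -> E2 *m E1 = 0 -> summand (ydsum N1 N2) (E1 + E2).
Proof.
move=> [F1 [G1 [GF1 FG1 [A1 R1]]]] [F2 [G2 [GF2 FG2 [A2 R2]]]] E12 E21.
exists (row_mx F1 F2), (col_mx G1 G2); split=> [||/=].
- rewrite mul_col_row GF1 GF2.
  have -> : G1 *m F2 = 0.
    (* G1 F2 = G1 (F1 G1) (F2 G2) F2 = G1 E1 E2 F2. *)
    rewrite -[G1]mul1mx -GF1 -[F2]mulmx1 -GF2 !mulmxA -(mulmxA G1) FG1 -[_ *m F2 *m G2]mulmxA FG2.
    by rewrite -(mulmxA G1) E12 mulmx0 mul0mx.
  have -> : G2 *m F1 = 0.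
    rewrite -[G2]mul1mx -GF2 -[F1]mulmx1 -GF1 !mulmxA -(mulmxA G2) FG2 -[_ *m F1 *m G1]mulmxA FG1.
    by rewrite -(mulmxA G2) E21 mulmx0 mul0mx.
  by rewrite -scalar_mx_block.
- by rewrite mul_row_col FG1 FG2.
- split=> b; rewrite /= mul_mx_row mul_row_block !mulmx0 addr0 add0r.
    by rewrite A1 A2.
  by rewrite R1 R2.
Qed.

Lemma summand_yd0 : summand (yd0 K) 0.
Proof.
exists 0, 0; split; rewrite ?mulmx0 //; first by apply/matrixP => -[].
by split=> b; rewrite mulmx0 mul0mx.
Qed.

Lemma summand_iso N : summand N 1%:M -> yd_iso M N.
Proof.
move=> [F [G [GF FG [AF RF]]]]; exists G, F; split=> // b.
  by rewrite -[LHS]mulmx1 -FG mulmxA -(mulmxA G) AF mulmxA GF mul1mx.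
by rewrite -[LHS]mulmx1 -FG mulmxA -(mulmxA G) RF mulmxA GF mul1mx.
Qed.

Lemma summand_pow (bb : K) g m (V : 'M_(n, m)) V' : V' *m V = 1%:M ->
  (forall j, @intertwines (Mbg bb g) (col j V)) -> summand (ydpow (Mbg bb g) m) (V *m V').
Proof.
elim: m V V' => [|m IH] V V' VV HV.
  have -> : V *m V' = 0 by apply/matrixP => r s; rewrite !mxE big_ord0.
  exact: summand_yd0.
move: V V' VV HV; rewrite -[m.+1]/(1 + m)%N => V V' VV HV.
move: (VV); rewrite -{1}(hsubmxK V) -{1}(vsubmxK V') mul_col_row scalar_mx_block.
case/eq_block_mx => ul ur dl dr.
rewrite -(hsubmxK V) -(vsubmxK V') mul_row_col; apply: summand_sum.
- exists (lsubmx V), (usubmx V'); split=> //.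
  have -> : lsubmx V = col (lshift m 0) V.
    by apply/matrixP => r s; rewrite !mxE [s]ord1.
  exact: HV.
- apply: IH => // j; have -> : col j (rsubmx V) = col (rshift 1 j) V.
    by apply/matrixP => r s; rewrite !mxE.
  exact: HV.
- by rewrite mulmxA -(mulmxA (lsubmx V)) ur mulmx0 mul0mx.
- by rewrite mulmxA -(mulmxA (rsubmx V)) dl mulmx0 mul0mx.
Qed.

Lemma part_iso_cmat N F (E : 'M_n) G r s p q : @part_iso N F G E ->
  \sum_k \sum_l cmat (M := M) r s k l * (F k p * F l q) =
  \sum_k \sum_l F r k * F s l * cmat (M := N) k l p q.
Proof.
case=> _ _ [AF RF].
have := cmat_vec (col p F) (col q F) r s.
under eq_bigr do under eq_bigr do rewrite !mxE.
move=> ->; rewrite /cmat.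
transitivity (\sum_b (\sum_k F r k * yact N b k q) * (\sum_l F s l * ycoact N b l p)).
  apply: eq_bigr => b _; have := congr1 (fun B : 'M_(_, _) => B r q) (AF b).
  have := congr1 (fun B : 'M_(_, _) => B s p) (RF b); rewrite !mxE => e2 e1.
  rewrite -e1 -e2; congr (_ * _); apply: eq_bigr => k _; by rewrite mxE.
under eq_bigr do rewrite big_distrl.
rewrite exchange_big; apply: eq_bigr => k _.
under eq_bigr do rewrite big_distrr.
rewrite exchange_big; apply: eq_bigr => l _.
by rewrite big_distrr; apply: eq_bigr => b _ /=; ring.
Qed.

Lemma summand_fin N E : summand N E -> fin_nichols M -> fin_nichols N.
Proof.
move=> [F [G FE]]; have [GF _ _] := FE.
by apply: (fin_nichols_sub GF) => r s p q; apply: part_iso_cmat FE.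
Qed.

Lemma cartan_summand N theta (V : 'M_(n, theta)) V' (qm : 'M_theta) (A : 'M_theta) :
  summand N 1%:M -> V' *m V = 1%:M -> V *m V' = 1%:M ->
  (forall i j r s, \sum_b (yact M b *m col j V) r 0 * (ycoact M b *m col i V) s 0 =
     qm i j * (V r j * V s i)) ->
  (forall i, qm i i != 1) ->
  (forall i j, i != j -> qm i j * qm j i = qm i i ^ A i j) ->
  cartan_type N A.
Proof.
move=> [F [G [GF FG [AF RF]]]] VV VV' Vq q1 qA.
exists (G *m V), (V' *m F), qm; split=> //.
- by rewrite mulmxA -(mulmxA V') FG mulmx1.
- by rewrite mulmxA -(mulmxA G) VV' mulmx1.
move=> i j r s.
have := cmat_vec (col i (G *m V)) (col j (G *m V)) r s.
under eq_bigr do under eq_bigr do rewrite [col i _ _ _]mxE [col j _ _ _]mxE mulrA.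
move=> ->.
have AG b (v : 'cV_n) : yact N b *m (G *m v) = G *m (yact M b *m v).
  by rewrite -[yact N b]mul1mx -GF -(mulmxA G) -AF -!mulmxA (mulmxA F) FG mul1mx.
have RG b (v : 'cV_n) : ycoact N b *m (G *m v) = G *m (ycoact M b *m v).
  by rewrite -[ycoact N b]mul1mx -GF -(mulmxA G) -RF -!mulmxA (mulmxA F) FG mul1mx.
have cm k : col k (G *m V) = G *m col k V by rewrite !colE mulmxA.
rewrite !cm.
under eq_bigr do rewrite AG RG !mxE.
transitivity (\sum_k \sum_l G r k * G s l * (qm i j * (V k j * V l i))).
  under [RHS]eq_bigr do under eq_bigr do rewrite -Vq big_distrr.
  under [RHS]eq_bigr do rewrite exchange_big.
  rewrite [RHS]exchange_big; apply: eq_bigr => b _.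
  rewrite big_distrl; apply: eq_bigr => k _; rewrite big_distrr; apply: eq_bigr => l _ /=; ring.
rewrite !mxE big_distrl big_distrr; apply: eq_bigr => k _ /=.
rewrite big_distrr big_distrr; apply: eq_bigr => l _ /=; ring.
Qed.

Hypothesis HM : is_YD M.

Lemma act_gen_intertwines m (F : 'M_(n, m)) X Y Z :
  yact M (true, false, false) *m F = F *m X ->
  yact M (false, true, false) *m F = F *m Y ->
  yact M (false, false, true) *m F = F *m Z ->
  forall b, yact M b *m F = F *m act_gen X Y Z b.
Proof.
move=> HX HY HZ [[a b] c]; rewrite (act_genE HM) /act_gen !mulmxA.
have e (B : bool) (P : 'M_n) Q : P *m F = F *m Q ->
  (if B then P else 1%:M) *m F = F *m (if B then Q else 1%:M).
  by case: B => //; rewrite mul1mx mulmx1.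
by rewrite -mulmxA (e _ _ _ HZ) mulmxA -(mulmxA _ _ F) (e _ _ _ HY) !mulmxA (e _ _ _ HX).
Qed.

End Summands.

(** * Explicit matrices of the simple modules *)

Section SimpleData.
Variable K : fieldType.

Lemma mul_row_mx2 n (v0 v1 : 'cV[K]_n) a b c d :
  row_mx v0 v1 *m mx2 a b c d = row_mx (a *: v0 + c *: v1) (b *: v0 + d *: v1).
Proof.
have e : mx2 a b c d = block_mx a%:M b%:M c%:M d%:M :> 'M_(1 + 1).
  apply/matrixP => r s; rewrite -[r]splitK -[s]splitK.
  by case: (split r) => r'; case: (split s) => s'; rewrite [r']ord1 [s']ord1 /=
    ?(block_mxEul, block_mxEur, block_mxEdl, block_mxEdr) !mxE /= ?mulr1n.
transitivity (row_mx v0 v1 *m block_mx a%:M b%:M c%:M d%:M); first by rewrite -e.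
by rewrite mul_row_block !mul_mx_scalar.
Qed.

Lemma hmul_z (f : hel K) a b c : (forall a b, f (a, b, true) = 0) ->
  hmul f (hz K) (a, b, c) = if c then f (a, b, false) else 0.
Proof.
move=> f0; have -> : hmul f (hz K) (a, b, c) = \sum_p f p * hmul_b K p (false, false, true) (a, b, c).
  apply: eq_bigr => p _; rewrite (bigD1 (false, false, true)) //= big1 ?addr0 => [|p' /negPf np].
    by rewrite /hz /hbas eqxx mulr1.
  by rewrite /hz /hbas np mulr0 mul0r.
rewrite big_hb !sum_bool !f0.
by case: a; case: b; case: c; rewrite /= ?mulr1 ?mulr0 ?mul0r ?addr0 ?add0r.
Qed.

Lemma fjkE j k a b c : fjk K j k (a, b, c) =
  if c then 0 else sgn K ((j && a) (+) (k && b)) / 4%:R.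
Proof.
rewrite /fjk /hmul big_hb.
under eq_bigr do under eq_bigr do under eq_bigr do rewrite big_hb !sum_bool.
rewrite !sum_bool /hone /hx /hy /hbas /=.
by case: a; case: b; case: c; case: j; case: k; rewrite /sgn /=; ring.
Qed.

End SimpleData.

Lemma col_mulmx (K : fieldType) m n p (A : 'M[K]_(m, n)) (B : 'M_(n, p)) j :
  col j (A *m B) = A *m col j B.
Proof. by rewrite !colE mulmxA. Qed.

Lemma eq_row_mx2 (K : fieldType) n (v v' w w' : 'cV[K]_n) :
  v = v' -> w = w' -> row_mx v w = row_mx v' w'.
Proof. by move=> -> ->. Qed.

Lemma col_row_mul1 (K : fieldType) n m (A : 'M[K]_(n, m)) (B : 'M_(m, n)) j :
  m = 1%N -> col j A *m row j B = A *m B.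
Proof.
move=> m1; subst m; apply/matrixP => r s; rewrite !mxE !big_ord1 !mxE.
by rewrite [j]ord1.
Qed.

(** * Realizing the simple modules inside M *)

Section Pieces.
Variables (K : closedFieldType) (ch0 : [pchar K] =i pred0) (i : K) (ii : i * i = -1).
Variables (M : ydmod K) (HM : is_YD M) (fM : fin_nichols M).
Local Notation n := (ydim M).
Local Notation sg := (sgn K).
Local Notation typ := (@typ K i M).
Local Notation mult := (mult i M).
Local Notation proj := (proj i M).
Local Notation vec := {t : lab & 'I_(mult t)}.
Definition mk t (j : 'I_(mult t)) : vec := existT _ t j.
Local Notation vecv := (@vecv K i M).
Local Notation covec := (@covec K i M).
Local Notation Z := (yact M (false, false, true)).
Local Notation S := (T M true false).

Lemma coact_block (g : bool * bool) s t m (V : 'M[K]_(n, m)) q : block (Some g) s t V ->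
  ycoact M q *m V = (q == (g, false))%:R *: V.
Proof.
case: q => [[a b] []] bV; last first.
  case: bV => _ _ -> _; congr (_%:R *: _); rewrite eq_sym.
  by case: g => g1 g2; case: a b g1 g2 => [] [] [] [].
rewrite (coact_T ch0) !sum_bool -scalemxAl !mulmxDl -!scalemxAl !(T_block ch0 HM bV) //.
by rewrite !scaler0 !addr0 scaler0 xpair_eqE andbF scale0r.
Qed.

Lemma coactC_block s t m (V : 'M[K]_(n, m)) a b : block None s t V ->
  ycoact M (a, b, false) *m V = 0.
Proof. by case=> _ _ -> _; rewrite scale0r. Qed.

Definition line_module c e := Mbg (if e then - i else i) (if c then gy else gx).
Definition pair_module c := Mpair K (if c then gy else gxy) (if c then gxy else gx).

Lemma line_intertwines c e (v : 'cV[K]_n) : typ (inl (c, e)) v ->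
  @intertwines _ M (line_module c e) v.
Proof.
case=> bv Hv; have z2 : (if e then - i else i) ^+ 2 = -1 by rewrite expr2; case: e {Hv bv}; rewrite ?mulrNN.
split=> [|q]; last first.
  rewrite (coact_block _ bv) /= mul_mx_scalar; congr (_%:R *: _).
  by case: c {bv Hv}; case: q => [[[] []] []].
have [HX HY _ _] := bv.
apply: (act_gen_intertwines HM); rewrite mul_mx_scalar ?z2.
- by rewrite HX.
- by rewrite HY.
- by rewrite Hv; case: (e); rewrite /sgn ?mulN1r ?mul1r.
Qed.

Lemma pair_intertwines c (v : 'cV[K]_n) : typ (inr (inl (c, false))) v ->
  @intertwines _ M (pair_module c) (row_mx v (Z *m v)).
Proof.
move=> tv; have [bv _] := tv; have [bw _] := typ_Z ch0 HM tv.
have [HX HY _ _] := bv; have [HX' HY' _ _] := bw.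
split=> [|q].
  apply: (@act_gen_intertwines _ _ HM (1 + 1)%N);
    apply: etrans (esym (mul_row_mx2 _ _ _ _ _ _)); rewrite mul_mx_row ?HX ?HY ?HX' ?HY'.
  - by rewrite !scale0r addr0 add0r.
  - by rewrite !scale0r addr0 add0r.
  - by rewrite (zz_block ch0 HM bv) /= !scale0r !scale1r addr0 add0r.
apply: etrans (esym (mul_row_mx2 _ _ _ _ _ _)); rewrite (@mul_mx_row _ _ _ 1 1).
rewrite (coact_block _ bv) (coact_block _ bw) !scale0r addr0 add0r.
by case: c {tv bv bw HX HY HX' HY'}; case: q => [[[] []] []].
Qed.

(** The vector p_2 is recovered as S p_1. The [f_jk] are the character idempotents of the group
    part, so the coaction matrices of W are inverse Fourier transforms of the T acting on v and S
    v. *)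
Lemma W_intertwines b (v : 'cV[K]_n) : typ (inr (inr (b, false))) v ->
  @intertwines _ M (W i (sg b) (-1)) (row_mx v (S *m v)).
Proof.
move=> tv; have [bv Nv] := tv; have tw := typ_S ch0 HM tv; have [bw Nw] := tw.
have [HX HY _ T0v] := bv; have [HX' HY' _ T0w] := bw.
split=> [|q].
  apply: (@act_gen_intertwines _ _ HM (1 + 1)%N);
    apply: etrans (esym (mul_row_mx2 _ _ _ _ _ _)); rewrite mul_mx_row ?HX ?HY ?HX' ?HY'.
  - by rewrite !scale0r addr0 add0r.
  - by rewrite !scale0r addr0 add0r.
  - rewrite (typ_W_Z ch0 HM fM tv) (typ_W_Z ch0 HM fM tw) /= !scale0r addr0 add0r.
    by apply: eq_row_mx2 => //; congr (_ *: _); rewrite mulrN1 mulNr opprK mulrC.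
apply: etrans (esym (mul_row_mx2 _ _ _ _ _ _)); rewrite (@mul_mx_row _ _ _ 1 1).
case: q => [[a b'] [|]]; last first.
  rewrite !(coactC_block _ _ bv) !(coactC_block _ _ bw) !hmul_z ?scale0r ?addr0 // => x y;
  by rewrite !fjkE mulr0 addr0.
have Sv : S *m (S *m v) = v.
  by rewrite mulmxA (T_mul ch0 HM) /= /sgn scale1r T0v scale1r.
have Dv : T M false true *m v = (sg b * i) *: (S *m v).
  have := T_mul ch0 HM true true true false; rewrite /= /sgn scale1r => <-.
  rewrite -mulmxA Nw /=; congr (_ *: _).
  by case: (b); rewrite /sgn /=; ring.
have Dw : T M false true *m (S *m v) = (- (sg b * i)) *: v.
  have := T_mul ch0 HM true true true false; rewrite /= /sgn scale1r => <-.
  by rewrite -mulmxA Sv Nv /= addbF mulNr.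
rewrite !hmul_z; try by move=> x y; rewrite !fjkE mulr0 addr0.
rewrite !fjkE (coact_T ch0) !sum_bool -!scalemxAl !mulmxDl -!scalemxAl.
rewrite /= in Nv Nw T0v T0w.
rewrite Nv Nw T0v T0w Sv Dv Dw.
apply: eq_row_mx2; apply/matrixP => r s; rewrite !mxE.
  by case: a; case: b'; case: (b); rewrite /sgn /=; ring.
by case: a; case: b'; case: (b); rewrite /sgn /=; ring.
Qed.

Definition vproj (x : vec) : 'M[K]_n := vecv x *m covec x.

Lemma covecv0 x y : x != y -> covec x *m vecv y = 0.
Proof.
by move=> ne; apply/matrixP => r s; rewrite [r]ord1 [s]ord1 (covecv ch0 ii HM fM) (negPf ne) mxE.
Qed.

Lemma covecv1 x : covec x *m vecv x = 1%:M.
Proof.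
by apply/matrixP => r s; rewrite [r]ord1 [s]ord1 (covecv ch0 ii HM fM) eqxx mxE.
Qed.

Lemma vproj_orth x y : x != y -> vproj x *m vproj y = 0.
Proof. by move=> ne; rewrite /vproj mulmxA -(mulmxA (vecv x)) covecv0 // mulmx0 mul0mx. Qed.

Lemma two_inverse x y : x != y ->
  col_mx (covec x) (covec y) *m row_mx (vecv x) (vecv y) = 1%:M.
Proof.
move=> ne; have ne' : y != x by rewrite eq_sym.
by rewrite mul_col_row !covecv1 (covecv0 ne) (covecv0 ne') -scalar_mx_block.
Qed.

Lemma vproj_mult1 t (j : 'I_(mult t)) : mult t = 1%N ->
  vproj (mk j) = proj t.
Proof.
by move=> m1; rewrite -(fam_cofam ch0 ii HM fM); apply: col_row_mul1.
Qed.

Lemma summand_line c e : summand (ydpow (line_module c e) (mult (inl (c, e)))) (proj (inl (c, e))).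
Proof.
rewrite -(fam_cofam ch0 ii HM fM); apply: summand_pow; first exact: (cofam_fam ch0 ii HM).
by move=> j; apply: line_intertwines; rewrite colE; apply: typM; apply: (typ_fam ch0 ii HM).
Qed.

Lemma summand_pair c (j : 'I_(mult (inr (inl (c, false))))) :
  summand (pair_module c) (vproj (mk j) + vproj (@mk (inr (inl (c, true))) j)).
Proof.
set x := mk j; set y := mk _.
have ne : x != y by apply/eqP => e; have : false = true := congr1 (fun z : vec => lab_x (tag z)) e.
have vy : vecv y = Z *m vecv x by rewrite /vecv /fam /= mul1mx col_mulmx.
exists (row_mx (vecv x) (vecv y)), (col_mx (covec x) (covec y)); split.
- exact: two_inverse.
- by have := mul_row_col (vecv x) (vecv y) (covec x) (covec y).
- by rewrite vy; apply: pair_intertwines; apply: (typ_vecv ch0 ii HM).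
Qed.

Lemma summand_W b (j : 'I_(mult (inr (inr (b, false))))) :
  summand (W i (sg b) (-1)) (vproj (mk j) + vproj (@mk (inr (inr (b, true))) j)).
Proof.
set x := mk j; set y := mk _.
have ne : x != y by apply/eqP => e; have : false = true := congr1 (fun z : vec => lab_x (tag z)) e.
have vy : vecv y = S *m vecv x by rewrite /vecv /fam /= mul1mx col_mulmx.
exists (row_mx (vecv x) (vecv y)), (col_mx (covec x) (covec y)); split.
- exact: two_inverse.
- by have := mul_row_col (vecv x) (vecv y) (covec x) (covec y).
- by rewrite vy; apply: W_intertwines; apply: (typ_vecv ch0 ii HM).
Qed.

End Pieces.

(** * Assembling the decomposition *)

Section Assembly.
Variables (K : closedFieldType) (ch0 : [pchar K] =i pred0) (i : K) (ii : i * i = -1).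
Variables (M : ydmod K) (HM : is_YD M) (fM : fin_nichols M).
Local Notation n := (ydim M).
Local Notation sg := (sgn K).
Local Notation typ := (@typ K i M).
Local Notation mult := (mult i M).
Local Notation proj := (proj i M).
Local Notation PP c k := (inr (inl (c, k)) : lab).
Local Notation WW b k := (inr (inr (b, k)) : lab).

Lemma proj_mult0 t : mult t = 0%N -> proj t = 0.
Proof.
move=> m0; rewrite -(fam_cofam ch0 ii HM fM); move: (fam _ _ _) (cofam _ _ _); rewrite m0 => A B.
by apply/matrixP => r s; rewrite !mxE big_ord0.
Qed.

Lemma proj_orth t t' : t != t' -> proj t *m proj t' = 0.
Proof. by move=> ne; rewrite (proj_typ ch0 ii _ (typ_proj ch0 ii HM t')) // (negPf ne) scale0r. Qed.

Definition pair_proj c := proj (PP c false) + proj (PP c true).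
Definition W_proj b := proj (WW b false) + proj (WW b true).

Lemma pair_proj0 c : mult (PP c false) = 0%N -> pair_proj c = 0.
Proof. by move=> m0; rewrite /pair_proj !proj_mult0 // addr0. Qed.

Lemma W_proj0 b : mult (WW b false) = 0%N -> W_proj b = 0.
Proof. by move=> m0; rewrite /W_proj !proj_mult0 // addr0. Qed.

Lemma proj_total :
  proj (inl (false, false)) + proj (inl (false, true)) + proj (inl (true, false))
  + proj (inl (true, true)) + pair_proj false + pair_proj true + W_proj false + W_proj true = 1%:M.
Proof.
rewrite -(proj_sum ch0 ii HM fM) big_lab !sum_bool /pair_proj /W_proj.
do 12!move: (proj _) => ?; by apply/matrixP => r s; rewrite !mxE; ring.
Qed.

Lemma summand_pair1 c : mult (PP c false) = 1%N -> summand (pair_module K c) (pair_proj c).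
Proof.
move=> m1; have j : 'I_(mult (PP c false)) by rewrite m1; exact: ord0.
by have := summand_pair ch0 ii HM fM j; rewrite !vproj_mult1.
Qed.

Lemma summand_W1 b : mult (WW b false) = 1%N -> summand (W i (sg b) (-1)) (W_proj b).
Proof.
move=> m1; have j : 'I_(mult (WW b false)) by rewrite m1; exact: ord0.
by have := summand_W ch0 ii HM fM j; rewrite !vproj_mult1.
Qed.

Lemma fin_pair_W c b : (0 < mult (PP c false))%N -> (0 < mult (WW b false))%N ->
  fin_nichols (ydsum (pair_module K c) (W i (sg b) (-1))).
Proof.
move=> m1 m2; have sP := summand_pair ch0 ii HM fM (Ordinal m1).
have sW := summand_W ch0 ii HM fM (Ordinal m2).
have ne t t' (j : 'I_(mult t)) (j' : 'I_(mult t')) : t != t' ->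
    vproj (mk j) *m vproj (mk j') = 0 :> 'M_n.
  by move=> ne; apply: (vproj_orth ch0 ii HM fM); apply: contra ne => /eqP/(congr1 tag)/= ->.
apply: (summand_fin (summand_sum sP sW _ _) fM).
  by rewrite mulmxDl !mulmxDr !ne // !addr0.
by rewrite mulmxDl !mulmxDr !ne // !addr0.
Qed.

(** A basis of the image of E with a label for each vector. Labels are indexed by [nat], so direct
    sums merely shift them and the Cartan matrix can be read off without casts. *)
Definition tbasis theta (l : nat -> lab) (E : 'M[K]_n) :=
  exists (V : 'M_(n, theta)) (V' : 'M_(theta, n)),
  [/\ V' *m V = 1%:M, V *m V' = E & forall j : 'I_theta, typ (l j) (col j V)].

Lemma tbasis_fam t : tbasis (mult t) (fun=> t) (proj t).
Proof.
exists (fam i M t), (cofam i M t); split; first exact: (cofam_fam ch0 ii HM).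
  exact: (fam_cofam ch0 ii HM fM).
by move=> j; rewrite colE; apply: typM; apply: (typ_fam ch0 ii HM).
Qed.

Lemma tbasis_sum t1 t2 l1 l2 E1 E2 : tbasis t1 l1 E1 -> tbasis t2 l2 E2 ->
  E1 *m E2 = 0 -> E2 *m E1 = 0 ->
  tbasis (t1 + t2) (fun k => if (k < t1)%N then l1 k else l2 (k - t1)%N) (E1 + E2).
Proof.
move=> [V1 [V1' [VV1 E1E tV1]]] [V2 [V2' [VV2 E2E tV2]]] E12 E21.
exists (row_mx V1 V2), (col_mx V1' V2'); split.
- rewrite mul_col_row VV1 VV2.
  have -> : V1' *m V2 = 0.
    by rewrite -[V1']mul1mx -VV1 -[V2]mulmx1 -VV2 !mulmxA -(mulmxA V1') E1E
      -[_ *m V2 *m V2']mulmxA E2E -(mulmxA V1') E12 mulmx0 mul0mx.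
  have -> : V2' *m V1 = 0.
    by rewrite -[V2']mul1mx -VV2 -[V1]mulmx1 -VV1 !mulmxA -(mulmxA V2') E2E
      -[_ *m V1 *m V1']mulmxA E1E -(mulmxA V2') E21 mulmx0 mul0mx.
  by rewrite -scalar_mx_block.
- by rewrite mul_row_col E1E E2E.
move=> j; rewrite -(splitK j); case: (split j) => k /=.
  by rewrite ltn_ord colKl; apply: tV1.
by rewrite ltnNge leq_addr /= addKn colKr; apply: tV2.
Qed.

Lemma tbasis_pair c : mult (PP c false) = 1%N ->
  tbasis 2 (fun k => if (k < 1)%N then PP c false else PP c true) (pair_proj c).
Proof.
move=> m1; have := tbasis_fam (PP c true); have := tbasis_fam (PP c false).
rewrite -[mult (PP c true)]/(mult (PP c false)) m1 => t0 t1.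
by apply: (tbasis_sum t0 t1); apply: proj_orth; case: (c).
Qed.

Lemma tbasis_W b : mult (WW b false) = 1%N ->
  tbasis 2 (fun k => if (k < 1)%N then WW b false else WW b true) (W_proj b).
Proof.
move=> m1; have := tbasis_fam (WW b true); have := tbasis_fam (WW b false).
rewrite -[mult (WW b true)]/(mult (WW b false)) m1 => t0 t1.
by apply: (tbasis_sum t0 t1); apply: proj_orth; case: (b).
Qed.

(** All q_jj are -1, so q_jk q_kj = -1 is the exponent -1 and q_jk q_kj = 1 the exponent 0. *)
Lemma cartan_tbasis N theta l (A : 'M[int]_theta) : summand N (1%:M : 'M_n) ->
  tbasis theta l 1%:M -> (forall j k : 'I_theta, lab_diag (l j) (l k)) ->
  (forall j k : 'I_theta, j != k ->
     A j k = if lab_q (l j) (l k) (+) lab_q (l k) (l j) then -1 else 0) ->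
  cartan_type N A.
Proof.
move=> sN [V [V' [VV VV' tV]]] ld lA.
apply: (cartan_summand (qm := \matrix_(j, k) sg (lab_q (l j) (l k))) sN VV VV').
- move=> j k r s; rewrite (typ_braiding ch0 ii HM fM _ _ (tV j) (tV k)) //.
  by rewrite !mxE.
- move=> j; rewrite mxE lab_qq /sgn eq_sym -subr_eq0 opprK.
  exact: (charf0_natr_neq0 ch0 1).
move=> j k jk; rewrite !mxE -sgnD lab_qq lA //.
by case: ifP => _; rewrite /sgn ?exprN1 ?invrN1 ?expr0z.
Qed.

End Assembly.

Definition is_line (t : lab) := if t is inl _ then true else false.

Lemma line_diag t t' : is_line t -> is_line t' ->
  lab_diag t t' /\ lab_q t t' (+) lab_q t' t = false.
Proof. by case: t => [[[] []]|//]; case: t' => [[[] []]|//]. Qed.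

Lemma cartanA2A1s_lab m (l : nat -> lab) :
  (forall k, is_line (l k.+2)) ->
  (forall k, ~~ (lab_q (l 0%N) (l k.+2) (+) lab_q (l k.+2) (l 0%N))
     && ~~ (lab_q (l 1%N) (l k.+2) (+) lab_q (l k.+2) (l 1%N))) ->
  lab_diag (l 0%N) (l 1%N) -> lab_diag (l 1%N) (l 0%N) ->
  lab_q (l 0%N) (l 1%N) (+) lab_q (l 1%N) (l 0%N) ->
  (forall j k : 'I_m.+2, lab_diag (l j) (l k)) /\
  (forall j k : 'I_m.+2, j != k ->
     cartanA2A1s m j k = if lab_q (l j) (l k) (+) lab_q (l k) (l j) then -1 else 0).
Proof.
move=> ll lo d01 d10 q01.
have dl1 k t : lab_diag t (l k.+2).
  by move: (ll k); case: (l k.+2) => // -[? ?] _; case: t => [?|[?|[? ?]]].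
have dl2 k t : lab_diag (l k.+2) t by move: (ll k); case: (l k.+2) => // -[? ?].
have d00 t : lab_diag t t by case: t => [?|[?|[? ?]]].
split=> [[j jm] [k km]|[j jm] [k km]] /=.
  by case: j k {jm km} => [|[|j]] [|[|k]]; rewrite ?d00 ?d01 ?d10 ?dl1 ?dl2.
rewrite mxE -val_eqE /= => /negPf ne; rewrite ne.
case: j k {jm km} ne => [|[|j]] [|[|k]] //= _; rewrite ?addn0 ?add0n ?addnS //=.
- by rewrite q01.
- by case/andP: (lo k) => /negPf->.
- by rewrite addbC q01.
- by case/andP: (lo k) => _ /negPf->.
- by rewrite addbC; case/andP: (lo j) => /negPf->.
- by rewrite addbC; case/andP: (lo j) => _ /negPf->.
- by case: (line_diag (ll j) (ll k)) => _ ->.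
Qed.

(** * The classification *)

Lemma cartanA1s_lab m (l : nat -> lab) : (forall k, is_line (l k)) ->
  (forall j k : 'I_m, lab_diag (l j) (l k)) /\
  (forall j k : 'I_m, j != k ->
     cartanA1s m j k = if lab_q (l j) (l k) (+) lab_q (l k) (l j) then -1 else 0).
Proof.
move=> ll; split=> j k; have [d q] := line_diag (ll j) (ll k) => //.
by move=> /negPf ne; rewrite mxE ne q.
Qed.

Lemma cartanA2A2_lab (l : nat -> lab) :
  (forall j k : 'I_4, j != k ->
     lab_q (l j) (l k) (+) lab_q (l k) (l j) = (j./2 == k./2)%N) ->
  forall j k : 'I_4, j != k ->
     cartanA2A2 j k = if lab_q (l j) (l k) (+) lab_q (l k) (l j) then -1 else 0.
Proof. by move=> lq j k jk; rewrite mxE (negPf jk) lq. Qed.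

Section Cases.
Variables (K : closedFieldType) (ch0 : [pchar K] =i pred0) (i : K) (ii : i * i = -1).
Variables (M : ydmod K) (HM : is_YD M) (fM : fin_nichols M).
Local Notation proj := (proj i M).
Local Notation mult := (mult i M).

Lemma A2A1s_case (L1 L2 N : ydmod K) (p0 p1 t1 t2 : lab) :
  summand L1 (proj t1) -> summand L2 (proj t2) -> summand N (proj p0 + proj p1) ->
  tbasis i 2 (fun k => if (k < 1)%N then p0 else p1) (proj p0 + proj p1) ->
  is_line t1 -> is_line t2 -> t1 != t2 -> ~~ is_line p0 -> ~~ is_line p1 ->
  lab_diag p0 p1 -> lab_diag p1 p0 -> lab_q p0 p1 (+) lab_q p1 p0 ->
  all (fun t => ~~ (lab_q p0 t (+) lab_q t p0) && ~~ (lab_q p1 t (+) lab_q t p1)) [:: t1; t2] ->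
  proj t1 + (proj t2 + (proj p0 + proj p1)) = 1%:M ->
  yd_iso M (ydsum L1 (ydsum L2 N)) /\
  cartan_type (ydsum L1 (ydsum L2 N)) (cartanA2A1s (mult t1 + mult t2)).
Proof.
move=> s1 s2 sN tN l1 l2 t12 l0p l1p d01 d10 q01 qt tot.
have ne t p : is_line t -> ~~ is_line p -> (t != p) * (p != t).
  by move=> tl pl; split; apply/eqP => e; move: tl pl; rewrite e => ->.
have orth t t' := @proj_orth K ch0 i ii M HM t t'.
have t21 : t2 != t1 by rewrite eq_sym.
have O := (ne _ _ l1 l0p, ne _ _ l2 l0p, ne _ _ l1 l1p, ne _ _ l2 l1p, t12, t21).
have sO : summand (ydsum L1 (ydsum L2 N)) (1%:M : 'M_(ydim M)).
  by rewrite -tot; apply: (summand_sum s1 (summand_sum s2 sN _ _));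
    rewrite ?mulmxDl ?mulmxDr ?mulmxDl ?mulmxDr !orth ?O // !addr0.
split; first exact: summand_iso.
(* The module lists its lines first, whereas the Cartan matrix has the A_2 block at indices 0 and 1;
   the basis therefore starts with p0 and p1. *)
have e : (proj p0 + proj p1) + (proj t1 + proj t2) = 1%:M by rewrite -tot [RHS]addrA [RHS]addrC.
have [o1 o2] : (proj p0 + proj p1) *m (proj t1 + proj t2) = 0 /\
   (proj t1 + proj t2) *m (proj p0 + proj p1) = 0.
  by rewrite !mulmxDl !mulmxDr !orth ?O // !addr0.
have tO := tbasis_sum tN (tbasis_sum (tbasis_fam ch0 ii HM fM t1) (tbasis_fam ch0 ii HM fM t2)
  (orth _ _ t12) (orth _ _ t21)) o1 o2.
rewrite e in tO.
set l := (fun k : nat => _) in tO.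
have [ld lA] : (forall j k : 'I_(mult t1 + mult t2).+2, lab_diag (l j) (l k)) /\
  (forall j k : 'I_(mult t1 + mult t2).+2, j != k -> cartanA2A1s (mult t1 + mult t2) j k =
     if lab_q (l j) (l k) (+) lab_q (l k) (l j) then -1 else 0).
  move: qt => /and3P[qt1 qt2 _].
  apply: cartanA2A1s_lab => // k; rewrite /l /= subn2 /=; case: ifP => _ //.
exact: (cartan_tbasis ch0 ii HM fM sO tO ld lA).
Qed.

Lemma A2A2_case (N N' : ydmod K) (p0 p1 r0 r1 : lab) :
  summand N (proj p0 + proj p1) -> summand N' (proj r0 + proj r1) ->
  tbasis i 2 (fun k => if (k < 1)%N then p0 else p1) (proj p0 + proj p1) ->
  tbasis i 2 (fun k => if (k < 1)%N then r0 else r1) (proj r0 + proj r1) ->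
  uniq [:: p0; p1; r0; r1] ->
  allrel lab_diag [:: p0; p1; r0; r1] [:: p0; p1; r0; r1] ->
  lab_q p0 p1 (+) lab_q p1 p0 -> lab_q r0 r1 (+) lab_q r1 r0 ->
  allrel (fun p r => ~~ (lab_q p r (+) lab_q r p)) [:: p0; p1] [:: r0; r1] ->
  (proj p0 + proj p1) + (proj r0 + proj r1) = 1%:M ->
  yd_iso M (ydsum N N') /\ cartan_type (ydsum N N') cartanA2A2.
Proof.
move=> sN sN' tN tN' U d qp qr q tot.
have orth t t' := @proj_orth K ch0 i ii M HM t t'.
have [o1 o2] : (proj p0 + proj p1) *m (proj r0 + proj r1) = 0 /\
   (proj r0 + proj r1) *m (proj p0 + proj p1) = 0.
  move: U; rewrite /= !inE !negb_or => /and4P[/and3P[_ n1 n2] /andP[n3 n4] _ _].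
  by rewrite !mulmxDl !mulmxDr !orth ?addr0 // eq_sym.
have sO : summand (ydsum N N') (1%:M : 'M_(ydim M)) by rewrite -tot; apply: summand_sum.
split; first exact: summand_iso.
have := tbasis_sum tN tN' o1 o2; rewrite tot; set l := (fun k : nat => _) => tO.
apply: (cartan_tbasis ch0 ii HM fM sO tO).
  move=> j k; move/allrelP: d; apply; rewrite /l !inE; do ?case: ifP => _; by rewrite eqxx ?orbT.
apply: cartanA2A2_lab.
move: q; rewrite /allrel /= !andbT => /andP[/andP[q1 q2] /andP[q3 q4]].
move=> [[|[|[|[|j]]]] jm] [[|[|[|[|k]]]] km] //= _; rewrite /l /=;
  rewrite ?qp ?qr ?(negPf q1) ?(negPf q2) ?(negPf q3) ?(negPf q4) //;
  by rewrite addbC ?qp ?qr ?(negPf q1) ?(negPf q2) ?(negPf q3) ?(negPf q4).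
Qed.

End Cases.

Theorem theoremA (K : closedFieldType) (i : K) :
  [pchar K] =i pred0 ->
  i * i = -1 ->
  (forall b1 : K, b1 = 1 \/ b1 = -1 ->
     ~ fin_nichols (ydsum (Mpair K gxy gx) (W i b1 (-1)))
     /\ ~ fin_nichols (ydsum (Mpair K gy gxy) (W i b1 (-1)))) ->
  forall M : ydmod K, is_YD M -> (0 < ydim M)%N -> fin_nichols M ->
    (exists n1 n2 n3 n4 : nat, (1 <= n1 + n2 + n3 + n4)%N
        /\ yd_iso M (Omega1 i n1 n2 n3 n4)
        /\ cartan_type (Omega1 i n1 n2 n3 n4) (cartanA1s (n1 + n2 + n3 + n4)))
    \/ (exists n1 n2 : nat, yd_iso M (Omega2 i n1 n2)
        /\ cartan_type (Omega2 i n1 n2) (cartanA2A1s (n1 + n2)))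
    \/ (exists n1 n2 : nat, yd_iso M (Omega3 i n1 n2)
        /\ cartan_type (Omega3 i n1 n2) (cartanA2A1s (n1 + n2)))
    \/ (exists n1 n2 : nat, yd_iso M (Omega4 i n1 n2)
        /\ cartan_type (Omega4 i n1 n2) (cartanA2A1s (n1 + n2)))
    \/ (exists n1 n2 : nat, yd_iso M (Omega5 i n1 n2)
        /\ cartan_type (Omega5 i n1 n2) (cartanA2A1s (n1 + n2)))
    \/ (yd_iso M (Omega6 K) /\ cartan_type (Omega6 K) cartanA2A2)
    \/ (yd_iso M (Omega7 i) /\ cartan_type (Omega7 i) cartanA2A2).
Proof.
move=> ch0 ii inf M HM M0 fM.
pose mL c e := mult i M (inl (c, e)).
pose mP c := mult i M (inr (inl (c, false))).
pose mW b := mult i M (inr (inr (b, false))).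
have P1 c : mP c = 0%N \/ mP c = 1%N.
  by have := mult_pair_le1 ch0 ii HM fM c; rewrite -/(mP c); case: (mP c) => [|[|?]] //; [left|right].
have W1 b : mW b = 0%N \/ mW b = 1%N.
  by have := mult_W_le1 ch0 ii HM fM b; rewrite -/(mW b); case: (mW b) => [|[|?]] //; [left|right].
have LP c e : mP c = 1%N -> mL (~~ c) e = 0%N.
  move=> p1; apply/eqP; rewrite -leqn0 leqNgt; apply/negP => l0.
  by have := mult_line_pair ch0 ii HM fM l0 (eq_leq (esym p1)); case: (c).
have LW c b : mW b = 1%N -> mL c (~~ b) = 0%N.
  move=> w1; apply/eqP; rewrite -leqn0 leqNgt; apply/negP => l0.
  by have := mult_line_W ch0 ii HM fM l0 (eq_leq (esym w1)); case: (b).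
have PW c b : mP c = 1%N -> mW b = 0%N.
  move=> p1; case: (W1 b) => // w1.
  have := fin_pair_W ch0 ii HM fM (eq_leq (esym p1)) (eq_leq (esym w1)).
  (* The assumed infinite dimensions enter only here: a surviving pair and a surviving W would span
     a forbidden submodule. *)
  have [] := inf (sgn K b); first by case: (b); [right|left].
  by case: (c).
have L0 c e (H : mL c e = 0%N) := proj_mult0 ch0 ii HM fM H.
have P0 c (H : mP c = 0%N) := pair_proj0 ch0 ii HM fM H.
have W0 b (H : mW b = 0%N) := W_proj0 ch0 ii HM fM H.
have tot := proj_total ch0 ii HM fM.
have sL c e := summand_line ch0 ii HM fM c e.
have sP c (H : mP c = 1%N) := summand_pair1 ch0 ii HM fM H.
have sW b (H : mW b = 1%N) := summand_W1 ch0 ii HM fM H.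
have tP c (H : mP c = 1%N) := tbasis_pair ch0 ii HM fM H.
have tW b (H : mW b = 1%N) := tbasis_W ch0 ii HM fM H.
case: (P1 false) => [p0|p1]; last first.
  rewrite (W0 _ (PW _ false p1)) (W0 _ (PW _ true p1)) !(L0 _ _ (LP _ _ p1)) in tot.
  case: (P1 true) => [q0|q1].
    right; left; exists (mL false false), (mL false true).
    rewrite (P0 _ q0) !addr0 -addrA in tot.
    exact: (A2A1s_case ch0 ii HM fM (sL false false) (sL false true) (sP _ p1) (tP _ p1)).
  rewrite !(L0 _ _ (LP _ _ q1)) !addr0 !add0r in tot.
  do 5!right; left.
  exact: (A2A2_case ch0 ii HM fM (sP _ p1) (sP _ q1) (tP _ p1) (tP _ q1)).
rewrite (P0 _ p0) addr0 in tot.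
case: (P1 true) => [q0|q1]; last first.
  rewrite (W0 _ (PW _ false q1)) (W0 _ (PW _ true q1)) !(L0 _ _ (LP _ _ q1)) !addr0 !add0r -addrA in tot.
  right; right; left; exists (mL true false), (mL true true).
  exact: (A2A1s_case ch0 ii HM fM (sL true false) (sL true true) (sP _ q1) (tP _ q1)).
rewrite (P0 _ q0) addr0 in tot.
case: (W1 false) => [w0|w1]; last first.
  rewrite !(L0 _ _ (LW _ _ w1)) !addr0 in tot.
  case: (W1 true) => [w0'|w1'].
    rewrite (W0 _ w0') addr0 -addrA in tot.
    do 3!right; left; exists (mL false false), (mL true false).
    exact: (A2A1s_case ch0 ii HM fM (sL false false) (sL true false) (sW _ w1) (tW _ w1)).
  rewrite !(L0 _ _ (LW _ _ w1')) !add0r in tot.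
  do 6!right.
  exact: (A2A2_case ch0 ii HM fM (sW _ w1) (sW _ w1') (tW _ w1) (tW _ w1')).
rewrite (W0 _ w0) addr0 in tot.
case: (W1 true) => [w0'|w1']; last first.
  rewrite !(L0 _ _ (LW _ _ w1')) !addr0 !add0r -addrA in tot.
  do 4!right; left; exists (mL false true), (mL true true).
  exact: (A2A1s_case ch0 ii HM fM (sL false true) (sL true true) (sW _ w1') (tW _ w1')).
rewrite (W0 _ w0') addr0 in tot.
have orth t t' := @proj_orth K ch0 i ii M HM t t'.
have tL c e := tbasis_fam ch0 ii HM fM (inl (c, e)).
left; exists (mL false false), (mL false true), (mL true false), (mL true true).
have sO : summand (Omega1 i (mL false false) (mL false true) (mL true false) (mL true true)) (1%:M : 'M_(ydim M)).
  by rewrite -tot -!addrA; apply: (summand_sum (sL false false)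
      (summand_sum (sL false true) (summand_sum (sL true false) (sL true true) _ _) _ _));
    rewrite ?mulmxDl ?mulmxDr ?mulmxDl ?mulmxDr !orth // !addr0.
split; last split.
- rewrite lt0n; apply/negP; rewrite !addn_eq0 => /andP[/andP[/andP[/eqP z1 /eqP z2] /eqP z3] /eqP z4].
  (* With no line at all the identity of the nonzero module M would be the zero matrix. *)
  have /matrixP/(_ (Ordinal M0) (Ordinal M0)) := tot.
  by rewrite (L0 _ _ z1) (L0 _ _ z2) (L0 _ _ z3) (L0 _ _ z4) !addr0 !mxE eqxx => /eqP; rewrite eq_sym oner_eq0.
- exact: summand_iso.
pose E c e := proj i M (inl (c, e)).
have [o1 o2] : (E false false + E false true) *m E true false = 0 /\
    E true false *m (E false false + E false true) = 0.
  by rewrite mulmxDl mulmxDr /E !orth // addr0.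
have [o3 o4] : (E false false + E false true + E true false) *m E true true = 0 /\
    E true true *m (E false false + E false true + E true false) = 0.
  by rewrite !mulmxDl !mulmxDr /E !orth // !addr0.
have tO := tbasis_sum (tbasis_sum (tbasis_sum (tL false false) (tL false true)
  (orth (inl (false, false)) (inl (false, true)) isT) (orth (inl (false, true)) (inl (false, false)) isT))
  (tL true false) o1 o2) (tL true true) o3 o4.
rewrite tot in tO; set l := (fun k : nat => _) in tO.
have ll k : is_line (l k) by rewrite /l; do 3?case: ifP => _.
have [ld lA] := cartanA1s_lab (mL false false + mL false true + mL true false + mL true true)%N ll.
exact: (cartan_tbasis ch0 ii HM fM sO tO ld lA).
Qed.
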